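(* Let $\lambda\Vdash n$ be a strict partition and let $\mathcal U$ be a standard barred tableau of shape $\lambda$. For $a=1,\dots,n$ let $\kappa_a$ be the signed content of the entry $a$ or $\bar a$ of $\mathcal U$. Then the consecutive evaluations of the rational function $\Phi(u_1,\dots,u_n)$ at $u_1=\kappa_1$, then $u_2=\kappa_2$, ..., then $u_n=\kappa_n$ are well-defined and $$\Phi(u_1,\dots,u_n)\big|_{u_1=\kappa_1}\big|_{u_2=\kappa_2}\cdots\big|_{u_n=\kappa_n}=\frac{n!}{g_\lambda}\,e_{\mathcal U},$$ where $g_\lambda$ is the number of standard unbarred tableaux of shape $\lambda$.
   Context: All algebras are over $\mathbb C$. The Sergeev superalgebra $\mathcal S_n=\mathbb C\mathfrak S_n^-\otimes \mathcal{C}l_n$ is the graded tensor product of: the spin symmetric group algebra $\mathbb C\mathfrak S_n^-$, generated by odd $t_1,\dots,t_{n-1}$ with $t_a^2=1$, $t_at_{a+1}t_a=t_{a+1}t_at_{a+1}$, $t_at_b=-t_bt_a$ for $|a-b|>1$; and the Clifford superalgebra $\mathcal{C}l_n$, generated by odd $c_1,\dots,c_n$ with $c_a^2=-1$, $c_ac_b=-c_bc_a$ for $a\neq b$. In particular $t_ac_b=-c_bt_a$ for all $a,b$. For $k<n$, $\mathcal S_k\subset\mathcal S_n$ is generated by $t_1,\dots,t_{k-1},c_1,\dots,c_k$. For $a<b$ put $t_{ab}=(-1)^{b-a-1}t_{b-1}\cdots t_{a+1}t_at_{a+1}\cdots t_{b-1}$ and $t_{ba}=-t_{ab}$. Jucys--Murphy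 elements: $m_1=0$, $m_a=t_{1a}+\dots+t_{a-1,a}$ for $a\ge2$, and $x_a=\sqrt2\,m_ac_a$ for $a=1,\dots,n$. The $x_a$ commute pairwise. A strict partition $\lambda\Vdash n$ is $\lambda=(\lambda_1>\dots>\lambda_\ell>0)$ with sum $n$. Its shifted Young diagram has boxes $(i,j)$ with $1\le i\le\ell$, $i\le j\le i+\lambda_i-1$; boxes $(i,i)$ are diagonal. A standard (unbarred) tableau of shape $\lambda$ is a bijective filling of the boxes by $1,\dots,n$ with entries increasing along rows and down columns. A standard barred tableau is obtained from a standard tableau by putting bars on an arbitrary subset of the non-diagonal entries. The signed content of the entry $a$ (unbarred) or $\bar a$ (barred) in box $(i,j)$, with $\sigma=j-i$, is $\sqrt{\sigma(\sigma+1)}$, respectively $-\sqrt{\sigma(\sigma+1)}$. The elements $e_{\mathcal U}\in\mathcal S_n$ are defined inductively: $e_{\mathcal U}=1$ for the one-box tableau, and for $n\ge2$ $$e_{\mathcal U}=e_{\mathcal V}\,\frac{(x_n-b_1)\cdots(x_n-b_p)}{(\kappa-b_1)\cdots(\kappa-b_p)},$$ where $\mathcal V$ is obtained from $\mathcal U$ by removing the box containing $n$ or $\bar n$, $\kappa$ is the signed content of that entry, and $b_1,\dots,b_p$ are the signed contents of all possible entries $n$ or $\bar n$ (bars being allowed only in non-diagonal boxes) in all addable boxes of the shape $\mu$ of $\mathcal V$ (boxes whose addition to $\mu$ gives the shifted diagram of a strict partition), except for the actual entry of $\mathcal U$. For $a\ne b$ define the rational function with values in $\mathcal S_n$ $$\varphi_{ab}(u,v)=1+t_{ab}\,\frac{\sqrt2\,(u\,c_a-v\,c_b)}{u^2-v^2},$$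 and set $$\Phi(u_1,\dots,u_n)=\prod_{1\le a<b\le n}\varphi_{ab}(u_a,u_b),$$ the product taken (left to right) in the lexicographic order on the pairs $(a,b)$. The consecutive evaluation means: at each step $a$ one has a rational function in $u_a,\dots,u_n$ with values in $\mathcal S_n$, which is claimed to be regular at $u_a=\kappa_a$, and one substitutes $u_a=\kappa_a$. *)

(* Defs.v *)
From HB Require Import structures.
From mathcomp Require Import all_boot all_order all_algebra.
From mathcomp Require Import boolp complex.
From mathcomp.multinomials Require monalg.

Set Implicit Arguments.
Unset Strict Implicit.
Unset Printing Implicit Defensive.

Import Order.TTheory GRing.Theory Num.Theory.

Local Open Scope ring_scope.
Local Open Scope quotient_scope.

(* Indices are shifted by one: the mathematical index a = 1, ..., n is
   represented by a - 1 : 'I_n, and the k-th generator t_k, k = 1, ..., n - 1,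
   by k - 1 : 'I_n.-1.  Boxes (i, j) of shifted diagrams are shifted likewise,
   so j - i is unchanged. *)

(* monalg is imported locally: its notations clash with those of mpoly. *)
Module FreeAlgebra.
Import monalg.

Definition free_algebra (C : numClosedFieldType) (I : choiceType) : Type :=
  {malg C[{fmonom I}]}.

HB.instance Definition _ C I := GRing.Lalgebra.on (free_algebra C I).

Definition free_gen (C : numClosedFieldType) (I : choiceType) (x : I) :
  free_algebra C I := << fmu x >>.

Section Theory.
Variables (C : numClosedFieldType) (I : choiceType).
Implicit Types (x y : free_algebra C I).

Lemma free_scalerAr (k : C) x y : k *: (x * y) = x * (k *: y).
Proof.
have comm : malgC k * x = x * malgC k.
  rewrite (monalgE x) mulr_sumr mulr_suml; apply: eq_bigr => m _.
  by rewrite !malgM_def !fgmulUU mul1m mulm1 mulrC.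
transitivity ((malgC k * x) * y).
  by rewrite -mulrA mul_malgC.
by rewrite comm -(mulrA x (malgC k)); congr (x * _); exact: mul_malgC.
Qed.

Variables (S : algType C) (h : I -> S).

Definition free_eval x : S :=
  mmap (in_alg S) (fun m : {fmonom I} => \prod_(i <- m : seq I) h i) x.

Let hm (m : {fmonom I}) := \prod_(i <- m : seq I) h i.

Let hm_mmorph : mmorphism hm.
Proof. by split=> [m1 m2|]; rewrite /hm ?fmM ?big_cat // fm1 big_nil. Qed.

HB.instance Definition _ := isMultiplicative.Build _ _ hm hm_mmorph.

Lemma free_evalB : {morph free_eval : x y / x - y}.
Proof. exact: mmapB. Qed.

Lemma free_evalD : {morph free_eval : x y / x + y}.
Proof. exact: mmapD. Qed.

Lemma free_eval0 : free_eval 0 = 0.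
Proof. exact: mmap0. Qed.

Lemma free_eval_multiplicative : multiplicative free_eval.
Proof.
apply: (@commr_mmap_is_multiplicative _ _ _ (in_alg S) hm) => g m m'.
by rewrite /GRing.comm /= mulr_algl mulr_algr.
Qed.

Lemma free_evalM : {morph free_eval : x y / x * y}.
Proof. exact: free_eval_multiplicative.1. Qed.

Lemma free_eval1 : free_eval 1 = 1.
Proof. exact: free_eval_multiplicative.2. Qed.

Lemma free_eval_gen i : free_eval (free_gen C i) = h i.
Proof. by rewrite /free_eval mmapU /= scale1r mul1r fmU big_seq1. Qed.

End Theory.
End FreeAlgebra.
Import FreeAlgebra.

Section Presentation.
Variables (C : numClosedFieldType) (n : nat).

(* The last relation is the sign rule of the graded tensor product. *)
Inductive sergeev_rel (A : nzRingType) (t : 'I_n.-1 -> A) (c : 'I_n -> A) :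
    A -> Prop :=
| Rel_tt a : sergeev_rel t c (t a * t a - 1)
| Rel_braid (a b : 'I_n.-1) : b = a.+1 :> nat ->
    sergeev_rel t c (t a * t b * t a - t b * t a * t b)
| Rel_far (a b : 'I_n.-1) : (a.+1 < b)%N || (b.+1 < a)%N ->
    sergeev_rel t c (t a * t b + t b * t a)
| Rel_cc a : sergeev_rel t c (c a * c a + 1)
| Rel_anti (a b : 'I_n) : a != b -> sergeev_rel t c (c a * c b + c b * c a)
| Rel_tc a b : sergeev_rel t c (t a * c b + c b * t a).

(* inl a is t_(a+1), inr a is c_(a+1) *)
Definition letter : choiceType := ('I_n.-1 + 'I_n)%type.

Local Notation L := (free_algebra C letter).

Definition free_t (a : 'I_n.-1) : L := free_gen C (inl a : letter).
Definition free_c (a : 'I_n) : L := free_gen C (inr a : letter).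

Inductive sergeev_ideal : L -> Prop :=
| Ideal0 : sergeev_ideal 0
| IdealD x y : sergeev_ideal x -> sergeev_ideal y -> sergeev_ideal (x + y)
| IdealM p r q : sergeev_rel free_t free_c r -> sergeev_ideal (p * r * q).

Lemma sergeev_idealMl p x : sergeev_ideal x -> sergeev_ideal (p * x).
Proof.
elim=> [|y z _ Hy _ Hz|p' r q Hr]; first by rewrite mulr0; exact: Ideal0.
- by rewrite mulrDr; exact: IdealD.
- by rewrite !mulrA; exact: IdealM.
Qed.

Lemma sergeev_idealMr p x : sergeev_ideal x -> sergeev_ideal (x * p).
Proof.
elim=> [|y z _ Hy _ Hz|p' r q Hr]; first by rewrite mul0r; exact: Ideal0.
- by rewrite mulrDl; exact: IdealD.
- by rewrite -(mulrA (p' * r)); exact: IdealM.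
Qed.

Lemma sergeev_idealN x : sergeev_ideal x -> sergeev_ideal (- x).
Proof. by rewrite -mulN1r; exact: sergeev_idealMl. Qed.

Definition sergeev_eq : rel L :=
  fun x y => `[< sergeev_ideal (x - y) >].

Lemma sergeev_eq_refl : reflexive sergeev_eq.
Proof. by move=> x; apply/asboolP; rewrite subrr; exact: Ideal0. Qed.

Lemma sergeev_eq_sym : symmetric sergeev_eq.
Proof.
move=> x y; apply/asboolP/asboolP => /sergeev_idealN; rewrite opprB //.
Qed.

Lemma sergeev_eq_trans : transitive sergeev_eq.
Proof.
move=> y x z /asboolP Hx /asboolP Hy; apply/asboolP.
have -> : x - z = (x - y) + (y - z) by rewrite addrA subrK.
exact: IdealD.
Qed.

Definition sergeev_equiv : equiv_rel _ :=
  EquivRel sergeev_eq sergeev_eq_refl sergeev_eq_sym sergeev_eq_trans.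

End Presentation.

(* The Clifford algebra on m generators acts on a nonzero space: this gives the
   nontriviality of the Sergeev superalgebra. *)
Lemma clifford_mx (C : comNzRingType) (m : nat) :
  exists k (f : nat -> 'M[C]_k.+1),
    (forall i, (i < m)%N -> f i * f i = -1) /\
    (forall i j, (i < m)%N -> (j < m)%N -> i != j -> f i * f j = - (f j * f i)).
Proof.
elim: m => [|m [k [f [fsq fanti]]]]; first by exists 0%N, (fun=> 0); split.
pose g i : 'M[C]_(k.+1 + k.+1) :=
  if i == m then block_mx 0 1 (-1) 0 else block_mx (f i) 0 0 (- f i).
have N1E : -1 = block_mx (-1) 0 0 (-1) :> 'M[C]_(k.+1 + k.+1).
  transitivity (- 1%:M : 'M[C]_(k.+1 + k.+1)) => //.
  by rewrite scalar_mx_block opp_block_mx !oppr0.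
have gm : g m *m g m = -1.
  rewrite N1E /g eqxx mulmx_block !mul0mx !mulmx0 !add0r !addr0.
  by rewrite mul1mx mulmx1.
have gi i : (i < m)%N -> g i *m g i = -1.
  move=> im; rewrite /g (ltn_eqF im) mulmx_block !mul0mx !mulmx0 !add0r !addr0.
  by rewrite mulmxN mulNmx opprK -[f i *m f i]/(f i * f i) fsq // N1E.
have gim i : (i < m)%N -> g i *m g m = - (g m *m g i).
  move=> im; rewrite /g eqxx (ltn_eqF im) !mulmx_block.
  rewrite !mul0mx !mulmx0 !add0r !addr0 opp_block_mx !oppr0.
  by rewrite !(mulmxN, mulNmx) !mulmx1 !mul1mx !opprK.
exists (k + k.+1)%N, (g : nat -> 'M[C]_((k + k.+1).+1)); split.
  by move=> i; rewrite ltnS leq_eqVlt => /predU1P[->|/gi //]; exact: gm.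
move=> i j; rewrite ltnS leq_eqVlt => /predU1P[->|im];
  rewrite ltnS leq_eqVlt => /predU1P[->|jm] ij.
- by rewrite eqxx in ij.
- by apply: oppr_inj; rewrite opprK; apply: esym; exact: gim.
- exact: gim.
- change (g i *m g j = - (g j *m g i)).
  rewrite /g (ltn_eqF im) (ltn_eqF jm) !mulmx_block.
  rewrite !mul0mx !mulmx0 !add0r !addr0 opp_block_mx !oppr0.
  rewrite !(mulmxN, mulNmx) !opprK.
  by rewrite -[f i *m f j]/(f i * f j) fanti.
Qed.

Lemma sergeev_rel_morph n (A B : nzRingType) (f : A -> B)
    (t : 'I_n.-1 -> A) (c : 'I_n -> A) (t' : 'I_n.-1 -> B) (c' : 'I_n -> B) r :
  {morph f : x y / x + y} -> {morph f : x y / x - y} ->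
  {morph f : x y / x * y} -> f 1 = 1 -> f \o t =1 t' -> f \o c =1 c' ->
  sergeev_rel t c r -> sergeev_rel t' c' (f r).
Proof.
move=> fD fB fM f1 ft fc; have {ft}ft a : f (t a) = t' a by exact: ft.
have {fc}fc a : f (c a) = c' a by exact: fc.
by case=> *; rewrite ?(fB, fD) !fM ?f1 ?(ft, fc); constructor.
Qed.

Lemma sergeev_ideal1 (C : numClosedFieldType) (n : nat) :
  ~ sergeev_ideal (1 : free_algebra C (letter n)).
Proof.
have [k [f [fsq fanti]]] := clifford_mx C (n + n).
pose z : C := sqrtC (- (2%:R^-1)).
have zz : z * z *+ 2 = -1.
  by rewrite -expr2 sqrtCK mulNrn -[_^-1 *+ _]mulr_natr mulVf ?pnatr_eq0.
pose d i := f (n + i)%N.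
pose T i := z *: (d i - d i.+1).
pose h (x : letter n) := match x with inl a => T a | inr b => f b end.
have ltd1 (a : 'I_n.-1) : (n + a.+1 < n + n)%N.
  by rewrite ltn_add2l -ltn_predRL ltn_ord.
have ltd0 (a : 'I_n.-1) : (n + a < n + n)%N.
  by apply: ltn_trans (ltd1 a); rewrite addnS.
have ltc (a : 'I_n) : (a < n + n)%N by exact: ltn_addr.
have dsq i : (n + i < n + n)%N -> d i * d i = -1 by exact: fsq.
have danti i j : (n + i < n + n)%N -> (n + j < n + n)%N -> i != j ->
    d i * d j = - (d j * d i).
  by move=> ? ? ij; apply: fanti; rewrite // eqn_add2l.
pose A (x y : 'M[C]_k.+1) := x * y + y * x.
have AC x y : A x y = A y x by rewrite /A addrC.
have ABl x y w : A (x - y) w = A x w - A y w.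
  by rewrite /A mulrBl mulrBr opprD addrACA.
have AZl e x w : A (e *: x) w = e *: A x w.
  by rewrite /A -scalerAl -scalerAr scalerDr.
have Ad0 i j : (n + i < n + n)%N -> (n + j < n + n)%N -> i != j ->
    A (d i) (d j) = 0.
  by move=> ? ? ?; rewrite /A danti // addNr.
have Ad i : (n + i < n + n)%N -> A (d i) (d i) = -2%:R.
  by move=> ?; rewrite /A dsq // -mulr2n mulNrn.
have ATE i j : A (T i) (T j) = (z * z) *: (A (d i) (d j) - A (d i) (d j.+1)
                  - (A (d i.+1) (d j) - A (d i.+1) (d j.+1))).
  by rewrite /T AZl AC AZl scalerA AC ABl !(AC _ (_ - _)) !ABl
    !(AC (d j)) !(AC (d j.+1)).
have Tsq (a : 'I_n.-1) : T a * T a = 1.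
  have : A (T a) (T a) = 2%:R.
    rewrite ATE !Ad // !Ad0 //; last 2 first.
    - by rewrite eqn_leq ltnn.
    - by rewrite eqn_leq ltnn andbF.
    rewrite subr0 sub0r opprK -opprD -mulr2n scalerN -scalerMnr scalerMnl zz.
    by rewrite scaleN1r opprK.
  rewrite (_ : 2%:R = (2%:R : C) *: 1); last by rewrite scaler_nat.
  rewrite /A -mulr2n -scaler_nat => /(congr1 (GRing.scale (2%:R^-1 : C))).
  by rewrite !scalerA mulVf ?pnatr_eq0 // !scale1r.
have Tfar (a b : 'I_n.-1) : (a.+1 < b)%N -> A (T a) (T b) = 0.
  move=> ab; have ab0 : (a < b)%N := ltnW ab.
  by rewrite ATE !Ad0 ?subr0 ?scaler0 // ?eqSS ltn_eqF // ltnS ltnW.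
have Tadj (a b : 'I_n.-1) : b = a.+1 :> nat -> A (T a) (T b) = -1.
  move=> ab; have bn := ltd1 b; have an := ltd1 a; have a0 := ltd0 a.
  rewrite ATE ab in bn *; rewrite Ad // !Ad0 ?ltn_eqF //.
  by rewrite !subr0 sub0r opprK -scaler_nat scalerA mulr_natr zz scaleN1r.
have AT (a b : 'I_n.-1) : A (T a) (T b) = -1 ->
    T a * T b * T a = - T b - T a.
  by rewrite /A => /(canRL (addrK _)) ->; rewrite mulrBl -mulrA Tsq mulN1r mulr1
     addrC.
have rel0 r : sergeev_rel (n := n) (fun a => T a) (fun b => f b) r -> r = 0.
  case=> [a|a b ab|a b ab|a|a b ab|a b] /=.
  - by rewrite Tsq subrr.
  - rewrite AT ?Tadj // AT; last by rewrite AC Tadj.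
    by apply/eqP; rewrite subr_eq0 addrC.
  - by case/orP: ab => ab; [exact: Tfar|rewrite -/(A _ _) AC Tfar].
  - by rewrite fsq // addNr.
  - by rewrite fanti // addNr.
  - have cd e : (n + e < n + n)%N -> A (d e) (f b) = 0.
      move=> ne; rewrite /A fanti ?addNr //.
      by rewrite gtn_eqF // (leq_trans (ltn_ord b)) ?leq_addr.
    by rewrite -/(A (T a) (f b)) AZl ABl !cd // subrr scaler0.
have ideal0 x : sergeev_ideal x -> free_eval h x = 0.
  elim=> [|y w _ Hy _ Hw|p r q Hr]; first exact: free_eval0.
    by rewrite free_evalD Hy Hw addr0.
  rewrite !free_evalM (rel0 (free_eval h r)) ?mulr0 ?mul0r //.
  apply: sergeev_rel_morph Hr.
  - exact: free_evalD.
  - exact: free_evalB.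
  - exact: free_evalM.
  - exact: free_eval1.
  - by move=> a; exact: free_eval_gen.
  - by move=> a; exact: free_eval_gen.
by move=> /ideal0/eqP; rewrite free_eval1 oner_eq0.
Qed.

Definition sergeev (C : numClosedFieldType) (n : nat) :=
  {eq_quot (@sergeev_equiv C n)}.

HB.instance Definition _ C n := Choice.on (sergeev C n).
HB.instance Definition _ C n := EqQuotient.on (sergeev C n).

(* The operations are locked: unfolding them makes failing unification problems
   very slow. *)
HB.lock Definition sergeev_add (C : numClosedFieldType) (n : nat)
    (u v : sergeev C n) : sergeev C n :=
  \pi_(sergeev C n) (repr u + repr v).

HB.lock Definition sergeev_opp (C : numClosedFieldType) (n : nat)
    (u : sergeev C n) : sergeev C n :=
  \pi_(sergeev C n) (- repr u).

HB.lock Definition sergeev_mul (C : numClosedFieldType) (n : nat)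
    (u v : sergeev C n) : sergeev C n :=
  \pi_(sergeev C n) (repr u * repr v).

HB.lock Definition sergeev_scale (C : numClosedFieldType) (n : nat)
    (k : C) (u : sergeev C n) : sergeev C n :=
  \pi_(sergeev C n) (k *: repr u).

HB.lock Definition sergeev_t (C : numClosedFieldType) (n : nat)
    (a : 'I_n.-1) : sergeev C n :=
  \pi_(sergeev C n) (free_t C a).

HB.lock Definition sergeev_c (C : numClosedFieldType) (n : nat)
    (a : 'I_n) : sergeev C n :=
  \pi_(sergeev C n) (free_c C a).

Arguments sergeev_add {C n}.
Arguments sergeev_opp {C n}.
Arguments sergeev_mul {C n}.
Arguments sergeev_scale {C n}.
Arguments sergeev_t {C n}.
Arguments sergeev_c {C n}.

Section Algebra.
Variables (C : numClosedFieldType) (n : nat).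
Local Notation L := (free_algebra C (letter n)).
Local Notation sergeev := (sergeev C n).
Local Notation p := (\pi_sergeev).

Implicit Types (x y z : L) (u v w : sergeev).

Lemma sergeev_piP x y : p x = p y <-> sergeev_ideal (x - y).
Proof.
split=> [/eqmodP|H]; first by move/asboolP.
by apply/eqmodP/asboolP.
Qed.

Lemma sergeev_pi_surj u : exists x, u = p x.
Proof. by exists (repr u); rewrite reprK. Qed.

Lemma sergeev_reprK x : sergeev_ideal (repr (p x) - x).
Proof. by apply/sergeev_piP; rewrite reprK. Qed.

Lemma sergeev_addE x y : sergeev_add (p x) (p y) = p (x + y).
Proof.
rewrite unlock; apply/sergeev_piP; rewrite opprD addrACA.
by apply: IdealD; exact: sergeev_reprK.
Qed.

Lemma sergeev_oppE x : sergeev_opp (p x) = p (- x).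
Proof.
rewrite unlock; apply/sergeev_piP; rewrite -opprD.
exact/sergeev_idealN/sergeev_reprK.
Qed.

Lemma sergeev_mulE x y : sergeev_mul (p x) (p y) = p (x * y).
Proof.
rewrite unlock; apply/sergeev_piP; set x' := repr _; set y' := repr _.
have -> : x' * y' - x * y = (x' - x) * y' + x * (y' - y).
  by rewrite mulrBl mulrBr addrA subrK.
apply: IdealD; first exact/sergeev_idealMr/sergeev_reprK.
exact/sergeev_idealMl/sergeev_reprK.
Qed.

Lemma sergeev_scaleE k x : sergeev_scale k (p x) = p (k *: x).
Proof.
rewrite unlock; apply/sergeev_piP; rewrite -scalerBr -[_ - x]mul1r scalerAl.
exact/sergeev_idealMl/sergeev_reprK.
Qed.

Ltac sergeev_lift :=
  repeat (let u := fresh "u" in intro u);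
  repeat match goal with
  | u : _ |- _ => let x := fresh "x" in
      let E := fresh "E" in
      destruct (sergeev_pi_surj u) as [x E]; subst u
  end;
  rewrite ?(sergeev_addE, sergeev_oppE, sergeev_mulE, sergeev_scaleE).

Lemma sergeev_addA : associative (@sergeev_add C n).
Proof. by sergeev_lift; rewrite addrA. Qed.
Lemma sergeev_addC : commutative (@sergeev_add C n).
Proof. by sergeev_lift; rewrite addrC. Qed.
Lemma sergeev_add0 : left_id (p 0) (@sergeev_add C n).
Proof. by sergeev_lift; rewrite add0r. Qed.
Lemma sergeev_addN : left_inverse (p 0) (@sergeev_opp C n) (@sergeev_add C n).
Proof. by sergeev_lift; rewrite addNr. Qed.

HB.instance Definition _ := GRing.isZmodule.Build sergeev
  sergeev_addA sergeev_addC sergeev_add0 sergeev_addN.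

Lemma sergeev_mulA : associative (@sergeev_mul C n).
Proof. by sergeev_lift; rewrite mulrA. Qed.
Lemma sergeev_mul1l : left_id (p 1) (@sergeev_mul C n).
Proof. by sergeev_lift; rewrite mul1r. Qed.
Lemma sergeev_mul1r : right_id (p 1) (@sergeev_mul C n).
Proof. by sergeev_lift; rewrite mulr1. Qed.
Lemma sergeev_mulDl : left_distributive (@sergeev_mul C n) (@sergeev_add C n).
Proof. by sergeev_lift; rewrite mulrDl. Qed.
Lemma sergeev_mulDr : right_distributive (@sergeev_mul C n) (@sergeev_add C n).
Proof. by sergeev_lift; rewrite mulrDr. Qed.
Lemma sergeev_1neq0 : p 1 != p 0.
Proof. by apply/eqP => /sergeev_piP; rewrite subr0; exact: sergeev_ideal1. Qed.

HB.instance Definition _ := GRing.Zmodule_isNzRing.Build sergeev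
  sergeev_mulA sergeev_mul1l sergeev_mul1r sergeev_mulDl sergeev_mulDr
  sergeev_1neq0.

Lemma sergeev_scaleA a b u :
  sergeev_scale a (sergeev_scale b u) = sergeev_scale (a * b) u.
Proof. by move: u; sergeev_lift; rewrite scalerA. Qed.
Lemma sergeev_scale1 : left_id 1 (@sergeev_scale C n).
Proof. by sergeev_lift; rewrite scale1r. Qed.
Lemma sergeev_scaleDr : right_distributive (@sergeev_scale C n) +%R.
Proof.
move=> k u v; change (sergeev_scale k (sergeev_add u v) =
  sergeev_add (sergeev_scale k u) (sergeev_scale k v)).
by move: u v; sergeev_lift; rewrite scalerDr.
Qed.
Lemma sergeev_scaleDl u :
  {morph (@sergeev_scale C n)^~ u : a b / a + b}.
Proof.
move=> a b; change (sergeev_scale (a + b) u =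
  sergeev_add (sergeev_scale a u) (sergeev_scale b u)).
by move: u; sergeev_lift; rewrite scalerDl.
Qed.

HB.instance Definition _ := GRing.Zmodule_isLmodule.Build C sergeev
  sergeev_scaleA sergeev_scale1 sergeev_scaleDr sergeev_scaleDl.

Lemma sergeev_scaleAl (a : C) u v : a *: (u * v) = (a *: u) * v.
Proof.
change (sergeev_scale a (sergeev_mul u v) = sergeev_mul (sergeev_scale a u) v).
by move: u v; sergeev_lift; rewrite scalerAl.
Qed.

HB.instance Definition _ := GRing.Lmodule_isLalgebra.Build C sergeev
  sergeev_scaleAl.

Lemma sergeev_scaleAr (a : C) u v : a *: (u * v) = u * (a *: v).
Proof.
change (sergeev_scale a (sergeev_mul u v) = sergeev_mul u (sergeev_scale a v)).
by move: u v; sergeev_lift; rewrite free_scalerAr.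
Qed.

HB.instance Definition _ := GRing.Lalgebra_isAlgebra.Build C sergeev
  sergeev_scaleAr.

Lemma sergeev_rel_eq0 (r : sergeev) : sergeev_rel sergeev_t sergeev_c r -> r = 0.
Proof.
suff lift : sergeev_rel sergeev_t sergeev_c r ->
    exists2 x, sergeev_rel (@free_t C n) (@free_c C n) x & r = p x.
  case/lift=> x Hx ->; apply/sergeev_piP; rewrite subr0 -[x]mul1r -[_ * x]mulr1.
  exact: IdealM.
have pD x y : p x + p y = p (x + y) by exact: sergeev_addE.
have pN x : - p x = p (- x) by exact: sergeev_oppE.
have pM x y : p x * p y = p (x * y) by exact: sergeev_mulE.
have tE a : sergeev_t a = p (free_t C a) by rewrite unlock.
have cE a : sergeev_c a = p (free_c C a) by rewrite unlock.
have p1 : (1 : sergeev) = p 1 by [].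
case=> [a|a b ab|a b ab|a|a b ab|a b].
- by exists (free_t C a * free_t C a - 1); [exact: Rel_tt|rewrite tE p1 pM pN pD].
- exists (free_t C a * free_t C b * free_t C a
          - free_t C b * free_t C a * free_t C b); first exact: Rel_braid.
  by rewrite !tE !pM pN pD.
- exists (free_t C a * free_t C b + free_t C b * free_t C a).
    exact: Rel_far.
  by rewrite !tE !pM pD.
- by exists (free_c C a * free_c C a + 1); [exact: Rel_cc|rewrite cE p1 pM pD].
- exists (free_c C a * free_c C b + free_c C b * free_c C a).
    exact: Rel_anti.
  by rewrite !cE !pM pD.
- exists (free_t C a * free_c C b + free_c C b * free_t C a).
    exact: Rel_tc.
  by rewrite tE cE !pM pD.
Qed.

End Algebra.

From mathcomp.multinomials Require Import mpoly.

Section JucysMurphy.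
Variables (C : numClosedFieldType) (n : nat).
Local Notation S := (sergeev C n).

(* Generators by (shifted) natural number; 0 is a junk value out of range. *)
Definition t_ (k : nat) : S := if insub k is Some a then sergeev_t a else 0.
Definition c_ (k : nat) : S := if insub k is Some a then sergeev_c a else 0.

(* t_ab for a < b; the products are ordered from left to right *)
Definition transp_lt (a b : nat) : S :=
  (-1) ^+ (b - a).-1 *: ((\prod_(k <- rev (index_iota a.+1 b)) t_ k) * t_ a
                          * (\prod_(k <- index_iota a.+1 b) t_ k)).

Definition transp (a b : nat) : S :=
  if (a < b)%N then transp_lt a b else - transp_lt b a.

Definition jm_m (a : nat) : S := \sum_(0 <= k < a) transp k a.
Definition jm_x (a : nat) : S := sqrtC 2%:R *: (jm_m a * c_ a).

End JucysMurphy.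

Section Tableaux.

Definition strict (la : seq nat) : bool := sorted gtn la && (0%N \notin la).

Definition strict_partition (n : nat) (la : seq nat) : bool :=
  strict la && (sumn la == n).

Definition boxes (la : seq nat) : seq (nat * nat) :=
  [seq (i, (i + k)%N) | i <- iota 0 (size la), k <- iota 0 (nth 0%N la i)].

Definition box (la : seq nat) : finType := seq_sub (boxes la).

Definition diagonal (b : nat * nat) : bool := b.1 == b.2.

Variables (n : nat) (la : seq nat).

(* The entry a of a tableau is represented by a - 1 : 'I_n. *)
Definition standard (T : {ffun box la -> 'I_n}) : bool :=
  [&& injectiveb T, [forall a, exists b, T b == a],
      [forall b, forall b', ((val b).1 == (val b').1) && ((val b).2 < (val b').2)%N
         ==> (T b < T b')%N] &
      [forall b, forall b', ((val b).2 == (val b').2) && ((val b).1 < (val b').1)%N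
         ==> (T b < T b')%N]].

Definition num_standard : nat :=
  #|[set T : {ffun box la -> 'I_n} | standard T]|.

Record barred_filling := BarredFilling {
  entries : {ffun box la -> 'I_n};
  bars : {set box la}
}.

Definition standard_barred (U : barred_filling) : bool :=
  standard (entries U) && [forall b in bars U, ~~ diagonal (val b)].

End Tableaux.

Section Idempotents.
Variables (C : numClosedFieldType) (n : nat) (la : seq nat).
Variable U : barred_filling n la.

(* An entry without its value: its box, and whether it is barred. *)
Definition place : Type := ((nat * nat) * bool)%type.

Definition signed_content (p : place) : C :=
  let sigma := (p.1.2 - p.1.1)%N in
  (-1) ^+ p.2 * sqrtC (sigma * sigma.+1)%:R.

(* junk if k is not an entry *)
Definition entry_place (k : nat) : place :=
  if [pick b | val (entries U b) == k] is Some b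
  then (val b, b \in bars U) else ((0, 0), false)%N.

Definition kappa (k : nat) : C := signed_content (entry_place k).

(* the strict partition whose diagram consists of the boxes of the k smallest
   entries *)
Definition subshape (k : nat) : seq nat :=
  filter (leq 1)
    (map (fun i => #|[set b : box la |
                       ((val b).1 == i) && (entries U b < k)%N]|)
         (iota 0 (size la))).

(* For i = size mu, incr_nth mu i has a new last row of length 1. *)
Definition addable_boxes (mu : seq nat) : seq (nat * nat) :=
  [seq (i, (i + nth 0%N mu i)%N) | i <- iota 0 (size mu).+1 &
    strict (incr_nth mu i)].

Definition addable_places (mu : seq nat) : seq place :=
  [seq (b, e) | b <- addable_boxes mu,
                e <- if diagonal b then [:: false] else [:: false; true]].

Definition other_places (k : nat) : seq place :=
  [seq p <- addable_places (subshape k) | p != entry_place k].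

Definition e_factor (k : nat) : sergeev C n :=
  (\prod_(p <- other_places k) (kappa k - signed_content p))^-1 *:
    \prod_(p <- other_places k) (jm_x C n k - (signed_content p)%:A).

(* e_upto k is the element attached to the tableau formed by the k smallest
   entries of U, seen in the ambient superalgebra. *)
Fixpoint e_upto (k : nat) : sergeev C n :=
  match k with
  | 0 => 1
  | k'.+1 => if k' == 0%N then 1 else e_upto k' * e_factor k'
  end.

Definition e_tab : sergeev C n := e_upto n.

End Idempotents.

Arguments num_standard : clear implicits.

Section RationalFunctions.
Variables (C : numClosedFieldType) (A : algType C) (n : nat).

(* (N, D), with D != 0, is the A-valued rational function N / D in the variables
   u_1, ..., u_n, represented by 'X_0, ..., 'X_(n-1). *)
Definition ratfun : Type := ({mpoly A[n]} * {mpoly C[n]})%type.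

Definition scalar_mpoly (D : {mpoly C[n]}) : {mpoly A[n]} :=
  map_mpoly (in_alg A) D.

Definition rf_eq (F G : ratfun) : Prop :=
  scalar_mpoly F.2 * G.1 = scalar_mpoly G.2 * F.1.

Definition rf_const (a : A) : ratfun := (a%:MP, 1).
Definition rf_add (F G : ratfun) : ratfun :=
  (scalar_mpoly G.2 * F.1 + scalar_mpoly F.2 * G.1, F.2 * G.2).
Definition rf_mul (F G : ratfun) : ratfun := (F.1 * G.1, F.2 * G.2).

Definition subst (R : nzRingType) (a : 'I_n) (z : R) (p : {mpoly R[n]}) :
    {mpoly R[n]} :=
  mmap (@mpolyC n R) (fun i => if i == a then z%:MP else 'X_i) p.

(* F = N / D is regular at u_a = z when D can be chosen not to vanish identically
   there; G is the value, a rational function of the remaining variables. By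
   evaluates_uniq below it is determined by F. *)
Definition evaluates (a : 'I_n) (z : C) (F G : ratfun) : Prop :=
  [/\ F.2 != 0, G.2 != 0 &
   exists N D, [/\ rf_eq F (N, D), subst a z D != 0 &
                   rf_eq G (subst a z%:A N, subst a z D)]].

Lemma scalar_mpoly_comm D (p : {mpoly A[n]}) :
  scalar_mpoly D * p = p * scalar_mpoly D.
Proof.
rewrite /scalar_mpoly (mpolyE D) raddf_sum mulr_suml mulr_sumr.
apply: eq_bigr => m _; rewrite /= map_mpolyZ map_mpolyX -mul_mpolyC.
set z := (X in X%:MP).
have zp : z%:MP_[n] * p = p * z%:MP_[n].
  rewrite (mpolyE p) mulr_sumr mulr_suml; apply: eq_bigr => m' _.
  rewrite -[_ *: 'X_[m']]mul_mpolyC mulrA -mpolyCM -[RHS]mulrA -commr_mpolyX.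
  by rewrite mulrA -mpolyCM /z /= mulr_algl mulr_algr.
by rewrite -mulrA -commr_mpolyX mulrA zp mulrA.
Qed.

Lemma scalar_mpoly_inj D (p q : {mpoly A[n]}) : D != 0 ->
  scalar_mpoly D * p = scalar_mpoly D * q -> p = q.
Proof.
move=> D0 /eqP; rewrite -subr_eq0 -mulrBr => /eqP Dpq.
apply/eqP; rewrite -subr_eq0; apply: contraTT isT => pq0.
have sD m : (scalar_mpoly D)@_m = (D@_m)%:A by rewrite mcoeff_map_mpoly.
move: Dpq; set r := p - q in pq0 * => /(congr1 (mcoeff (mlead D + mlead r)%MM)).
rewrite mcoeff0 => /eqP.
have inj : injective (in_alg A).
  move=> x y /eqP; rewrite -subr_eq0 /= -scalerBl scaler_eq0 oner_eq0 orbF.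
  by rewrite subr_eq0 => /eqP.
have -> : mlead D = mlead (scalar_mpoly D).
  by rewrite /mlead (perm_big _ (msupp_map_mpoly D inj)).
rewrite mleadcM.
have -> : mlead (scalar_mpoly D) = mlead D.
  by rewrite /mlead (perm_big _ (msupp_map_mpoly D inj)).
by rewrite sD mulr_algl scaler_eq0 !mleadc_eq0 (negPf D0) (negPf pq0).
Qed.

Lemma rf_eq_refl F : rf_eq F F.
Proof. by []. Qed.

Lemma rf_eq_sym F G : rf_eq F G -> rf_eq G F.
Proof. by move=> /esym. Qed.

Lemma scalar_mpoly_AC D E (p : {mpoly A[n]}) :
  scalar_mpoly D * (scalar_mpoly E * p) = scalar_mpoly E * (scalar_mpoly D * p).
Proof. by rewrite !mulrA (scalar_mpoly_comm D). Qed.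

Lemma rf_eq_trans G F H : G.2 != 0 -> rf_eq F G -> rf_eq G H -> rf_eq F H.
Proof.
move=> G0; rewrite /rf_eq => FG GH; apply: (scalar_mpoly_inj G0).
exact: etrans (scalar_mpoly_AC _ _ _) (etrans (congr1 _ GH)
  (etrans (scalar_mpoly_AC _ _ _) (etrans (congr1 _ FG)
  (scalar_mpoly_AC _ _ _)))).
Qed.

Lemma substM (R : nzRingType) (a : 'I_n) (z : R) :
  (forall y, y * z = z * y) -> {morph subst a z : p q / p * q}.
Proof.
move=> zc; apply: (commr_mmap_is_multiplicative (f := @mpolyC n R) _ _).1.
- move=> i p; case: eqP => _; last exact: commr_mpolyX.
  rewrite /GRing.comm {1 2}(mpolyE p) mulr_sumr mulr_suml.
  apply: eq_bigr => m _; rewrite -[_ *: 'X_[m]]mul_mpolyC -mulrA -commr_mpolyX.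
  by rewrite !mulrA -!mpolyCM zc.
- move=> p m m'; apply: commr_prod => i _; apply: commrX.
  case: eqP => _; last exact: commr_mpolyX.
  by rewrite /GRing.comm -!mpolyCM zc.
Qed.

Lemma substD (R : nzRingType) (a : 'I_n) (z : R) :
  {morph subst a z : p q / p + q}.
Proof. exact: mmapD. Qed.

Lemma subst_scalar a z D :
  subst a z%:A (scalar_mpoly D) = scalar_mpoly (subst a z D).
Proof.
have sD p q : scalar_mpoly (p + q) = scalar_mpoly p + scalar_mpoly q.
  by rewrite /scalar_mpoly raddfD.
elim/mpolyind: D => [|c m p _ _ IH].
  by rewrite /scalar_mpoly raddf0 /subst !mmap0 raddf0.
have H : subst a z%:A (scalar_mpoly (c *: 'X_[m])) =
         scalar_mpoly (subst a z (c *: 'X_[m])).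
  rewrite /subst /scalar_mpoly map_mpolyZ map_mpolyX !mmapZ rmorphM /=.
  rewrite map_mpolyC !mmapX; congr (_ * _).
  rewrite /mmap1 rmorph_prod; apply: eq_bigr => i _; rewrite rmorphXn /=.
  by case: eqP => _; rewrite ?map_mpolyC ?map_mpolyX.
rewrite sD substD substD sD.
exact: (f_equal2 +%R H IH).
Qed.

Lemma evaluates_uniq a z F F' G G' :
  rf_eq F F' -> evaluates a z F G -> evaluates a z F' G' -> rf_eq G G'.
Proof.
move=> FF [F0 G0 [N [D [FN D0 GN]]]] [F0' G0' [N' [D' [FN' D0' GN']]]].
have NN : rf_eq (N, D) (N', D').
  exact: (@rf_eq_trans F _ _ F0 (rf_eq_sym FN) (@rf_eq_trans F' _ _ F0' FF FN')).
have zA y : y * z%:A = z%:A * y :> A by rewrite mulr_algl mulr_algr.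
pose H : ratfun := (subst a z%:A N, subst a z D).
pose H' : ratfun := (subst a z%:A N', subst a z D').
have EE : rf_eq H H'.
  have step E M : scalar_mpoly (subst a z E) * subst a z%:A M =
      subst a z%:A (scalar_mpoly E * M).
    by rewrite (substM a zA) subst_scalar.
  exact: etrans (step D N') (etrans (congr1 (subst a z%:A) NN)
    (esym (step D' N))).
exact: (@rf_eq_trans H G G' D0 GN
  (@rf_eq_trans H' H G' D0' EE (rf_eq_sym GN'))).
Qed.

End RationalFunctions.

Section Fusion.
Variables (C : numClosedFieldType) (n : nat).
Local Notation S := (sergeev C n).

(* 1 + t_ab sqrt 2 (u_a c_a - u_b c_b) / (u_a^2 - u_b^2) *)
Definition phi (a b : 'I_n) : ratfun S n :=
  rf_add (rf_const n 1)
    ((transp C n a b)%:MP *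
       ((sqrtC 2%:R : C)%:A%:MP * ('X_a * (c_ C n a)%:MP - 'X_b * (c_ C n b)%:MP)),
     'X_a ^+ 2 - 'X_b ^+ 2).

Definition lex_pairs : seq ('I_n * 'I_n) :=
  filter (fun p : 'I_n * 'I_n => (p.1 < p.2)%N)
    [seq (a, b) | a <- enum 'I_n, b <- enum 'I_n].

Definition Phi : ratfun S n :=
  \big[@rf_mul C S n/rf_const n 1]_(p <- lex_pairs) phi p.1 p.2.

End Fusion.

(* Main.v *)
(* Let m_1, ..., m_n be the odd Jucys-Murphy elements. A right weight vector
   of m_1 ^ 2, ..., m_k ^ 2 along a path of strict partitions ending in mu is
   killed by the product of the polynomials attached to the addable contents
   of mu, evaluated at m_(k+1). This is an induction on k: the intertwiner
   psi_k = (m_(k+1) ^ 2 - m_k ^ 2) t_k + m_k - m_(k+1) exchanges m_k and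
   m_(k+1) up to sign, its square is a scalar on weight vectors, and the
   braid relation excludes the contents that are not addable. As x_k ^ 2 = 2
   m_k ^ 2, it follows that e_U x_k = kappa_k e_U.

   If v x_i = kappa_i v for i < k, conjugation by the t_i (c_(i+1) - c_i)
   shows that v (u - x_k) is, up to a scalar function of u, v times the
   product of the phi_ik(-kappa_i, -u) in decreasing order of i, and these
   are the inverses of the phi_ik(kappa_i, u) up to scalars. Hence v
   phi_1k(kappa_1, u) ... phi_(k-1,k)(kappa_(k-1), u) is a scalar function of
   u times v (u - x_k)^-1, which has only simple poles, at the signed
   contents of the addable places. The lexicographic product equals the
   product by columns, so the evaluation u_k = kappa_k replaces the k-th
   column by a scalar multiple of the k-th factor of e_U. The product of
   these scalars is n! / g_lambda by Schur's formula, which follows from the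
   branching rule by a residue computation. *)

From HB Require Import structures.
Require Import Defs.
From mathcomp Require Import all_boot all_order all_algebra.
From mathcomp Require Import boolp reals complex.
From mathcomp Require Import ring zify.
From mathcomp.multinomials Require Import mpoly.

Set Implicit Arguments.
Unset Strict Implicit.
Unset Printing Implicit Defensive.

Import Order.TTheory GRing.Theory Num.Theory.

(** * Strict partitions and standard shifted tableaux *)

Section StrictSequences.
Implicit Types (mu nu : seq nat) (i j a k : nat).

(** Only the defining relations are used, neither semisimplicity of the superalgebra nor a basis of
    it, so everything is said about right eigenvectors. The obstacle is content 0: from v m_k^2 = 0
    alone one may not conclude v m_k = 0, yet a double zero there would give a double pole. Hence
    weights record v m_k = 0, the annihilating product has the simple factor X at content 0, and
    each exclusion of a content is sharpened accordingly at 0. The scalars come from phi_ik(u, v)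
    phi_ik(-u, -v) = 1 - 2 (u^2 + v^2) / (u^2 - v^2)^2. If u^2 = a (a + 1), the numerator and the
    denominator each split into two factors, attached to the parts a and a + 1, so a product over
    boxes telescopes to a product over rows. Nothing is ever divided by u - x_k: the difference
    quotient of the annihilating polynomial replaces the resolvent, and identities with cleared
    denominators are proved over the ring of polynomials in the variables. *)

Definition strictly_decreasing (F : nat -> nat) : Prop :=
  forall i, 0 < F i.+1 -> F i.+1 < F i.

Lemma strictP mu : reflect (0 \notin mu /\ strictly_decreasing (nth 0 mu))
  (strict mu).
Proof.
rewrite /strict andbC; apply: (iffP andP) => -[n0]; last first.
  move=> dec; split=> //; apply/(sortedP 0) => i isz; apply: dec.
  by rewrite lt0n; apply: contraNneq n0 => <-; apply: mem_nth.
move=> /(sortedP 0) dec; split=> // i i0; apply: dec.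
by move: i0; case: (ltnP i.+1 (size mu)) => // sz; rewrite nth_default.
Qed.

Lemma strict_gt0 mu i : strict mu -> (0 < nth 0 mu i) = (i < size mu).
Proof.
case/strictP => n0 _; case: (ltnP i) => [ilt|sz]; last by rewrite nth_default.
by rewrite lt0n; apply: contraNneq n0 => <-; apply: mem_nth.
Qed.

Lemma decreasing_gap F i d : strictly_decreasing F -> 0 < F (i + d) ->
  F (i + d) + d <= F i.
Proof.
move=> dec; elim: d => [|d IH]; first by rewrite !addn0.
rewrite addnS => d0; have := dec _ d0 => d1.
by rewrite addnS; apply: leq_trans (IH _); [lia|exact: leq_ltn_trans d1].
Qed.

Lemma strict_nth_inj mu i j : strict mu -> 0 < nth 0 mu i ->
  nth 0 mu i = nth 0 mu j -> i = j.
Proof.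
wlog: i j / i < j.
  move=> H st i0 e; case: (ltngtP i j) => // [ij|ji]; first exact: H.
  by apply/esym/H; rewrite -?e.
move=> ij /strictP[_ dec] i0 e.
have := @decreasing_gap _ i (j - i) dec; rewrite subnKC ?(ltnW ij) // -e; lia.
Qed.

Lemma strict_eq mu nu : strict mu -> strict nu ->
  nth 0 mu =1 nth 0 nu -> mu = nu.
Proof.
move=> smu snu e; apply: (@eq_from_nth _ 0) => [|i _]; last exact: e.
apply/eqP; rewrite eqn_leq; apply/andP; split; rewrite leqNgt.
  by rewrite -(strict_gt0 _ smu) e strict_gt0 // ltnn.
by rewrite -(strict_gt0 _ snu) -e strict_gt0 // ltnn.
Qed.

(** After its first zero [F] vanishes for good, so the filter truncates the list without shifting
    indices. This gives access to the rows of [subshape] and of [decr_row], both defined by such a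
    filter. *)
Lemma strict_filter F K : strictly_decreasing F ->
  (forall i, K <= i -> F i = 0) ->
  let mu := filter (leq 1) (map F (iota 0 K)) in
  strict mu /\ nth 0 mu =1 F.
Proof.
elim: K F => [|K IH] F dec F0 /=.
  by split=> // i; rewrite nth_nil F0.
rewrite (iotaDl 1 0) -map_comp.
have [|i Ki|st e] := IH (F \o S); [by move=> i; apply: dec|exact: F0|].
case: ltnP => [F00|F00]; last first.
  have Fz i : F i = 0.
    elim: i => [|i Fi]; first by apply/eqP; rewrite -leqn0.
    by apply/eqP; apply: contraTT isT; rewrite -lt0n => /dec; rewrite Fi.
  by split=> // i; rewrite e /= !Fz.
have e' : nth 0 (F 0 :: filter (leq 1) (map (F \o S) (iota 0 K))) =1 F.
  by case=> //= i; exact: e.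
split=> //; apply/strictP; split; last by move=> i; rewrite !e'; apply: dec.
rewrite inE negb_or eq_sym -lt0n F00 /=; by case/strictP: st.
Qed.

Lemma mem_strict mu a : 0 < a ->
  reflect (exists i, nth 0 mu i = a) (a \in mu).
Proof.
move=> a0; apply: (iffP (nthP 0)) => [[i _ <-]|[i ia]]; first by exists i.
exists i => //; case: (ltnP i (size mu)) => // sz.
by rewrite -ia nth_default in a0.
Qed.

Lemma mem_incr_nth mu i a : strict mu -> 0 < a ->
  (a \in incr_nth mu i) =
  (a == (nth 0 mu i).+1) || (a \in mu) && (a != nth 0 mu i).
Proof.
move=> st a0; apply/(mem_strict _ a0)/idP => [[j]|].
  rewrite nth_incr_nth; case: eqVneq => [->|ij] ja; rewrite -ja in a0 *.
    by rewrite eqxx.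
  rewrite add0n in a0 *; apply/orP; right; apply/andP; split.
    by apply/(mem_strict _ a0); exists j.
  by apply: contra ij => /eqP/(strict_nth_inj st a0) ->.
case/orP => [/eqP->|/andP[/(mem_strict _ a0)[j ja] ai]].
  by exists i; rewrite nth_incr_nth eqxx.
exists j; rewrite nth_incr_nth; case: eqVneq => // ij.
by move: ai; rewrite ij ja eqxx.
Qed.

Lemma notin0_incr_nth mu i : i <= size mu -> 0 \notin mu ->
  0 \notin incr_nth mu i.
Proof.
elim: mu i => [|m mu IH] [|i] //= ile.
  by rewrite !inE !negb_or => /andP[].
by rewrite !inE !negb_or => /andP[-> /(IH _ ile)].
Qed.

Lemma strict_incr_size mu i : strict (incr_nth mu i) -> i <= size mu.
Proof.
case/strictP=> n0 _; rewrite leqNgt; apply: contra n0 => sz.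
have : nth 0 (incr_nth mu i) (size mu) = 0.
  by rewrite nth_incr_nth nth_default // gtn_eqF.
by move=> <-; rewrite mem_nth // size_incr_nth; case: ifP; lia.
Qed.

Lemma strict_incr_notin mu i : strict mu -> strict (incr_nth mu i) ->
  (nth 0 mu i).+1 \notin mu.
Proof.
move=> st st'; apply/(mem_strict _ (ltn0Sn _)) => -[j ja].
have ij : i <> j by move=> e; rewrite e in ja; lia.
apply: ij; apply: (strict_nth_inj st'); rewrite !nth_incr_nth eqxx //.
by rewrite ja; case: eqVneq => // e; rewrite e in ja; lia.
Qed.

(** With [strict_incr_notin], this reduces addability of a box to the absence of one part, which is
    how [addable] expresses it for sets of parts. *)
Lemma strict_incr mu i : strict mu -> i <= size mu ->
  (nth 0 mu i).+1 \notin mu -> strict (incr_nth mu i).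
Proof.
move=> st ile ni; have /strictP[n0 dec] := st; apply/strictP.
split=> [|j]; first exact: notin0_incr_nth.
rewrite !nth_incr_nth; have := dec j; case: (eqVneq i j.+1) => [ij|ij].
  rewrite ij gtn_eqF // => _ _; move: ile; rewrite ij => jlt.
  have := jlt; rewrite -strict_gt0 // => j0; move: ni; rewrite ij.
  case: (ltngtP (nth 0 mu j.+1).+1 (nth 0 mu j)) => [//|lt _|-> /negP[]].
    by have := dec j; lia.
  exact: mem_nth.
by rewrite add0n => /[apply] d; rewrite ltn_addl.
Qed.

Lemma incr_nth_inj mu nu i : strict mu -> strict nu ->
  incr_nth mu i = incr_nth nu i -> mu = nu.
Proof.
move=> smu snu e; apply: strict_eq => // j.
by have := congr1 (nth 0 ^~ j) e; rewrite !nth_incr_nth => /addnI.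
Qed.

End StrictSequences.

Lemma mem_boxes la (p : nat * nat) :
  (p \in boxes la) = (p.1 <= p.2 < p.1 + nth 0 la p.1).
Proof.
case: p => i j /=; apply/allpairsPdep/idP => [[i' [k []]]|].
  rewrite !mem_iota /= add0n => ilt klt [-> ->].
  by rewrite leq_addr ltn_add2l.
move=> /andP[ij jlt]; exists i, (j - i); rewrite !mem_iota subnKC //.
split=> //; last by rewrite /= ltn_subLR.
rewrite leq0n add0n /= ltnNge; apply: contraTN jlt => sz.
by rewrite nth_default // addn0 -leqNgt.
Qed.

(** Applied to the boxes of a row with entries below k, it turns a count of boxes into the position
    where the prefix shape ends. *)
Lemma downset_card m (A : {set 'I_m}) :
  (forall o o' : 'I_m, o <= o' -> o' \in A -> o \in A) ->
  forall o : 'I_m, (o \in A) = (o < #|A|).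
Proof.
move=> down o; have lt_card k : k <= m -> #|[set o' : 'I_m | o' < k]| = k.
  have inj_widen (km : k <= m) : injective (widen_ord km).
    by move=> x y /(congr1 val) /= /val_inj.
  move=> km; rewrite -[RHS]card_ord -(card_imset _ (inj_widen km)).
  apply: eq_card => o'; rewrite inE; apply/idP/imsetP => [lt|[x _ ->]].
    by exists (Ordinal lt) => //; apply: val_inj.
  exact: (ltn_ord x).
apply/idP/idP => [oA|].
  rewrite -(lt_card o.+1) //; apply: subset_leq_card; apply/subsetP => o'.
  by rewrite inE ltnS => o'o; exact: down o'o oA.
apply: contraTT => oA; rewrite -leqNgt -(lt_card o (ltnW (ltn_ord o))).
apply: subset_leq_card; apply/subsetP => o' o'A; rewrite inE ltnNge.
by apply: contra oA => /down; apply.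
Qed.

(** * Shapes formed by the smallest entries of a tableau *)

Section Tableau.
Variables (n : nat) (la : seq nat) (T : {ffun box la -> 'I_n}).
Hypotheses (la_strict : strict la) (T_std : standard T).
Implicit Types (b : box la) (i j k : nat).

Lemma standard_inj : injective T.
Proof. by case/and4P: T_std => /injectiveP. Qed.

Lemma standard_surj (a : 'I_n) : exists b, T b = a.
Proof.
case/and4P: T_std => _ /forallP/(_ a)/existsP[b /eqP Tb] _ _; by exists b.
Qed.

Lemma standard_row b b' :
  (val b).1 = (val b').1 -> (val b).2 < (val b').2 -> T b < T b'.
Proof.
case/and4P: T_std => _ _ /forallP/(_ b)/forallP/(_ b')/implyP H _ e lt.
by apply: H; rewrite e eqxx.
Qed.

Lemma standard_col b b' :
  (val b).2 = (val b').2 -> (val b).1 < (val b').1 -> T b < T b'.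
Proof.
case/and4P: T_std => _ _ _ /forallP/(_ b)/forallP/(_ b')/implyP H e lt.
by apply: H; rewrite e eqxx.
Qed.

Definition row_count k i := #|[set b : box la | ((val b).1 == i) && (T b < k)]|.

Lemma mem_row_box i (o : 'I_(nth 0 la i)) : (i, i + o) \in boxes la.
Proof. by rewrite mem_boxes /= leq_addr ltn_add2l ltn_ord. Qed.

Definition row_box i (o : 'I_(nth 0 la i)) : box la := SeqSub (mem_row_box o).

Lemma row_boxE b (i := (val b).1) : exists2 o : 'I_(nth 0 la i),
  row_box o = b & (val b).2 = i + o.
Proof.
have /andP[ij jlt] : i <= (val b).2 < i + nth 0 la i.
  by have := valP b; rewrite mem_boxes.
have jm : (val b).2 - i < nth 0 la i by rewrite ltn_subLR.
exists (Ordinal jm); rewrite /= ?subnKC //.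
by apply: val_inj; rewrite /= subnKC // -surjective_pairing.
Qed.

Lemma row_countE k i :
  row_count k i = #|[set o : 'I_(nth 0 la i) | T (row_box o) < k]|.
Proof.
have f_inj : injective (@row_box i) by move=> o o' [/addnI/val_inj].
rewrite /row_count -(card_imset _ f_inj); apply: eq_card => b; rewrite inE.
apply/andP/imsetP => [[/eqP bi bk]|[o]]; last first.
  by rewrite inE => ok ->; rewrite /= eqxx.
subst i; have [o ob _] := row_boxE b.
by exists o; rewrite ?inE ob.
Qed.

Lemma row_countP k b : (T b < k) =
  ((val b).2 < (val b).1 + row_count k (val b).1).
Proof.
have [o ob ->] := row_boxE b; rewrite ltn_add2l row_countE -downset_card.
  by rewrite inE ob.
move=> o1 o2; rewrite !inE leq_eqVlt => /predU1P[/val_inj->//|oo'] o'k.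
by apply: ltn_trans o'k; apply: standard_row => //=; rewrite ltn_add2l.
Qed.

Lemma row_count_le k i : row_count k i <= nth 0 la i.
Proof. by rewrite row_countE -[leqRHS]card_ord max_card. Qed.

Lemma row_count_decreasing k : strictly_decreasing (row_count k).
Proof.
move=> i i0; set l := row_count k i.+1 in i0 *.
have lla : l <= nth 0 la i.+1 := row_count_le k i.+1.
have [_ dec] := strictP _ la_strict; have := dec i (leq_trans i0 lla) => lla'.
(* As row i + 1 starts one column later than row i, this is its last box with an entry below k; the
   box above it has position l in row i. *)
have m1 : (i.+1, i + l) \in boxes la by rewrite mem_boxes /=; lia.
have m0 : (i, i + l) \in boxes la by rewrite mem_boxes /=; lia.
have := row_countP k (SeqSub m1); rewrite /= -/l addSn ltnS leqnn => k1.
have := row_countP k (SeqSub m0); rewrite /= ltn_add2l => <-.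
by apply: ltn_trans k1; apply: standard_col.
Qed.

Lemma row_count0 i : row_count 0 i = 0.
Proof. by rewrite row_countE; apply: eq_card0 => o; rewrite !inE. Qed.

Lemma row_countn i : row_count n i = nth 0 la i.
Proof.
rewrite row_countE -[RHS]card_ord; apply: eq_card => o.
by rewrite !inE ltn_ord.
Qed.

Lemma row_countS (b : box la) i :
  row_count (T b).+1 i = ((val b).1 == i) + row_count (T b) i.
Proof.
rewrite {1}/row_count (cardsD1 b) inE ltnS leqnn andbT; congr (_ + _).
apply: eq_card => b'; rewrite !inE ltnS [in RHS]ltn_neqAle.
by rewrite val_eqE (inj_eq standard_inj) andbCA.
Qed.

Lemma row_count_box b : (val b).2 = (val b).1 + row_count (T b) (val b).1.
Proof.
have := row_countP (T b) b; have := row_countP (T b).+1 b.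
by rewrite row_countS eqxx ltnn ltnS leqnn; lia.
Qed.

(** Convertible to [subshape U k] when [T] is [entries U]. *)
Definition prefix_shape k :=
  filter (leq 1) (map (row_count k) (iota 0 (size la))).

Lemma prefix_shapeP k : strict (prefix_shape k) /\ nth 0 (prefix_shape k) =1
  row_count k.
Proof.
apply: strict_filter; first exact: row_count_decreasing.
move=> i sz; apply/eqP; rewrite -leqn0.
by apply: leq_trans (row_count_le k i) _; rewrite nth_default.
Qed.

Lemma prefix_shape_strict k : strict (prefix_shape k). Proof.
  by case: (prefix_shapeP k). Qed.

Lemma prefix_shape0 : prefix_shape 0 = [::].
Proof.
apply: strict_eq => //; first exact: prefix_shape_strict.
by move=> i; rewrite (proj2 (prefix_shapeP 0)) row_count0 nth_nil.
Qed.

Lemma prefix_shapen : prefix_shape n = la.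
Proof.
apply: strict_eq => //; first exact: prefix_shape_strict.
by move=> i; rewrite (proj2 (prefix_shapeP n)) row_countn.
Qed.

Lemma prefix_shapeS b : prefix_shape (T b).+1 =
  incr_nth (prefix_shape (T b)) (val b).1.
Proof.
have e i : nth 0 (incr_nth (prefix_shape (T b)) (val b).1) i =
  row_count (T b).+1 i.
  by rewrite nth_incr_nth (proj2 (prefix_shapeP _)) row_countS.
have [st e'] := prefix_shapeP (T b).+1.
apply: strict_eq => // [|i]; last by rewrite e e'.
apply/strictP; split; last by move=> i; rewrite !e; exact: row_count_decreasing.
apply: notin0_incr_nth; last by case/strictP: (prefix_shape_strict (T b)).
(* A box opened further down would leave an empty row just above it, against
   [row_count_decreasing]. *)
rewrite leqNgt; apply/negP => sz.
have /row_count_decreasing : 0 < row_count (T b).+1 (val b).1.-1.+1.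
  by rewrite prednK ?(leq_ltn_trans _ sz) // row_countS eqxx.
rewrite prednK ?(leq_ltn_trans _ sz) // !row_countS eqxx.
rewrite -!(proj2 (prefix_shapeP (T b))) [nth _ _ _.-1]nth_default; last by lia.
by case: eqVneq => // ; lia.
Qed.

Lemma box_shape b : val b =
  ((val b).1, (val b).1 + nth 0 (prefix_shape (T b)) (val b).1).
Proof.
by rewrite (proj2 (prefix_shapeP _)) -row_count_box -surjective_pairing.
Qed.

End Tableau.

(** * Standard tableaux as words of row indices *)

Section Words.
Implicit Types (w la mu : seq nat) (i j k : nat) (p q : nat * nat).

(* A standard tableau is encoded by the rows of its entries, the last entry
   first. *)
Definition word_shape w : seq nat := foldr (fun i mu => incr_nth mu i) [::] w.

Fixpoint word_ok w : bool :=
  if w is i :: w' then word_ok w' && strict (word_shape w) else true.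

Fixpoint word_boxes w : seq (nat * nat) :=
  if w is i :: w' then (i, i + nth 0 (word_shape w') i) :: word_boxes w' else
    [::].

Lemma word_shape_strict w : word_ok w -> strict (word_shape w).
Proof. by case: w => //= i w /andP[]. Qed.

Lemma mem_word_boxes w : word_boxes w =i boxes (word_shape w).
Proof.
elim: w => [|i w IH] p; first by rewrite mem_boxes nth_nil /=; lia.
rewrite inE IH !mem_boxes /= nth_incr_nth; case: p => a b /=.
rewrite xpair_eqE; case: eqVneq => [->|ai]; last by [].
by lia.
Qed.

Lemma word_boxes_uniq w : uniq (word_boxes w).
Proof.
by elim: w => //= i w ->; rewrite mem_word_boxes mem_boxes /= ltnn !andbF.
Qed.

Lemma size_word_boxes w : size (word_boxes w) = size w.
Proof. by elim: w => //= i w ->. Qed.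

Lemma word_boxes_rows w : map fst (word_boxes w) = w.
Proof. by elim: w => //= i w ->. Qed.

(** The two comparisons tested by [standard]. The condition [p.1 <= p.2] excludes positions left of
    the diagonal, which belong to no shifted diagram. *)
Definition box_before p q : bool :=
  (p.1 == q.1) && (p.1 <= p.2 < q.2) || (p.2 == q.2) && (p.1 < q.1).

Lemma boxes_ideal mu p q : strict mu -> box_before p q ->
  q \in boxes mu -> p \in boxes mu.
Proof.
case: p q => a b [a' b'] st; rewrite !mem_boxes /box_before /=.
case/orP => /andP[/eqP <-]; first by lia.
move=> lt /andP[h1 h2]; have /strictP[_ dec] := st.
have := @decreasing_gap _ a (a' - a) dec; rewrite subnKC ?(ltnW lt) //; lia.
Qed.

(** Each intermediate shape is a shifted diagram, hence closed under [box_before] by [boxes_ideal]: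
    when q is added, p is already there. The list is reversed because words start with the last
    entry. *)
Lemma index_word_boxes w p q : word_ok w -> box_before p q ->
  q \in word_boxes w ->
    index p (rev (word_boxes w)) < index q (rev (word_boxes w)).
Proof.
elim: w => //= i w IH /andP[ok st] pq; rewrite inE rev_cons -!cats1 !index_cat.
rewrite !mem_rev size_rev /=; set x := (i, _).
have xN : x \notin word_boxes w by have := word_boxes_uniq (i :: w) => /andP[].
case/orP => [/eqP qx|qw]; last first.
  rewrite qw (_ : p \in _) ?IH // mem_word_boxes.
  apply: (boxes_ideal (word_shape_strict ok) pq).
  by rewrite -mem_word_boxes.
have pq' : p != q.
  by apply: contraTneq pq => ->; rewrite /box_before !ltnn !andbF.
have pw : p \in word_boxes w.
  have : p \in word_boxes (i :: w).
    rewrite mem_word_boxes; apply: (boxes_ideal st pq).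
    by rewrite -(mem_word_boxes (i :: w)) qx /= inE eqxx.
  by rewrite /= inE -/x -qx (negPf pq').
rewrite pw qx (negPf xN) eqxx addn0.
by rewrite (leq_trans (n := size (rev (word_boxes w)))) ?size_rev //
  -(size_rev (word_boxes w)) index_mem mem_rev.
Qed.

Definition removable_row la i : bool :=
  (nth 0 la i == 1) || (nth 0 la i.+1 < (nth 0 la i).-1).

Definition decr_row la i : seq nat :=
  filter (leq 1) [seq nth 0 la j - (i == j) | j <- iota 0 (size la)].

Lemma decr_rowP la i : strict la -> removable_row la i ->
  strict (decr_row la i) /\ incr_nth (decr_row la i) i = la.
Proof.
move=> st rem; have /strictP[n0 dec] := st.
have [|j sz|st' e] := @strict_filter (fun j => nth 0 la j - (i == j)) (size la).
- move=> j; have := dec j; move: rem; rewrite /removable_row.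
  by case: (eqVneq i j) => [->|] //=; case: eqVneq => //=; lia.
- by rewrite nth_default.
split=> //; have i0 : 0 < nth 0 la i by move: rem; rewrite /removable_row; lia.
have e' : nth 0 (incr_nth (decr_row la i) i) =1 nth 0 la.
  by move=> j; rewrite nth_incr_nth e; case: eqVneq => [<-|]; lia.
apply: strict_eq => //; apply/strictP; split; last first.
  by move=> j; rewrite !e'; exact: dec.
apply: notin0_incr_nth; last by case/strictP: st'.
rewrite leqNgt; apply/negP => sz.
have : nth 0 (decr_row la i) i.-1 = 0 by apply: nth_default; lia.
rewrite e; have -> : i == i.-1 = false by lia.
rewrite subn0 => z; have := dec i.-1; rewrite prednK ?(leq_ltn_trans _ sz) //.
by rewrite z; lia.
Qed.

Lemma removable_incr mu i : strict mu -> strict (incr_nth mu i) ->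
  removable_row (incr_nth mu i) i.
Proof.
move=> /strictP[_ dec] /strictP[_ dec']; rewrite /removable_row.
rewrite !nth_incr_nth eqxx; have -> : i == i.+1 = false by lia.
rewrite add0n /= add1n eqSS; have := dec i; have := dec' i.
by rewrite !nth_incr_nth; lia.
Qed.

(** Enumeration by the row of the last box, so that the branching rule [size_wordsS] holds by
    computation. *)
Fixpoint words k la : seq (seq nat) :=
  if k is k'.+1 then
    flatten [seq [seq i :: w | w <- words k' (decr_row la i)]
            | i <- iota 0 (size la) & removable_row la i]
  else if la == [::] then [:: [::]] else [::].

Lemma mem_words k la w : strict la ->
  (w \in words k la) = [&& size w == k, word_ok w & word_shape w == la].
Proof.
elim: k la w => [|k IH] la w st.
  by case: w => [|i w] /=; rewrite ?andbF; case: eqVneq => // ->.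
apply/flatten_mapP/and3P => [[j]|[]].
  rewrite mem_filter => /andP[rem _] /mapP[w' + ->] /=.
  have [st' e] := decr_rowP st rem.
  rewrite IH // => /and3P[/eqP -> ok /eqP wsh]; rewrite wsh e.
  by rewrite eqSS !eqxx ok.
case: w => // i w /= szw /andP[ok st'] /eqP wla.
have rem : removable_row la i.
  by rewrite -wla; apply: removable_incr => //; exact: word_shape_strict.
have [st'' e] := decr_rowP st rem.
exists i.
  rewrite mem_filter rem mem_iota add0n /= -strict_gt0 //.
  by rewrite -wla nth_incr_nth eqxx.
apply: map_f; rewrite IH // -(eqSS (size w)) szw ok /=; apply/eqP.
by apply: (@incr_nth_inj _ _ i); rewrite ?e // word_shape_strict.
Qed.

Lemma words_uniq k la : uniq (words k la).
Proof.
elim: k la => [|k IH] la /=; first by case: ifP.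
elim: [seq _ <- _ | _] (filter_uniq (removable_row la) (iota_uniq 0 (size la)))
  => //= i s IHs.
move=> /andP[si us]; rewrite cat_uniq IHs // andbT map_inj_uniq ?IH /=;
  last first.
  by move=> w w' [].
apply/hasPn => w /flatten_mapP[j js /mapP[w' _ ->]].
by apply/negP => /mapP[w'' _ [ji _]]; rewrite -ji js in si.
Qed.

Lemma size_wordsS k la : size (words k.+1 la) =
  \sum_(i < size la | removable_row la i) size (words k (decr_row la i)).
Proof.
rewrite /= size_flatten /shape -map_comp sumnE big_map big_filter.
rewrite -(big_mkord (removable_row la)
  (fun i => size (words k (decr_row la i)))).
by rewrite /index_iota subn0; apply: eq_bigr => i _; rewrite /= size_map.
Qed.

End Words.

Section TableauWords.
Variables (n : nat) (la : seq nat).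
Hypothesis la_strict : strict la.
Implicit Types (T : {ffun box la -> 'I_n}).

Definition entry_row T k : nat :=
  if [pick b | val (T b) == k] is Some b then (val b).1 else 0.

Definition prefix_word T k : seq nat :=
  [seq entry_row T j | j <- rev (iota 0 k)].

Lemma prefix_wordS T k : prefix_word T k.+1 = entry_row T k :: prefix_word T k.
Proof. by rewrite /prefix_word -addn1 iotaD rev_cat. Qed.

Lemma entry_rowE T b : standard T -> entry_row T (T b) = (val b).1.
Proof.
move=> std; rewrite /entry_row; case: pickP => [b' /eqP/val_inj|/(_ b)].
  by move/(standard_inj std) ->.
by rewrite eqxx.
Qed.

Lemma standard_entry T k : standard T -> (k < n)%N -> exists b, T b = k :> nat.
Proof.
by move=> std kn; have [b Tb] := standard_surj std (Ordinal kn); exists b;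
  rewrite Tb.
Qed.

Lemma prefix_wordP T k : standard T -> (k <= n)%N ->
  word_ok (prefix_word T k) /\ word_shape (prefix_word T k) = prefix_shape T k.
Proof.
move=> std; elim: k => [|k IH] kn; first by rewrite prefix_shape0.
have [ok e] := IH (ltnW kn); have [b Tb] := standard_entry std kn.
have eS : incr_nth (prefix_shape T k) (entry_row T k) = prefix_shape T k.+1.
  by rewrite -Tb entry_rowE // (prefix_shapeS la_strict std).
by rewrite prefix_wordS /= e eS ok prefix_shape_strict.
Qed.

(** By [box_shape], the row of an entry and the shape of the smaller entries determine its box. *)
Lemma prefix_word_inj T T' : standard T -> standard T' ->
  prefix_word T n = prefix_word T' n -> T = T'.
Proof.
move=> std std' /eq_in_map e.
have {}e k : (k < n)%N -> entry_row T k = entry_row T' k.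
  by move=> kn; apply: e; rewrite mem_rev mem_iota.
have ew k : (k <= n)%N -> prefix_word T k = prefix_word T' k.
  move=> kn; apply/eq_in_map => j; rewrite mem_rev mem_iota add0n => /= jk.
  by apply: e; exact: leq_trans jk kn.
apply/ffunP => b; have [b' Tb'] := standard_entry std' (ltn_ord (T b)).
suff bb' : b = b' by apply: val_inj; rewrite /= -Tb' -bb'.
apply: val_inj; rewrite (box_shape la_strict std b)
  (box_shape la_strict std' b').
rewrite -(entry_rowE b std) -(entry_rowE b' std') Tb' e //.
have ltk := ltnW (ltn_ord (T b)).
by rewrite -(proj2 (prefix_wordP std ltk)) -(proj2 (prefix_wordP std' ltk)) ew.
Qed.

Section OfWord.
Variable w : seq nat.
Hypotheses (w_ok : word_ok w) (w_la : word_shape w = la) (w_n : size w = n).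

Let bs := rev (word_boxes w).

Let mem_bs (b : box la) : val b \in bs.
Proof. by rewrite mem_rev mem_word_boxes w_la; exact: valP. Qed.

Lemma index_word_lt (b : box la) : (index (val b) bs < n)%N.
Proof. by rewrite -w_n -size_word_boxes -size_rev index_mem. Qed.

Definition word_tableau : {ffun box la -> 'I_n} :=
  [ffun b => Ordinal (index_word_lt b)].

Lemma word_tableau_standard : standard word_tableau.
Proof.
have before b b' : box_before (val b) (val b') ->
    (word_tableau b < word_tableau b')%N.
  move=> bb'; rewrite !ffunE /=; apply: index_word_boxes => //.
  by have := mem_bs b'; rewrite mem_rev.
have le_diag (b : box la) : ((val b).1 <= (val b).2)%N.
  by have := valP b; rewrite mem_boxes => /andP[].
apply/and4P; split.
- apply/injectiveP => b b'; rewrite !ffunE => /(congr1 val) /= e.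
  apply: val_inj; rewrite -[LHS](nth_index (0, 0)%N (mem_bs b)) e.
  by rewrite nth_index ?mem_bs.
- apply/forallP => a; apply/existsP.
  have an : (a < size bs)%N by rewrite size_rev size_word_boxes w_n.
  have ma : nth (0, 0)%N bs a \in boxes la.
    by rewrite -w_la -mem_word_boxes -mem_rev mem_nth.
  exists (SeqSub ma); rewrite ffunE; apply/eqP/val_inj => /=.
  by rewrite index_uniq // rev_uniq word_boxes_uniq.
- apply/forallP => b; apply/forallP => b'; apply/implyP => /andP[e lt].
  by apply: before; rewrite /box_before e lt le_diag.
- apply/forallP => b; apply/forallP => b'; apply/implyP => /andP[e lt].
  by apply: before; rewrite /box_before e lt orbT.
Qed.

Lemma word_tableauK : prefix_word word_tableau n = w.
Proof.
apply: (can_inj revK); rewrite /prefix_word -map_rev revK.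
rewrite -[in RHS](word_boxes_rows w) -map_rev -/bs.
apply: (@eq_from_nth _ 0);
  first by rewrite !size_map size_iota size_rev size_word_boxes.
move=> k; rewrite size_map size_iota => kn.
have ks : (k < size bs)%N by rewrite size_rev size_word_boxes w_n.
have ma : nth (0, 0)%N bs k \in boxes la.
  by rewrite -w_la -mem_word_boxes -mem_rev mem_nth.
rewrite (nth_map 0) ?size_iota // nth_iota // add0n.
rewrite (nth_map (0, 0)%N) //.
have kE : word_tableau (SeqSub ma) = k :> nat.
  by rewrite ffunE /= index_uniq // rev_uniq word_boxes_uniq.
by have := entry_rowE (SeqSub ma) word_tableau_standard; rewrite kE.
Qed.

End OfWord.

Lemma num_standard_words : num_standard n la = size (words n la).
Proof.
rewrite /num_standard cardE; set s := enum _.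
rewrite -(size_map (prefix_word^~ n) s).
apply: perm_size; apply: uniq_perm; last 1 first.
- move=> w; rewrite mem_words //;
  apply/mapP/and3P => [[T]|[/eqP sw ok /eqP wla]].
    rewrite mem_enum inE => std ->; rewrite size_map size_rev size_iota eqxx.
    have [ok e] := prefix_wordP std (leqnn n).
    by rewrite ok e prefix_shapen.
  exists (word_tableau wla sw); last by rewrite word_tableauK.
  by rewrite mem_enum inE word_tableau_standard.
- rewrite map_inj_in_uniq ?enum_uniq // => T T'; rewrite !mem_enum !inE.
  exact: prefix_word_inj.
- exact: words_uniq.
Qed.

End TableauWords.

Local Open Scope ring_scope.

(** * The spectrum of the odd Jucys-Murphy elements *)

(** Once a noncommutative identity is fully expanded, what remains is linear in the monomials and is
    decided by comparing integer coefficients. *)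
Inductive zexpr := ZVar of nat | ZZero | ZAdd of zexpr & zexpr | ZOpp of zexpr.

Section ZExpr.
Variable V : zmodType.

Fixpoint zeval (e : seq V) (x : zexpr) : V :=
  match x with
  | ZVar i => e`_i
  | ZZero => 0
  | ZAdd y z => zeval e y + zeval e z
  | ZOpp y => - zeval e y
  end.

Fixpoint zcoef (x : zexpr) (i : nat) : int :=
  match x with
  | ZVar j => (i == j)%:R
  | ZZero => 0
  | ZAdd y z => zcoef y i + zcoef z i
  | ZOpp y => - zcoef y i
  end.

Lemma zevalE e x : zeval e x = \sum_(i < size e) e`_i *~ zcoef x i.
Proof.
elim: x => [j||y IHy z IHz|y IHy] /=.
- have [jle|jge] := ltnP j (size e).
    rewrite (bigD1 (Ordinal jle)) //= eqxx mulr1z big1 ?addr0 // => i.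
    by rewrite -val_eqE /= => /negPf->; rewrite mulr0z.
  rewrite nth_default // big1 // => i _.
  by rewrite ltn_eqF ?mulr0z // (leq_trans (ltn_ord i)).
- by rewrite big1 // => i _; rewrite mulr0z.
- by rewrite IHy IHz -big_split; apply: eq_bigr => i _; rewrite mulrzDr.
- by rewrite IHy -sumrN; apply: eq_bigr => i _; rewrite mulrNz.
Qed.

Lemma zexprP e x y :
  all (fun i => zcoef x i == zcoef y i) (iota 0 (size e)) ->
  zeval e x = zeval e y.
Proof.
move/allP=> xy; rewrite !zevalE; apply: eq_bigr => i _.
by rewrite (eqP (xy i _)) // mem_iota ltn_ord.
Qed.
End ZExpr.

Ltac zindex a l :=
  match l with
  | ?b :: _ => let _ := match tt with _ => unify a b end in constr:(0%N)
  | _ :: ?l' => let i := zindex a l' in constr:(i.+1)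
  end.
Ltac zatoms x l :=
  match x with
  | ?a + ?b => let l' := zatoms a l in zatoms b l'
  | - ?a => zatoms a l
  | 0 => l
  | _ => match l with
         | _ => let _ := zindex x l in l
         | _ => constr:(x :: l)
         end
  end.
Ltac zreify x l :=
  match x with
  | ?a + ?b => let a' := zreify a l in let b' := zreify b l in
               constr:(ZAdd a' b')
  | - ?a => let a' := zreify a l in constr:(ZOpp a')
  | 0 => constr:(ZZero)
  | _ => let i := zindex x l in constr:(ZVar i)
  end.
(* Decides equalities that hold in every abelian group, with the products as
   atoms. *)
Ltac zmodule :=
  match goal with
  | |- @eq ?V ?x ?y =>
    let l := zatoms x (@nil V) in let l := zatoms y l in
    let x' := zreify x l in let y' := zreify y l in
    exact: (@zexprP _ l x' y' isT)
  end.
Ltac expand := rewrite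
  ?(mulrDl, mulrDr, mulrN, mulNr, mulrA, mulr1, mul1r, mulr0, mul0r).
Ltac nc := expand; zmodule.

(** * Anticommutation, the odd Jucys-Murphy elements and their intertwiners *)

Section Anticommutation.
Variable B : nzRingType.
Implicit Types x y z : B.

Definition anti x y := x * y = - (y * x).

Lemma anti_sym x y : anti x y -> anti y x.
Proof. by rewrite /anti => ->; rewrite opprK. Qed.

Lemma antiA x y z : anti x y -> z * x * y = - (z * y * x).
Proof. by rewrite -!mulrA => ->; rewrite mulrN. Qed.

Lemma antiB x y z : anti x y -> anti x z -> anti x (y - z).
Proof. by rewrite /anti mulrBr mulrBl => -> ->; rewrite opprB opprK addrC. Qed.

Lemma antiN x y : anti x y -> anti x (- y).
Proof. by rewrite /anti mulrN mulNr => ->. Qed.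

Lemma anti_sandwich x y z : anti x y -> anti x z -> anti x (y * z * y).
Proof.
move=> xy xz; rewrite /anti !mulrA xy mulNr (antiA _ xz) opprK.
by rewrite (antiA _ xy).
Qed.

Lemma anti_comm2 x y : anti x y -> x * (y * y) = y * y * x.
Proof. by move=> xy; rewrite mulrA xy mulNr (antiA _ xy) opprK. Qed.

End Anticommutation.

Section SpinRelations.
Variables (B : nzRingType) (N : nat) (t : nat -> B).

Definition spin_rel : Prop :=
  [/\ forall k, (k < N)%N -> t k * t k = 1,
      forall k, (k.+1 < N)%N -> t k * t k.+1 * t k = t k.+1 * t k * t k.+1 &
      forall j k, (j.+1 < k < N)%N -> anti (t j) (t k)].

(** The conjugation recursion replaces the sum of transpositions, so that the relations follow by
    induction on k; [jm_sum] recovers the sum. With shifted indices, [jm k] has k summands. *)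
Fixpoint jm_rec (k : nat) : B :=
  if k is k'.+1 then t k' - t k' * jm_rec k' * t k' else 0.

(* Locked, as jm k.+1 would otherwise unify with a sum. *)
Definition jm := locked jm_rec.

Lemma jm0 : jm 0 = 0. Proof. by rewrite /jm -lock. Qed.

Lemma jmS k : jm k.+1 = t k - t k * jm k * t k.
Proof. by rewrite /jm -lock. Qed.

Hypothesis tP : spin_rel.

Let t2 k : (k < N)%N -> t k * t k = 1. Proof. by case: tP => + _ _; apply. Qed.
Let t2A k z : (k < N)%N -> z * t k * t k = z.
Proof. by move=> kN; rewrite -mulrA t2 ?mulr1. Qed.
Let braid k : (k.+1 < N)%N -> t k * t k.+1 * t k = t k.+1 * t k * t k.+1.
Proof. by case: tP => _ + _; apply. Qed.
Let braidA z k : (k.+1 < N)%N ->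
  z * t k * t k.+1 * t k = z * t k.+1 * t k * t k.+1.
Proof. by move=> kN; rewrite -!mulrA (mulrA (t k)) braid // !mulrA. Qed.
Let far j k : (j.+1 < k < N)%N -> anti (t j) (t k).
Proof. by case: tP => _ _; apply. Qed.

(** The spin analogue of the relation between a simple transposition and the polynomial generators
    in the degenerate affine Hecke algebra. *)
Lemma t_jm k : (k < N)%N -> t k * jm k = 1 - jm k.+1 * t k.
Proof.
by move=> kN; rewrite jmS mulrBl t2 // t2A // opprB addrCA subrr addr0.
Qed.

Lemma jm_t k : (k < N)%N -> jm k * t k = 1 - t k * jm k.+1.
Proof.
move=> kN; rewrite jmS mulrBr t2 // !mulrA t2 // mul1r opprB addrCA subrr.
by rewrite addr0.
Qed.

Lemma t_jm_gt k j : (k < j < N)%N -> anti (t j) (jm k).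
Proof.
elim: k => [|k IH] /andP[kj jN]; first by rewrite jm0 /anti mulr0 mul0r oppr0.
have tk : anti (t j) (t k) by apply/anti_sym/far; rewrite kj.
by rewrite jmS; apply: antiB => //; apply: anti_sandwich => //; apply: IH;
  rewrite (ltnW kj).
Qed.

Lemma t_conj_anti k z : (k.+1 < N)%N -> anti (t k.+1) z ->
  anti (t k) (t k.+1 * t k * z * t k * t k.+1).
Proof.
move=> kN az; by rewrite /anti !mulrA braid // (antiA _ az) braidA // !mulNr.
Qed.

Lemma t_jm_lt j k : (j.+1 < k <= N)%N -> anti (t j) (jm k).
Proof.
elim: k => // k IH /andP[]; rewrite ltnS leq_eqVlt => /predU1P[<-|jk] kN.
  (* Two steps of the recursion. Conjugation by t_j exchanges t_(j+1) and t_(j+1) t_j t_(j+1), hence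
     negates their difference; the last summand is covered by [t_conj_anti]. *)
  have -> : jm j.+2 = (t j.+1 - t j.+1 * t j * t j.+1)
                      + t j.+1 * t j * jm j * t j * t j.+1.
    by rewrite !jmS; nc.
  have := t_conj_anti kN (@t_jm_gt j j.+1 _);
    rewrite ltnS leqnn kN => /(_ isT) e.
  rewrite /anti mulrDr e mulrBr !mulrA braid // t2A // mulrDl mulrBl.
  by rewrite -braid // t2A // 1?ltnW //; nc.
have tk : anti (t j) (t k) by apply/far; rewrite jk kN.
by rewrite jmS; apply: antiB => //; apply: anti_sandwich => //; apply: IH;
  rewrite jk ltnW.
Qed.

Lemma jm_anti j k : (j < k <= N)%N -> anti (jm j) (jm k).
Proof.
elim: j => [|j IH] /andP[jk kN]; first by rewrite jm0 /anti mulr0 mul0r oppr0.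
have tk : anti (jm k) (t j) by apply/anti_sym/t_jm_lt; rewrite jk.
rewrite jmS; apply/anti_sym/antiB => //; apply: anti_sandwich => //.
by apply/anti_sym/IH; rewrite (ltnW jk).
Qed.

Lemma t_jm2 k : (k < N)%N ->
  t k * (jm k * jm k) = jm k.+1 * jm k.+1 * t k + (jm k - jm k.+1).
Proof.
move=> kN; by rewrite mulrA t_jm // mulrBl mul1r -(mulrA _ (t k)) t_jm //; nc.
Qed.

Definition psi k :=
  locked ((jm k.+1 * jm k.+1 - jm k * jm k) * t k + (jm k - jm k.+1)).

Lemma psiE k :
  psi k = (jm k.+1 * jm k.+1 - jm k * jm k) * t k + (jm k - jm k.+1).
Proof. by rewrite /psi -lock. Qed.

Lemma psi_jm k : (k < N)%N -> psi k * jm k = - (jm k.+1 * psi k).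
Proof.
move=> kN; have a : anti (jm k) (jm k.+1) by apply: jm_anti; rewrite ltnSn.
rewrite psiE mulrDl -(mulrA _ (t k)) t_jm //; expand.
by rewrite (antiA _ a) a; nc.
Qed.

Lemma psi_jmS k : (k < N)%N -> psi k * jm k.+1 = - (jm k * psi k).
Proof.
move=> kN; have a : anti (jm k) (jm k.+1) by apply: jm_anti; rewrite ltnSn.
have e : t k * jm k.+1 = 1 - jm k * t k by rewrite jm_t //; nc.
rewrite psiE mulrDl -(mulrA _ (t k)) e //; expand.
by rewrite a; expand; rewrite (antiA _ a); nc.
Qed.

(** Only the second factor is expanded, and the first one is moved across its coefficients,
    exchanging m_k and m_(k+1); the only product of two t_k that arises is then t_k^2 = 1. *)
Lemma psi2 k : (k < N)%N ->
  psi k * psi k = jm k * jm k + jm k.+1 * jm k.+1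
    - (jm k.+1 * jm k.+1 - jm k * jm k) * (jm k.+1 * jm k.+1 - jm k * jm k).
Proof.
move=> kN; have a : anti (jm k) (jm k.+1) by apply: jm_anti; rewrite ltnSn.
have p2 x y : psi k * x = - (y * psi k) -> psi k * (x * x) = y * y * psi k.
  by move=> xy; rewrite mulrA xy mulNr -(mulrA y (psi k)) xy; nc.
rewrite {2}psiE mulrDr mulrA !mulrBr (p2 _ _ (psi_jm kN)).
rewrite (p2 _ _ (psi_jmS kN)) psi_jm // psi_jmS //.
rewrite -mulrBl -mulrA (_ : psi k * t k =
   (jm k.+1 * jm k.+1 - jm k * jm k) + (jm k - jm k.+1) * t k); last first.
  by rewrite psiE mulrDl t2A.
by rewrite psiE; expand; rewrite ?((fun z => antiA z a), a, mulNr, mulrN); nc.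
Qed.

End SpinRelations.

(** * Paths of strict partitions and weight vectors *)

Section Paths.
Local Open Scope nat_scope.

(* The strict partition reached by a path, as the set of its parts: adding a box
   of content a turns a part a (or an empty row if a = 0) into a + 1. *)
Fixpoint parts (s : seq nat) (k : nat) : bool :=
  if s is a :: s' then (k == a.+1) || parts s' k && (k != a) else false.

Definition addable (M : pred nat) (a : nat) := ((a == 0) || M a) && ~~ M a.+1.
Definition removable (M : pred nat) (a : nat) := M a.+1 && ((a == 0) || ~~ M a).

Fixpoint path_ok (s : seq nat) : bool :=
  if s is a :: s' then path_ok s' && addable (parts s') a else true.

Lemma parts_le s k : path_ok s -> parts s k -> k <= size s.
Proof.
elim: s k => //= a s IH k /andP[ok /andP[a_s _]] /orP[/eqP->|/andP[ks _]].
  by case/predU1P: a_s => [->//|/(IH _ ok)].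
by rewrite leqW ?IH.
Qed.

(* Half of the square of the signed content, as x_k ^ 2 = 2 m_k ^ 2. *)
Definition tri (a : nat) : nat := 'C(a.+1, 2).

Lemma triS a : tri a.+1 = tri a + a.+1.
Proof. by rewrite /tri binS bin1. Qed.

Lemma tri_double a : (tri a).*2 = a * a.+1.
Proof. by elim: a => // a IH; rewrite triS doubleD IH; lia. Qed.

Lemma tri_inj : injective tri.
Proof. by move=> a b ab; have := tri_double a; rewrite ab tri_double; nia. Qed.

End Paths.

Section Eigenvectors.
Variables (C : numFieldType) (B : algType C).
Implicit Types (v w x y : B) (a b : nat) (h : C).

Local Notation triC a := ((tri a)%:R : C).

Lemma triC_eq a b : (triC a == triC b) = (a == b).
Proof. by rewrite eqr_nat (inj_eq tri_inj). Qed.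

(** At content 0 the vector must be killed by x itself and not merely by its square, in accordance
    with the simple factor [fpol 0]. *)
Definition eig v x a := v * x * x = triC a *: v /\ (a = 0%N -> v * x = 0).

Lemma eigP v x a : (a = 0%N -> v * x = 0) ->
  (a != 0%N -> v * x * x = triC a *: v) -> eig v x a.
Proof.
case: (eqVneq a 0%N) => [->|a0] v0 va; split=> //; last exact: va.
by rewrite v0 // mul0r scale0r.
Qed.

Lemma eigD v w x a : eig v x a -> eig w x a -> eig (v + w) x a.
Proof.
move=> [v2 v0] [w2 w0]; split=> [|a0]; rewrite !mulrDl ?v2 ?w2 ?scalerDr //.
by rewrite v0 ?w0 ?addr0.
Qed.

Lemma eigZ h v x a : eig v x a -> eig (h *: v) x a.
Proof.
move=> [v2 v0]; split=> [|a0]; rewrite -!scalerAl ?v2 ?scalerA 1?mulrC //.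
by rewrite v0 ?scaler0.
Qed.

(** A global sign affects neither squares nor kernels, so [eig] is transported along such
    intertwiners. *)
Definition twist y x x' := y * x = x' * y \/ y * x = - (x' * y).

Lemma anti_twist y x : anti y x -> twist y x x. Proof. by right. Qed.

Lemma twistM y z x x' x'' : twist y x x' -> twist z x' x'' ->
  twist (z * y) x x''.
Proof.
rewrite /twist; case=> xx [xx2|xx2];
  rewrite -!mulrA xx ?mulrN !mulrA xx2 ?mulNr.
- by left.
- by right.
- by right.
- by left; rewrite opprK.
Qed.

Lemma twist1 x : twist 1 x x.
Proof. by left; rewrite mul1r mulr1. Qed.

Lemma twist2 v y x x' : twist y x x' -> v * y * x * x = v * x' * x' * y.
Proof.
case=> xx; rewrite -!mulrA (mulrA y) xx ?mulNr -?mulrA ?xx ?mulrN ?opprK //.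
Qed.

Lemma eigM v y x x' a : twist y x x' -> eig v x' a -> eig (v * y) x a.
Proof.
move=> xx [v2 v0]; split=> [|a0]; first by rewrite (twist2 _ xx) v2 scalerAl.
by case: xx => xx; rewrite -mulrA xx ?mulrN mulrA v0 ?mul0r ?oppr0.
Qed.

Definition fpol a : {poly C} :=
  if a is 0%N then 'X else 'X^2 - (triC a)%:P.

Local Notation ev x := (horner_alg x).

Lemma ev_fpol0 x : ev x (fpol 0) = x. Proof. exact: horner_algX. Qed.

Lemma ev_quad x h : ev x ('X^2 - h%:P) = x * x - h%:A.
Proof. by rewrite rmorphB rmorphXn /= horner_algX horner_algC expr2. Qed.

Lemma eigE v x a : eig v x a <-> v * ev x (fpol a) = 0.
Proof.
case: a => [|a]; rewrite ?ev_fpol0 /=.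
  by split=> [[_ ->]|v0] //; apply: eigP.
rewrite ev_quad mulrBr mulrA mulr_algr; split=> [[-> _]|/eqP];
  first exact: subrr.
by rewrite subr_eq0 => /eqP v2; split.
Qed.

(** Each factor is injective on such a vector: for a > 0 it acts by the non-zero scalar h - tri a,
    and for a = 0 its square acts by h, which is then non-zero. *)
Lemma eigen_ann v x h (L : seq nat) :
  v * x * x = h *: v -> (forall a, a \in L -> h != triC a) ->
  v * ev x (\prod_(a <- L) fpol a) = 0 -> v = 0.
Proof.
elim: L v => [|a L IH] v v2 hL; first by rewrite big_nil rmorph1 mulr1.
have ha : h != triC a by apply: hL; rewrite mem_head.
have {}hL b : b \in L -> h != triC b by move=> bL; rewrite hL // inE bL orbT.
rewrite big_cons rmorphM mulrA /=.
case: a ha => [|a] ha vL.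
  have v0 : v * x = 0.
    apply: IH => //; first by rewrite v2 scalerAl.
    by rewrite -[X in v * X]ev_fpol0.
  have /eqP: h *: v = 0 by rewrite -v2 v0 mul0r.
  by rewrite scaler_eq0 (negPf ha) => /eqP.
apply: IH => //; apply/eqP.
have /eqP := vL; rewrite ev_quad mulrBr mulrA v2 mulr_algr -scalerBl -scalerAl.
by rewrite scaler_eq0 subr_eq0 (negPf ha).
Qed.

(** This excludes Jordan blocks: the factors of L other than [fpol a] kill [v * fpol a], and by
    [eigen_ann] they can only kill an eigenvector for [tri a] if it is zero. *)
Lemma eigen_simple v x a (L : seq nat) : uniq L ->
  v * ev x (\prod_(b <- L) fpol b) = 0 ->
  (v * ev x (fpol a)) * x * x = triC a *: (v * ev x (fpol a)) ->
  v * ev x (fpol a) = 0.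
Proof.
move=> Lu vL v2; apply: (eigen_ann (L := rem a L)) v2 _ _ => [b|].
  by rewrite mem_rem_uniq // inE triC_eq eq_sym => /andP[].
have [aL|aL] := boolP (a \in L).
  by move: vL; rewrite (big_rem a aL) rmorphM mulrA.
by rewrite rem_id // -mulrA -rmorphM mulrC rmorphM mulrA vL mul0r.
Qed.

End Eigenvectors.

Section Weights.
Variables (C : numFieldType) (B : algType C) (N : nat) (t : nat -> B).
Hypothesis tP : spin_rel N t.
Implicit Types (v w : B) (s : seq nat) (a b : nat).
Local Notation triC a := ((tri a)%:R : C).
Local Notation jm := (jm t).
Local Notation psi := (psi t).
Local Notation ev x := (horner_alg x).

(** The path starts with the last content; an entry followed by k others is the content at which
    [jm k] acts. *)
Fixpoint weight v s : Prop :=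
  if s is a :: s' then weight v s' /\ eig v (jm (size s')) a else True.

Lemma weightD v w s : weight v s -> weight w s -> weight (v + w) s.
Proof.
elim: s => //= a s IH [vs va] [ws wa]; split; [exact: IH|exact: eigD].
Qed.

Lemma weightZ h v s : weight v s -> weight (h *: v) s.
Proof. by elim: s => //= a s IH [vs va]; split; [exact: IH|exact: eigZ]. Qed.

Lemma weightN v s : weight v s -> weight (- v) s.
Proof. by rewrite -scaleN1r; exact: weightZ. Qed.

Lemma weightM v y s : (forall k, (k < size s)%N -> twist y (jm k) (jm k)) ->
  weight v s -> weight (v * y) s.
Proof.
elim: s => //= a s IH ys [vs va]; split; last by apply: eigM va; exact: ys.
by apply: IH => // k ks; apply: ys; exact: leqW.
Qed.

Lemma weight_jm v s k : (size s <= k <= N)%N -> weight v s ->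
  weight (v * jm k) s.
Proof.
move=> /andP[sk kN]; apply: weightM => j js; apply/anti_twist/anti_sym.
by apply: (jm_anti tP); rewrite (leq_trans js sk) ?kN.
Qed.

Lemma weight_t v s k : (size s <= k < N)%N -> weight v s -> weight (v * t k) s.
Proof.
move=> /andP[sk kN]; apply: weightM => j js; apply/anti_twist.
by apply: (t_jm_gt tP); rewrite (leq_trans js sk) ?kN.
Qed.

Lemma weight_ev v s k p : (size s <= k <= N)%N -> weight v s ->
  weight (v * ev (jm k) p) s.
Proof.
move=> sk; elim/poly_ind: p v => [|p h IH] v vs.
  by rewrite rmorph0 mulr0 -(scale0r v); exact: weightZ.
rewrite rmorphD rmorphM /= horner_algX horner_algC mulrDr mulr_algr mulrA.
by apply: weightD; [apply/weight_jm/IH|apply: weightZ].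
Qed.

Lemma twist_psi k j : (k.+1 < j <= N)%N || (j < k < N)%N ->
  twist (psi k) (jm j) (jm j).
Proof.
move=> jk; apply/anti_twist.
suff [at_ ak ak1] : [/\ anti (jm j) (t k), anti (jm j) (jm k)
    & anti (jm j) (jm k.+1)].
  apply/anti_sym; rewrite psiE; set p := _ - _.
  have jp : jm j * p = p * jm j by rewrite mulrBr mulrBl !anti_comm2.
  move: p jp => p jp;
    rewrite /anti mulrDr mulrDl mulrA jp -(mulrA p) at_ mulrN mulrA.
  by rewrite (antiB ak ak1) opprD.
case/orP: jk => /andP[h1 h2]; split.
- by apply/anti_sym/(t_jm_lt tP); rewrite h1.
- by apply/anti_sym/(jm_anti tP); rewrite h2 andbT ltnW.
- by apply/anti_sym/(jm_anti tP); rewrite h1.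
- by apply/anti_sym/(t_jm_gt tP); rewrite h1.
- by apply/(jm_anti tP); rewrite h1 ltnW.
- by apply/(jm_anti tP); rewrite h2 andbT ltnW // ltnW.
Qed.

Lemma weight_psi v s k : (size s <= k < N)%N -> weight v s ->
  weight (v * psi k) s.
Proof.
move=> /andP[sk kN]; apply: weightM => j js; apply: twist_psi.
by rewrite (leq_trans js sk) kN orbT.
Qed.

Lemma twist_psiS k : (k < N)%N -> twist (psi k) (jm k.+1) (jm k).
Proof. by move=> kN; right; rewrite (psi_jmS tP kN). Qed.

Lemma twist_psi0 k : (k < N)%N -> twist (psi k) (jm k) (jm k.+1).
Proof. by move=> kN; right; rewrite (psi_jm tP kN). Qed.

Lemma weight_swap v s a b : (size s < N)%N -> weight v (b :: a :: s) ->
  weight (v * psi (size s)) (a :: b :: s).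
Proof.
move=> sN /= [[vs va] vb]; split; last by apply: eigM va; exact: twist_psiS.
split; first by apply: weight_psi => //; rewrite leqnn.
by apply: eigM vb; exact: twist_psi0.
Qed.

Lemma psi2_eig v k (h h' : C) : (k < N)%N ->
  v * jm k * jm k = h *: v -> v * jm k.+1 * jm k.+1 = h' *: v ->
  v * psi k * psi k = (h + h' - (h' - h) ^+ 2) *: v.
Proof.
move=> kN vh vh'; have e (x : B) (z : C) y : x * y * y = z *: x -> x * (y * y) =
  z *: x.
  by rewrite mulrA.
have hE : v * (jm k.+1 * jm k.+1 - jm k * jm k) = (h' - h) *: v.
  by rewrite mulrBr (e _ _ _ vh) (e _ _ _ vh') scalerBl.
rewrite -mulrA (psi2 tP kN) mulrBr mulrDr (e _ _ _ vh) (e _ _ _ vh') mulrA hE.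
by rewrite -scalerAl hE scalerA -scalerDl -scalerBl expr2.
Qed.

End Weights.

Section Spectrum.
Variables (C : numFieldType) (B : algType C) (N : nat) (t : nat -> B).
Hypothesis tP : spin_rel N t.
Implicit Types (v w : B) (s : seq nat) (a b : nat).
Local Notation triC a := ((tri a)%:R : C).
Local Notation jm := (jm t).
Local Notation psi := (psi t).
Local Notation ev x := (horner_alg x).
Local Notation weight := (weight (C := C) t).

(** Any duplicate-free list containing the addable contents is allowed, so the induction may use
    whichever list its factorizations produce. *)
Definition annihilated s := forall w (L : seq nat), weight w s -> uniq L ->
  (forall a, addable (parts s) a -> a \in L) ->
  w * ev (jm (size s)) (\prod_(a <- L) fpol C a) = 0.

Lemma weight_not_addable v s a : path_ok s -> annihilated s -> weight v s ->
  ~~ addable (parts s) a ->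
  v * jm (size s) * jm (size s) = triC a *: v -> v = 0.
Proof.
move=> ok ann vs na va.
(* By [parts_le] a content addable to s is at most the length of s, so this list contains them
   all. *)
pose L := [seq b <- iota 0 (size s).+1 | addable (parts s) b].
apply: (eigen_ann (L := L) va) => [b|].
  by rewrite mem_filter triC_eq => /andP[ab _]; apply: contraNneq na => ->.
apply: ann => // [|b ab]; first by rewrite filter_uniq ?iota_uniq.
rewrite mem_filter ab mem_iota ltnS /=.
by case/andP: ab => /predU1P[->//|/(parts_le ok)].
Qed.

Lemma annihilated_simple s w a : path_ok s -> annihilated s -> weight w s ->
  let u := w * ev (jm (size s)) (fpol C a) in
  u * jm (size s) * jm (size s) = triC a *: u -> u = 0.
Proof.
move=> ok ann ws u u2.
pose L := [seq b <- iota 0 (size s).+1 | addable (parts s) b].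
apply: (eigen_simple (L := L)) u2; first by rewrite filter_uniq ?iota_uniq.
apply: ann => // [|b ab]; first by rewrite filter_uniq ?iota_uniq.
rewrite mem_filter ab mem_iota ltnS /=.
by case/andP: ab => /predU1P[->//|/(parts_le ok)].
Qed.

Lemma scaler_eq_self_opp v (h : C) : h != 0 -> h *: v = - (h *: v) -> v = 0.
Proof.
move=> h0 /eqP; rewrite -subr_eq0 opprK -mulr2n -scaler_nat !scaler_eq0.
by rewrite pnatr_eq0 (negPf h0) => /eqP.
Qed.

Lemma triC_neq0 a : a != 0%N -> triC a != 0.
Proof. by rewrite -(triC_eq C a 0). Qed.

(** For a > 0, v t_k (m_k^2 - tri a) = v (m_k - m_(k+1)) would make v t_k the head of a Jordan
    block, so it is zero by [annihilated_simple]. Then v m_k = v m_(k+1), and anticommutation gives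
    tri a v = - tri a v. For a = 0 the block is one of m_k instead of m_k^2. *)
Lemma weight_repeat v s a : (size s < N)%N -> path_ok s -> annihilated s ->
  weight v (a :: s) ->
  v * jm (size s).+1 * jm (size s).+1 = triC a *: v -> v = 0.
Proof.
move=> sN ok ann; set k := size s.
have ak : anti (jm k) (jm k.+1) by apply: (jm_anti tP); rewrite ltnSn.
have kk : (k <= k < N)%N by rewrite leqnn.
case: (eqVneq a 0%N) => [->|a0].
  have step u : weight u (0%N :: s) -> u * jm k.+1 = 0 -> u = 0.
    move=> /= [us [_ /(_ erefl) u0]] u1.
    have ut : u * t k * jm k = u.
      by rewrite -mulrA (t_jm tP sN) mulrBr mulr1 mulrA u1 mul0r subr0.
    have := @annihilated_simple s (u * t k) 0 ok ann (weight_t tP kk us).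
    rewrite /= ev_fpol0 -/k ut u0 mul0r scale0r; exact.
  (* The auxiliary claim needs a vector killed by m_(k+1): it is applied to v m_(k+1), whose image
     under m_(k+1) is zero by hypothesis, and then to v itself. *)
  move=> vs v2; apply: (step) => //; apply: (step); last by rewrite v2 scale0r.
  by apply: (weight_jm tP) => //=; rewrite leqnn.
move=> /= [vs [va _]] v2; pose u := v * (jm k - jm k.+1).
have uE : v * t k * ev (jm k) (fpol C a) = u.
  case: a a0 va v2 => // a _ va v2; rewrite ev_quad mulrBr mulr_algr.
  rewrite -mulrA (t_jm2 tP sN) mulrDr !mulrA v2 -scalerAl.
  by rewrite addrAC subrr add0r.
have u2 : u * jm k * jm k = triC a *: u.
  have e : (jm k - jm k.+1) * (jm k * jm k) = jm k * jm k * (jm k - jm k.+1).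
    by rewrite mulrBl mulrBr mulrA (anti_comm2 (anti_sym ak)).
  by rewrite /u -!mulrA e -!mulrA (mulrA v) (mulrA (v * _)) va scalerAl.
have u0 : u = 0.
  rewrite -uE; apply: (annihilated_simple ok ann);
    first exact: (weight_t tP kk vs).
  by rewrite -/k uE.
have e : v * jm k = v * jm k.+1.
  by apply/eqP; rewrite -subr_eq0 -mulrBr; apply/eqP.
apply: (scaler_eq_self_opp (triC_neq0 a0)).
by rewrite -{1}va e -mulrA (anti_sym ak) mulrN mulrA e v2.
Qed.

Section Braid.
Variables (s : seq nat) (a b : nat).
Local Notation k := (size s).
Hypotheses (kN : (k.+1 < N)%N) (ok : path_ok [:: b, a & s]).
Hypotheses (ann : annihilated s) (anna : annihilated (a :: s)).
Hypotheses (nb : ~~ addable (parts s) b) (na : ~~ addable (parts (a :: s)) a).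

(** Vectors with the consecutive contents a, b, a, a space stable under all three Jucys-Murphy
    elements. Exchanging two neighbouring contents would give a forbidden path, so psi_k and
    psi_(k+1) vanish here and t_k, t_(k+1) become multiples of differences of Jucys-Murphy elements,
    by [Zt] and [ZtS]. *)
Let Z v := weight v [:: b, a & s] /\ v * jm k.+2 * jm k.+2 = triC a *: v.

Let ltk : (k < N)%N. Proof. exact: ltnW. Qed.

Let a12 : anti (jm k) (jm k.+1).
Proof. by apply: (jm_anti tP); rewrite ltnSn. Qed.
Let a13 : anti (jm k) (jm k.+2).
Proof. by apply: (jm_anti tP); rewrite ltnS leqnSn. Qed.
Let a23 : anti (jm k.+1) (jm k.+2).
Proof. by apply: (jm_anti tP); rewrite ltnSn. Qed.

Let Z1 v : Z v -> Z (v * jm k).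
Proof.
move=> [[[vs va] vb] v3]; split; last first.
  by rewrite (twist2 v (anti_twist a13)) v3 scalerAl.
split; last exact: (eigM (anti_twist a12)).
split; first by apply: (weight_jm tP) => //; rewrite leqnn ltnW.
by apply: eigM va; left.
Qed.

Let Z2 v : Z v -> Z (v * jm k.+1).
Proof.
move=> [[[vs va] vb] v3]; split; last first.
  by rewrite (twist2 v (anti_twist a23)) v3 scalerAl.
split; last by apply: eigM vb; left.
split; first by apply: (weight_jm tP) => //; rewrite leqnSn ltnW.
exact: (eigM (anti_twist (anti_sym a12))).
Qed.

Let Z3 v : Z v -> Z (v * jm k.+2).
Proof.
move=> [vs v3]; split; last by rewrite v3 scalerAl.
by apply: (weight_jm tP) => //=; rewrite leqnn.
Qed.

Let ZB v w : Z v -> Z w -> Z (v - w).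
Proof.
move=> [vs v3] [ws w3]; split; last by rewrite !mulrBl v3 w3 scalerBr.
by apply: weightD => //; exact: weightN.
Qed.

Let c := triC b - triC a.

Let Zt v : Z v -> c *: (v * t k) = v * (jm k.+1 - jm k).
Proof.
move=> [[[vs va] vb] _].
have : v * psi k = 0.
  apply: (weight_not_addable _ ann _ nb); first by case/andP: ok => /andP[].
    by apply: (weight_psi tP) => //; rewrite leqnn.
  by rewrite (twist2 v (twist_psi0 tP ltk)) (proj1 vb) scalerAl.
rewrite psiE mulrDr mulrA mulrBr !mulrA (proj1 va) (proj1 vb) -scalerBl
  -scalerAl.
by move/eqP; rewrite addr_eq0 => /eqP->; rewrite -mulrN opprB.
Qed.

Let ZtS v : Z v -> c *: (v * t k.+1) = - (v * (jm k.+2 - jm k.+1)).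
Proof.
move=> [[vs vb] v3].
have : v * psi k.+1 = 0.
  apply: (weight_not_addable _ anna _ na); first by case/andP: ok.
    by apply: (weight_psi tP) => //=; rewrite leqnn.
  by rewrite (twist2 v (twist_psi0 tP kN)) v3 scalerAl.
rewrite psiE mulrDr mulrA mulrBr !mulrA v3 (proj1 vb) -scalerBl -scalerAl.
move/eqP; rewrite addr_eq0 => /eqP e.
by rewrite /c -opprB scaleNr e opprK -mulrN opprB.
Qed.

(** The braid relation, rewritten by [Zt] and [ZtS], gives v m_(k+2) = v m_k. These elements
    anticommute and have the same square on v, which forces v = 0 unless a = 0. *)
Lemma weight_braid v : weight v [:: b, a & s] ->
  v * jm k.+2 * jm k.+2 = triC a *: v ->
  v * jm k.+2 = 0 /\ (a != 0%N -> v = 0).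
Proof.
move=> vs v3; have Zv : Z v by [].
have ab : a != b.
  by apply: contraNneq na => {2}->; case/andP: ok.
have c0 : c != 0 by rewrite subr_eq0 triC_eq eq_sym.
have ZA w : Z w -> Z (w * (jm k.+1 - jm k)).
  by move=> Zw; rewrite mulrBr; apply: ZB; [exact: Z2|exact: Z1].
have ZC w : Z w -> Z (w * (jm k.+2 - jm k.+1)).
  by move=> Zw; rewrite mulrBr; apply: ZB; [exact: Z3|exact: Z2].
have [_ braid _] := tP.
pose x := jm k.+1 - jm k; pose y := jm k.+2 - jm k.+1.
have push w1 w2 w3 : c *: (c *: (c *: (v * w1 * w2 * w3))) =
    c *: (c *: (c *: (v * w1) * w2) * w3) by rewrite !scalerAl.
have e1 : c *: (c *: (c *: (v * t k * t k.+1 * t k))) = - (v * x * y * x).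
  rewrite push Zt // ZtS; last exact: ZA.
  by rewrite mulNr scalerN Zt //; exact/ZC/ZA.
have e2 : c *: (c *: (c *: (v * t k.+1 * t k * t k.+1))) = v * y * x * y.
  rewrite push ZtS // mulNr scalerN Zt; last exact: ZC.
  by rewrite mulNr scalerN ZtS ?opprK //; exact/ZA/ZC.
have {e1 e2}e : v * y * x * y + v * x * y * x = 0.
  have := congr1 ( *%R v) (braid _ kN); rewrite !mulrA => eb.
  by rewrite -e2 -[v * x * y * x]opprK -e1 eb subrr.
have sq1 w : Z w -> w * jm k * jm k = triC a *: w by case=> [[[_ []]]].
have sq2 w : Z w -> w * jm k.+1 * jm k.+1 = triC b *: w by case=> [[_ []]].
have sq3 w : Z w -> w * jm k.+2 * jm k.+2 = triC a *: w by case.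
have xx w : Z w -> w * x * x = (triC a + triC b) *: w.
  move=> Zw; rewrite scalerDl -sq1 // -sq2 // /x; expand.
  by rewrite (antiA _ a12); nc.
have yy w : Z w -> w * y * y = (triC a + triC b) *: w.
  move=> Zw; rewrite scalerDl -sq3 // -sq2 // /y; expand.
  by rewrite (antiA _ a23); nc.
have xy w : Z w -> w * x * y = - (triC b *: w) - triC b *: w - w * y * x.
  move=> Zw; rewrite -sq2 // /x /y; expand.
  by rewrite (antiA _ a12) (antiA _ a13) (antiA _ a23); nc.
(* On [Z] one has x^2 = y^2 = tri a + tri b and x y + y x = - 2 tri b, so the braid identity reduces
   to (tri a + 3 tri b) v (x + y) = 0; the scalar is non-zero because a and b differ. *)
have e3 : v * x = - (v * y).
  have h0 : triC a + triC b + (triC b + triC b) != 0 :> C.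
    rewrite -!natrD pnatr_eq0.
    by have := tri_double a; have := tri_double b; move: ab; clear; nia.
  apply/eqP; rewrite -addr_eq0 -(inj_eq (scalerI h0)) scaler0; apply/eqP.
  move: {+}e; rewrite (xy (v * y)) 1?[v * x * y]xy // ?yy //; last exact: ZC.
  rewrite -mulNr !mulrBl mulNr -!scalerAl xx; last exact: ZC.
  move/(congr1 -%R); rewrite oppr0 => <-.
  by rewrite mulNr -scalerAl !scalerDr !scalerDl; zmodule.
have {}e : v * jm k.+2 = v * jm k.
  move/eqP: e3; rewrite -addr_eq0 -mulrDr /x /y => /eqP e3.
  by apply/eqP; rewrite -subr_eq0 -mulrBr -e3; apply/eqP; congr (_ * _); nc.
case: (vs) => [[_ [va2 va0]] _]; case: (eqVneq a 0%N) => [a0|a0].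
  by split=> //; rewrite e va0.
suff -> : v = 0 by split=> //; rewrite mul0r.
apply: (scaler_eq_self_opp (triC_neq0 a0)).
by rewrite -{1}v3 e -mulrA a13 mulrN mulrA e va2.
Qed.

End Braid.

End Spectrum.

(** The scalar by which psi_k^2 acts if m_k^2 acts by tri a and m_(k+1)^2 by h. It vanishes exactly
    at the neighbouring contents; for a = 0 the default [0.-1 = 0] gives the second root h = 0. It
    is also used with h the polynomial X^2. *)
Lemma tri_diff_sqr (C : comNzRingType) a (h : C) :
  (tri a)%:R + h - (h - (tri a)%:R) ^+ 2 =
  - ((h - (tri a.+1)%:R) * (h - (tri a.-1)%:R)).
Proof.
have e1 : (tri a.+1)%:R = (tri a)%:R + a.+1%:R :> C by rewrite triS natrD.
have e2 : (tri a)%:R = (tri a.-1)%:R + a%:R :> C.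
  by case: a {e1} => [|a]; rewrite ?addr0 // triS natrD.
have e3 : (tri a.-1)%:R + (tri a.-1)%:R = a%:R * a%:R - a%:R :> C.
  case: a {e1 e2} => [|a]; first by rewrite mul0r subr0 addr0.
  by rewrite /= -natrD addnn tri_double natrM -addn1 natrD; ring.
rewrite e1 e2 -[a.+1]addn1 natrD; move: e3; move: (tri _)%:R => p e3.
apply/eqP; rewrite -subr_eq0; apply/eqP.
transitivity (p + p - (a%:R * a%:R - a%:R)); last by rewrite e3 subrr.
ring.
Qed.

Section PathMoves.
Variables (C : numFieldType) (B : algType C) (N : nat) (t : nat -> B).
Hypothesis tP : spin_rel N t.
Implicit Types (v w : B) (s : seq nat) (a b : nat).
Local Notation triC a := ((tri a)%:R : C).
Local Notation jm := (jm t).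
Local Notation psi := (psi t).
Local Notation ev x := (horner_alg x).
Local Notation weight := (weight (C := C) t).
Local Notation annihilated := (annihilated (C := C) t).

(** If a is removable, it can be moved to the end of the path across each later content d. Such a d
    is neither a nor a neighbour of a, so psi has a non-zero scalar square and is invertible on the
    weight vectors met; y is the product of these psi and z undoes it. *)
Lemma path_move s a : path_ok s -> removable (parts s) a -> (size s <= N)%N ->
  exists s' y z,
  [/\ size s = (size s').+1, path_ok (a :: s'), parts (a :: s') =1 parts s,
      forall j, (size s <= j <= N)%N -> twist y (jm j) (jm j)
    & forall w, weight w s -> weight (w * y) (a :: s') /\ w * y * z = w].
Proof.
elim: s => [|d s IH] //= ok rem sN.
have [da|da] := eqVneq d a.
  exists s, 1, 1; rewrite -da; split=> // [j _|w]; first exact: twist1.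
  by rewrite !mulr1.
case/andP: ok => ok /andP[ds dS].
have [daS adS rem'] : [/\ d != a.+1, a != d.+1 & removable (parts s) a].
  by move: rem ds dS; rewrite /removable; split; lia.
have [s' [y [z [ss /= /andP[ok' as'] pe ty wy]]]] := IH ok rem' (ltnW sN).
have kN : (size s' < N)%N by rewrite -ss ltnW.
exists (d :: s'), (y * psi (size s')).
pose g : C := triC a + triC d - (triC d - triC a) ^+ 2.
have g0 : g != 0.
  rewrite /g tri_diff_sqr oppr_eq0 mulf_neq0 // subr_eq0 triC_eq //.
  by move: daS adS da; clear; case: a => //= a _; rewrite eqSS eq_sym.
exists (g^-1 *: psi (size s') * z); split=> /=.
- by rewrite ss.
- have := pe d; have := pe d.+1; move: as' ds dS; rewrite ok' /addable.
  by lia.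
- move=> k; have := pe k; lia.
- move=> j /andP[sj jN]; apply: (@twistM _ _ _ _ _ (jm j)).
    by apply: (twist_psi tP); rewrite -ss sj jN.
  by apply: ty; rewrite ltnW.
- move=> w [ws wd]; have [wy1 wyz] := wy _ ws.
  have wda : weight (w * y) [:: d, a & s'].
    split=> //=; rewrite -ss; apply: eigM wd; apply: ty.
    by rewrite leqnn ltnW.
  split; first by rewrite mulrA; exact: (weight_swap tP kN wda).
  case: wda => [[_ [wa2 _]] [wd2 _]].
  rewrite -scalerAl -scalerAr !mulrA (psi2_eig tP kN wa2 wd2) -/g.
  by rewrite -scalerAl scalerA mulVf // scale1r.
Qed.

(** After [path_move] the path ends with b, a and would continue with b. As a and b are neighbours,
    the exchanged paths are invalid, and [weight_braid] applies. *)
Lemma weight_forbidden s a b v : (size s < N)%N -> path_ok (a :: s) ->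
  (forall s', (size s' <= size s)%N -> path_ok s' -> annihilated s') ->
  removable (parts s) b -> (a == b.+1) || (b == a.+1) ->
  weight v (a :: s) ->
  v * jm (size s).+1 * jm (size s).+1 = triC b *: v ->
  v * jm (size s).+1 = 0 /\ (b != 0%N -> v = 0).
Proof.
move=> sN /= /andP[ok a_s] ann rem ab [vs va] v2.
have [s' [y [z [ss ok' pe ty wy]]]] := path_move ok rem (ltnW sN).
have tyS : twist y (jm (size s).+1) (jm (size s).+1) by apply: ty;
  rewrite leqnSn.
have [wvy vyz] := wy _ vs.
have vjs : weight (v * jm (size s).+1) s by apply: (weight_jm tP) => //;
  rewrite leqnSn.
have [_ vjyz] := wy _ vjs.
have [||||||||e1 e2] := @weight_braid _ _ _ _ tP s' b a _ _ _ _ _ _ (v * y).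
- by rewrite -ss.
- rewrite /= -/(path_ok (b :: s')) in ok' *; rewrite ok' /=.
  by move: a_s; rewrite /addable -!pe.
- by apply: ann; [rewrite ss leqnSn|case/andP: ok'].
- by apply: ann => //; rewrite ss.
- by case/andP: ok' => _; rewrite /addable; case/orP: ab => /eqP ->; lia.
- by rewrite /addable /= (eqxx b.+1) andbF.
- split=> //=; rewrite -ss; apply: eigM va; apply: ty.
  by rewrite leqnn ltnW.
- by rewrite -ss (twist2 v tyS) v2 scalerAl.
- split=> [|b0]; last by rewrite -vyz e2 ?mul0r.
  rewrite -vjyz; move: e1; rewrite -ss; case: tyS => e; rewrite -mulrA e.
    by rewrite mulrA => ->; rewrite mul0r.
  rewrite mulrN mulrA => /eqP; rewrite oppr_eq0 => /eqP->.
  by rewrite mul0r.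
Qed.

End PathMoves.

Section SpectrumTheorem.
Variables (C : numFieldType) (B : algType C) (N : nat) (t : nat -> B).
Hypothesis tP : spin_rel N t.
Implicit Types (v w : B) (s : seq nat) (a b : nat).
Local Notation triC a := ((tri a)%:R : C).
Local Notation jm := (jm t).
Local Notation psi := (psi t).
Local Notation ev x := (horner_alg x).
Local Notation weight := (weight (C := C) t).
Local Notation annihilated := (annihilated (C := C) t).

(** Each [fpol] is an even or an odd polynomial, so the signs combine into a global one. *)
Lemma twist_prod_fpol (y x x' : B) (L : seq nat) : twist y x x' ->
  twist y (ev x (\prod_(a <- L) fpol C a)) (ev x' (\prod_(a <- L) fpol C a)).
Proof.
move=> xx; elim: L => [|a L IH].
  by rewrite big_nil !rmorph1; left; rewrite mulr1 mul1r.
have fa : twist y (ev x (fpol C a)) (ev x' (fpol C a)).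
  case: a => [|a]; rewrite ?ev_fpol0 //= !ev_quad; left.
  rewrite mulrBr mulrBl mulr_algl mulr_algr; congr (_ - _).
  by have := twist2 1 xx; rewrite !mul1r !mulrA.
rewrite big_cons !rmorphM /=.
case: fa => fa; case: IH => IH; [left|right|right|left];
  by rewrite mulrA fa ?mulNr -!mulrA IH ?mulrN ?opprK.
Qed.

Lemma big_pred1_uniq (R : comNzRingType) (L : seq nat) (F : nat -> R) a :
  uniq L -> \prod_(b <- L | b == a) F b = if a \in L then F a else 1.
Proof.
case: ifPn => aL Lu; first by rewrite -big_filter filter_pred1_uniq // big_seq1.
by rewrite big_seq_cond big1 // => b /andP[bL /eqP ba]; rewrite -ba bL in aL.
Qed.

(** Isolates the contents a + 1 and a - 1, the roots produced by the square of the intertwiner; the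
    factor at a, if present, is collected in r. *)
Lemma annihilator_split (L : seq nat) a : uniq L ->
  let near := [pred b | (b == a) || (b == a.+1) || (b.+1 == a)] in
  exists r, \prod_(b <- L) fpol C b =
    (\prod_(b <- L | ~~ near b) fpol C b) *
    (if a.+1 \in L then fpol C a.+1 else 1) *
    (if (0 < a)%N && (a.-1 \in L) then fpol C a.-1 else 1) * r.
Proof.
move=> Lu near; exists (\prod_(b <- L | b == a) fpol C b).
rewrite (bigID near) /= mulrC -!mulrA; congr (_ * _).
rewrite -(big_pred1_uniq (fpol C) a.+1 Lu) [LHS](bigID (pred1 a.+1)) /=;
  congr (_ * _).
  by apply: eq_bigl => b; lia.
rewrite [LHS](bigID (pred1 a)) mulrC /=; congr (_ * _).
  by apply: eq_bigl => b; lia.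
case: ltnP => [a0|a0] /=; last first.
  by rewrite big1_seq // => b; lia.
by rewrite -(big_pred1_uniq (fpol C) a.-1 Lu); apply: eq_bigl => b; lia.
Qed.

Lemma weight_annihilated s : (size s <= N)%N -> path_ok s -> annihilated s.
Proof.
have [m] := ubnP (size s); elim: m s => // m IH [|a s] sm sN ok w L ws Lu Ladd.
  have L0 : 0%N \in L by apply: Ladd.
  rewrite (big_rem _ L0) rmorphM mulrA /= horner_algX jm0 mulr0 mul0r //.
have ann s' : (size s' <= size s)%N -> path_ok s' -> annihilated s'.
  by move=> s's; apply: IH;
    [exact: leq_ltn_trans s's sm|exact: leq_trans s's (ltnW sN)].
have [oks a_s] : path_ok s /\ addable (parts s) a by apply/andP.
have kN : (size s < N)%N by [].
set x := jm (size s).+1.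
have [r ->] := annihilator_split a Lu; set near := [pred b | _].
set G := \prod_(b <- L | _) _; set g1 := if _ then _ else _.
set g2 := if _ then _ else _; set k := size s.
have Wws p : weight (w * ev x p) (a :: s).
  by apply: (weight_ev tP) => //=; rewrite leqnn.
have sqE v h : v * ev x ('X^2 - h%:P) = 0 -> v * x * x = h *: v.
  rewrite ev_quad mulrBr mulrA mulr_algr => /eqP.
  by rewrite subr_eq0 => /eqP.
have start : w * ev x (fpol C a * G) *
    ev x (('X^2 - (triC a.+1)%:P) * ('X^2 - (triC a.-1)%:P)) = 0.
  have e : w * psi k * ev (jm k) (fpol C a * G) = 0.
    (* A content addable to s and different from a is not a neighbour of a and remains addable after
       a, so this list contains all contents addable to s. *)
    have -> : fpol C a * G =
      \prod_(b <- a :: [seq b <- L | ~~ near b]) fpol C b.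
      by rewrite big_cons big_filter.
    apply: (ann s) => //.
    - by case: ws => ws _; apply: (weight_psi tP) => //; rewrite leqnn.
    - by rewrite /= filter_uniq // mem_filter /near /= eqxx.
    move=> b bs; rewrite inE mem_filter; case: eqVneq => //= ba.
    rewrite Ladd ?andbT.
      apply/negP => /orP[/orP[]|] /eqP e; first by rewrite e eqxx in ba.
        by move: bs a_s; rewrite e /addable; lia.
      by move: bs a_s; rewrite -e /addable; lia.
    by move: bs a_s; rewrite /addable /=; lia.
  (* Moving psi_k across the product gives u psi_k = 0. Then u psi_k^2 = 0 is, by [psi2] and
     [tri_diff_sqr] at h = X^2, a polynomial relation for m_(k+1) alone. *)
  pose u := w * ev x (fpol C a * G).
  have u0 : u * psi k = 0.
    have := twist_prod_fpol (a :: [seq b <- L | ~~ near b]) (twist_psi0 tP kN).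
    rewrite big_cons big_filter -/G -/x; case=> tw.
      by rewrite /u -mulrA -tw mulrA.
    by rewrite /u -mulrA -[_ * psi k]opprK -tw mulrN mulrA e oppr0.
  have [_ [u2 _]] := Wws (fpol C a * G); rewrite -/u in u2.
  have WE p : weight (u * p) (a :: s) ->
      u * p * (x * x - jm k * jm k) = u * p * ev x ('X^2 - (triC a)%:P).
    by case=> _ [up2 _]; rewrite ev_quad !mulrBr mulr_algr !mulrA up2.
  have WE1 : u * (x * x - jm k * jm k) = u * ev x ('X^2 - (triC a)%:P).
    by have := WE 1; rewrite mulr1; apply; exact: Wws.
  have := psi2 tP kN; rewrite -/k -/x => /(congr1 ( *%R u)).
  rewrite mulrA u0 mul0r mulrBr mulrA WE1 mulrDr !mulrA u2 WE; last first.
    by rewrite -mulrA -rmorphM; exact: Wws.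
  move=> /esym psi0; apply/eqP; rewrite -oppr_eq0 -mulrN -rmorphN; apply/eqP.
  have := tri_diff_sqr a ('X^2 : {poly C}); rewrite -!(rmorph_nat polyC) => <-.
  rewrite rmorphB rmorphD rmorphXn /= horner_algC rmorphXn /= horner_algX.
  by rewrite mulrBr mulrDr mulr_algr !expr2 !mulrA psi0.
rewrite -(mulrA w) -rmorphM in start.
have repeat v : weight v (a :: s) -> v * x * x = triC a *: v -> v = 0.
  by apply: (weight_repeat tP) => //; exact: ann.
have forbid b v : removable (parts s) b -> (a == b.+1) || (b == a.+1) ->
    weight v (a :: s) -> v * ev x ('X^2 - (triC b)%:P) = 0 ->
    v * x = 0 /\ (b != 0%N -> v = 0).
  by move=> rem ab vs /sqE; exact: (weight_forbidden tP kN ok ann rem ab vs).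
(* The extra factor at a is removed, since content a cannot be repeated. *)
have {}start : w * ev x (G * ('X^2 - (triC a.+1)%:P) *
    ('X^2 - (triC a.-1)%:P)) = 0.
  apply: repeat; first exact: Wws.
  set v := w * _; suff [] : eig v x a by [].
  apply/eigE; rewrite /v -(mulrA w) -rmorphM -[RHS]start.
  by congr (w * ev x _); ring.
(* If a + 1 is not in L, it is not addable; then a + 2 is a part, so a + 1 is removable from s and
   is excluded by the braid argument. *)
have {start} e1 : w * ev x (G * g1 * ('X^2 - (triC a.-1)%:P)) = 0.
  rewrite /g1; case: ifPn => aL; first exact: start.
  rewrite mulr1; apply: (proj2 (forbid a.+1 _ _ _ _ _)) => //.
  - have : ~~ addable (parts (a :: s)) a.+1 by apply: contraNN aL; exact: Ladd.
    move: a_s; rewrite /addable /removable /=; lia.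
  - by rewrite eqxx orbT.
  - rewrite -(mulrA w) -rmorphM -[RHS]start; congr (w * ev x _); ring.
have e2 : w * ev x (G * g1 * g2) = 0.
  have vs := Wws (G * g1); move: e1; rewrite !rmorphM mulrA /= -rmorphM.
  rewrite mulrA; move: (w * _) vs => v vs v2.
  case: (posnP a) => [a0|a0].
    rewrite (_ : v = 0) ?mul0r //; apply: repeat => //; apply: sqE.
    by rewrite -[RHS]v2 a0.
  have fb : (a.-1 == 0%N) || ~~ parts s a.-1 -> removable (parts s) a.-1.
    by move: a_s; rewrite /addable /removable prednK //; clear -a0; lia.
  have ab : (a == a.-1.+1) || (a.-1 == a.+1) by rewrite prednK ?eqxx.
  rewrite /g2 a0 /=; case: ifPn => aL; last first.
    rewrite (proj2 (forbid a.-1 v _ _ _ _)) ?mul0r //.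
      apply: fb; apply: contraNT aL; rewrite negb_or negbK => /andP[a1 pa].
      apply: Ladd; rewrite /addable /= prednK //; lia.
    by apply: contraNneq aL => a1; apply: Ladd; rewrite a1 /addable /=; lia.
  (* At a - 1 = 0 the intertwiner only yields the factor X^2; the braid argument improves it to the
     simple factor X. *)
  have [a1|a1] := eqVneq a.-1 0%N; last first.
    by move: v2 a1; case: (a.-1).
  have := forbid a.-1 v (fb _) ab vs v2.
  by rewrite a1 ev_fpol0; case.
by rewrite rmorphM mulrA e2 mul0r.
Qed.

End SpectrumTheorem.

(** * The fusion identity for one column *)

Section SergeevRelations.
Variables (B : nzRingType) (N : nat) (t c : nat -> B).

Definition sergeev_gens : Prop :=
  [/\ spin_rel N t,
      forall a, (a <= N)%N -> c a * c a = -1,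
      forall a b, (a <= N)%N -> (b <= N)%N -> a != b -> anti (c a) (c b) &
      forall k a, (k < N)%N -> (a <= N)%N -> anti (t k) (c a)].

Fixpoint transposition_rec (i k : nat) : B :=
  if k is k'.+1 then
    if i == k' then t k' else - (t k' * transposition_rec i k' * t k')
  else 0.

(* This is t_(ik) for i < k, and 0 otherwise. *)
Definition transposition := locked transposition_rec.

Lemma transpositionSn k : transposition k k.+1 = t k.
Proof. by rewrite /transposition -lock /= eqxx. Qed.

Lemma transpositionS i k : i != k ->
  transposition i k.+1 = - (t k * transposition i k * t k).
Proof. by move=> /negPf ik; rewrite /transposition -lock /= ik. Qed.

Lemma transposition_ge i k : (k <= i)%N -> transposition i k = 0.
Proof.
elim: k => [|k IH] ki; first by rewrite /transposition -lock.
rewrite transpositionS ?gtn_eqF // IH ?mulr0 ?mul0r ?oppr0 //; exact: ltnW.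
Qed.

Lemma jm_sum k : jm t k = \sum_(i < k) transposition i k.
Proof.
elim: k => [|k IH]; first by rewrite jm0 big_ord0.
rewrite jmS IH big_ord_recr /= transpositionSn addrC; congr (_ + _).
rewrite mulr_sumr mulr_suml -sumrN; apply: eq_bigr => i _.
by rewrite transpositionS // ltn_eqF.
Qed.

Hypothesis gensP : sergeev_gens.
Let tP : spin_rel N t. Proof. by case: gensP. Qed.
Let t2 k : (k < N)%N -> t k * t k = 1. Proof. by case: tP => + _ _; apply. Qed.
Let far j k : (j.+1 < k < N)%N -> anti (t j) (t k).
Proof. by case: tP => _ _; apply. Qed.
Let tc k a : (k < N)%N -> (a <= N)%N -> anti (t k) (c a).
Proof. by case: gensP => _ _ _; apply. Qed.

Lemma transposition_anti z i k :
  (forall j, (i <= j < k)%N -> anti z (t j)) -> anti z (transposition i k).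
Proof.
elim: k => [|k IH] zt.
  by rewrite /anti transposition_ge // mulr0 mul0r oppr0.
have [ik|ki] := leqP i k; last first.
  by rewrite /anti transposition_ge // mulr0 mul0r oppr0.
have ztk : anti z (t k) by apply: zt; rewrite ik /=.
have [->|ik'] := eqVneq i k; first by rewrite transpositionSn.
rewrite transpositionS //; apply/antiN/anti_sandwich => //.
by apply: IH => j /andP[ij jk]; apply: zt; rewrite ij ltnW.
Qed.

Lemma transposition_c i k a : (k <= N)%N -> (a <= N)%N ->
  anti (transposition i k) (c a).
Proof.
move=> kN aN; apply/anti_sym/transposition_anti => j /andP[_ jk].
by apply/anti_sym/tc => //; exact: leq_trans jk kN.
Qed.

Lemma jm_c k a : (k <= N)%N -> (a <= N)%N -> anti (jm t k) (c a).
Proof.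
move=> kN aN; rewrite jm_sum /anti mulr_suml mulr_sumr -sumrN.
by apply: eq_bigr => i _; apply: transposition_c.
Qed.

Lemma transposition2 i k : (i < k <= N)%N ->
  transposition i k * transposition i k = 1.
Proof.
elim: k => // k IH /andP[]; rewrite ltnS leq_eqVlt => /predU1P[->|ik] kN.
  by rewrite transpositionSn t2.
have kk : t k * t k = 1 by apply: t2.
have xx : transposition i k * transposition i k = 1 by apply: IH;
  rewrite ik ltnW.
rewrite transpositionS ?ltn_eqF // mulrNN; set x := transposition i k in xx *.
by rewrite -!mulrA (mulrA (t k) (t k)) kk mul1r (mulrA x x) xx mul1r.
Qed.

Lemma t_transposition i j k : (i < j)%N -> (j.+1 < k <= N)%N ->
  anti (t j) (transposition i k).
Proof.
move=> ij; elim: k => // k IH /andP[].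
rewrite ltnS leq_eqVlt => /predU1P[<-|jk] kN.
  rewrite !transpositionS ?ltn_eqF // 1?ltnW // mulrN mulNr opprK !mulrA.
  apply: (t_conj_anti tP) => //; apply: transposition_anti => l /andP[_ lj].
  by apply/anti_sym/far; rewrite ltnS lj.
have tjk : anti (t j) (t k) by apply: far; rewrite jk.
rewrite transpositionS; last by rewrite ltn_eqF // (ltn_trans ij) // ltnW.
by apply/antiN/anti_sandwich => //; apply: IH; rewrite jk ltnW.
Qed.

(** Nested pairs are exactly those met when the lexicographic product is reordered by columns. *)
Lemma transposition_nested i a b k : (i < a)%N -> (b < k <= N)%N ->
  anti (transposition i k) (transposition a b).
Proof.
move=> ia /andP[bk kN]; apply: transposition_anti => j /andP[aj jb].
apply/anti_sym/t_transposition; first exact: leq_trans ia aj.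
by rewrite kN (leq_ltn_trans jb).
Qed.

End SergeevRelations.

(** * The product over one column, by conjugation *)

Section Fusion.
Variables (K : comNzRingType) (B : algType K) (N : nat) (t c : nat -> B).
Variables (r r' : K).
Hypotheses (gensP : sergeev_gens N t c) (r2 : r * r = 2%:R) (rr' : r * r' = 1).

Let tP : spin_rel N t. Proof. by case: gensP. Qed.
Let t2 k : (k < N)%N -> t k * t k = 1. Proof. by case: tP => + _ _; apply. Qed.
Let tc k a : (k < N)%N -> (a <= N)%N -> anti (t k) (c a).
Proof. by case: gensP => _ _ _; apply. Qed.
Let cc a b : (a <= N)%N -> (b <= N)%N -> a != b -> anti (c a) (c b).
Proof. by case: gensP => _ _ + _; apply. Qed.
Let c2 a : (a <= N)%N -> c a * c a = -1.
Proof. by case: gensP => _ + _ _; apply. Qed.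

Local Notation jm := (jm t).
Local Notation tr := (transposition t).

(** The scalars form a commutative ring because they will be the polynomials in the variables u_a; r
    is a square root of 2. *)
Definition jmx k := locked (r *: (jm k * c k)).

Lemma jmxE k : jmx k = r *: (jm k * c k).
Proof. by rewrite /jmx -lock. Qed.

Lemma comm_even (x y z : B) : anti z x -> anti z y -> GRing.comm (x * y) z.
Proof. by move=> zx zy;
  rewrite /GRing.comm mulrA zx mulNr (antiA _ zy) opprK. Qed.

Lemma comm_scale (h : K) (x z : B) : GRing.comm x z -> GRing.comm (h *: x) z.
Proof. by rewrite /GRing.comm -scalerAl -scalerAr => ->. Qed.

Lemma jmx_t k j : (j < N)%N -> (k < j)%N || (j.+1 < k <= N)%N ->
  GRing.comm (jmx k) (t j).
Proof.
move=> jN kj; have kN : (k <= N)%N.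
  by case/orP: kj => [/ltnW kj|/andP[]//]; exact: leq_trans kj (ltnW jN).
rewrite jmxE; apply/comm_scale/comm_even; last exact: tc.
case/orP: kj => kj; first by apply: (t_jm_gt tP); rewrite kj.
exact: (t_jm_lt tP).
Qed.

Lemma jmx_c k a : (k <= N)%N -> (a <= N)%N -> k != a ->
  GRing.comm (jmx k) (c a).
Proof.
move=> kN aN ka; rewrite jmxE; apply/comm_scale/comm_even.
  exact/anti_sym/(jm_c gensP).
by apply: cc; rewrite // eq_sym.
Qed.

Lemma jmx_comm j k : (j < k <= N)%N -> GRing.comm (jmx j) (jmx k).
Proof.
move=> /andP[jk kN]; have jN : (j <= N)%N by rewrite ltnW // (leq_trans jk).
apply/commr_sym; rewrite jmxE; apply/comm_scale/commr_sym.
apply: commrM; last by apply: jmx_c; rewrite // ltn_eqF.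
rewrite jmxE; apply/comm_scale/comm_even; last exact: (jm_c gensP).
by apply/anti_sym/(jm_anti tP); rewrite jk.
Qed.

(** Divided by r, this even element is the simple transposition of the symmetric group that permutes
    the Clifford generators in the Sergeev superalgebra. *)
Definition swap k := locked (t k * (c k.+1 - c k)).

Lemma swapE k : swap k = t k * (c k.+1 - c k).
Proof. by rewrite /swap -lock. Qed.

Lemma swap2 k : (k < N)%N -> swap k * swap k = 2%:R.
Proof.
move=> kN; have kN' := ltnW kN.
have td : anti (t k) (c k.+1 - c k) by apply: antiB; apply: tc.
rewrite swapE mulrA (antiA _ (anti_sym td)) t2 // mul1r.
expand; rewrite !c2 // (cc kN' kN) ?ltn_eqF //.
by rewrite -[2%:R]/(1 + 1); nc.
Qed.

Lemma swap_transposition i k : (i < k < N)%N ->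
  swap k * tr i k = tr i k.+1 * swap k.
Proof.
move=> /andP[ik kN]; have kN' := ltnW kN.
have da : anti (tr i k) (c k.+1 - c k).
  by apply: antiB; apply: (transposition_c gensP).
rewrite swapE transpositionS ?ltn_eqF // mulNr !mulrA.
rewrite -(mulrA (t k * _) (t k) (t k)) t2 // mulr1.
by rewrite (antiA _ (anti_sym da)).
Qed.

Lemma swap_c_far i k : (i < k < N)%N -> swap k * c i = c i * swap k.
Proof.
move=> /andP[ik kN]; have iN : (i <= N)%N by apply: ltnW; exact: ltn_trans kN.
rewrite swapE; apply: comm_even; first exact/anti_sym/tc.
by apply: antiB; apply: cc; rewrite ?ltn_eqF ?(ltnW kN) // ltnW.
Qed.

Lemma swap_c k : (k < N)%N -> swap k * c k = c k.+1 * swap k.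
Proof.
move=> kN; have kN' := ltnW kN.
have ct : anti (c k.+1) (t k) by apply/anti_sym/tc.
by rewrite swapE mulrA ct; expand; rewrite -!mulrA !c2 //; nc.
Qed.

Variables (kappa : nat -> K) (u : K).

Definition pole i := kappa i ^+ 2 - u ^+ 2.
Definition phi_num i k := locked (r *: (tr i k * (kappa i *: c i - u *: c k))).

Lemma phi_numE i k : phi_num i k = r *: (tr i k * (kappa i *: c i - u *: c k)).
Proof. by rewrite /phi_num -lock. Qed.

(** Since this square is a scalar, pole - phi_num inverts pole + phi_num up to a scalar. Negating
    kappa_i and u negates the numerator and fixes the pole. *)
Lemma phi_num2 i k : (i < k <= N)%N ->
  phi_num i k * phi_num i k = (2%:R * (kappa i ^+ 2 + u ^+ 2))%:A.
Proof.
move=> /andP[ik kN]; have iN : (i <= N)%N by rewrite ltnW // (leq_trans ik).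
have ac : anti (c i) (c k) by apply: cc; rewrite // ltn_eqF.
set l := kappa i *: c i - u *: c k.
have tl : anti (tr i k) l.
  rewrite /l /anti mulrBr mulrBl -!scalerAr -!scalerAl.
  by rewrite !(transposition_c gensP) // !scalerN opprB opprK addrC.
have l2 : l * l = - (kappa i ^+ 2 + u ^+ 2)%:A.
  rewrite /l mulrBl !mulrBr -!scalerAl -!scalerAr !c2 // ac !scalerA !scalerN.
  by rewrite scalerDl !expr2 [u * kappa i]mulrC; zmodule.
rewrite phi_numE -/l -scalerAl -scalerAr mulrA (antiA _ (anti_sym tl)).
rewrite (transposition2 gensP) ?ik // mul1r mulNr l2 opprK !scalerA r2.
by [].
Qed.

Lemma jmx_phi_num j k : (j < k < N)%N -> GRing.comm (jmx j) (phi_num k k.+1).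
Proof.
move=> /andP[jk kN]; have kN' := ltnW kN.
apply/commr_sym; rewrite phi_numE; apply/comm_scale/commr_sym.
rewrite transpositionSn; apply: commrM.
  by apply: jmx_t => //; rewrite jk.
have jc a : (j < a <= N)%N -> GRing.comm (jmx j) (c a).
  move=> /andP[ja aN]; apply: jmx_c; rewrite ?ltn_eqF // ltnW //.
  exact: leq_trans aN.
by apply: commrB; apply/commr_sym/comm_scale/commr_sym/jc; rewrite ?jk // ltnW.
Qed.

Lemma jmx_swap j k : (j < k < N)%N -> GRing.comm (jmx j) (swap k).
Proof.
move=> /andP[jk kN]; have kN' := ltnW kN.
have jN : (j <= N)%N by rewrite ltnW // (ltn_trans jk).
rewrite swapE; apply: commrM; first by apply: jmx_t => //; rewrite jk.
by apply: commrB; apply: jmx_c; rewrite // ltn_eqF // ltnW.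
Qed.

Lemma swap_phi_num i k : (i < k < N)%N ->
  swap k * phi_num i k = phi_num i k.+1 * swap k.
Proof.
move=> /andP[ik kN]; have ikN : (i < k < N)%N by rewrite ik.
rewrite !phi_numE -scalerAr -scalerAl mulrA swap_transposition // -!mulrA.
rewrite mulrBr mulrBl -!scalerAr -!scalerAl swap_c_far // swap_c //.
Qed.

Lemma swap_jmx k : (k < N)%N ->
  swap k * jmx k = (jmx k.+1 - r *: (t k * c k.+1)) * swap k.
Proof.
move=> kN; have kN' := ltnW kN.
have dm : anti (c k.+1 - c k) (jm k).
  by apply/anti_sym/antiB; apply: (jm_c gensP).
have tt z : z * t k * t k = z by rewrite -mulrA t2 ?mulr1.
have ct : anti (c k.+1) (t k) by apply/anti_sym/tc.
have -> : jmx k.+1 - r *: (t k * c k.+1) = r *: (t k * jm k * c k.+1 * t k).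
  rewrite jmxE -scalerBr -mulrBl jmS; congr (_ *: _).
  by rewrite (antiA _ ct); nc.
rewrite jmxE swapE -scalerAr -scalerAl; congr (_ *: _).
rewrite !mulrA tt (antiA _ dm); expand.
by rewrite -!mulrA !c2 //; nc.
Qed.

(** Conjugation by the swap turns x_k into x_(k+1) minus a correction, by [swap_jmx]; on an
    eigenvector of x_k the factor of index k absorbs this correction. *)
Lemma phi_num_step v k : (k < N)%N -> v * jmx k = kappa k *: v ->
  v * (pole k *: 1 - phi_num k k.+1) * (u%:A - (jmx k.+1 - r *: (t k * c k.+1)))
  = pole k *: (v * (u%:A - jmx k.+1)).
Proof.
move=> kN vk; have kN' := ltnW kN.
set X := jmx k.+1 - _.
have XE : X = r *: (t k * jm k * c k.+1 * t k).
  have ct : anti (c k.+1) (t k) by apply/anti_sym/tc.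
  rewrite /X jmxE -scalerBr -mulrBl jmS; congr (_ *: _).
  by rewrite (antiA _ ct); nc.
have tt z : z * t k * t k = z by rewrite -mulrA t2 ?mulr1.
have t0 : anti (c k) (t k) by apply/anti_sym/tc.
have t1 : anti (c k.+1) (t k) by apply/anti_sym/tc.
have c01 : anti (c k.+1) (c k) by apply: cc; rewrite // gtn_eqF.
have m0 : anti (c k) (jm k) by apply/anti_sym/(jm_c gensP).
have m1 : anti (c k.+1) (jm k) by apply/anti_sym/(jm_c gensP).
have vm : r *: (v * jm k * c k) = kappa k *: v.
  by rewrite -vk jmxE -scalerAr mulrA.
(* Right multiplication by X preserves the span of v t_k c_k and v t_k c_(k+1): it exchanges the two
   vectors with the factor - kappa_k. *)
have e0 : v * t k * c k * X = - (kappa k *: (v * t k * c k.+1)).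
  have -> : v * t k * c k * X = r *: (v * jm k * c k) * c k.+1 * t k.
    rewrite XE -scalerAr -!scalerAl !mulrA (antiA _ t0) tt !mulNr (antiA _ m0).
    by rewrite !mulNr opprK.
  by rewrite vm -!scalerAl (antiA _ t1) scalerN.
have e1 : v * t k * c k.+1 * X = - (kappa k *: (v * t k * c k)).
  have -> : v * t k * c k.+1 * X = r *: (v * jm k * c k) * c k * t k.
    rewrite XE -scalerAr -!scalerAl !mulrA (antiA (v * t k) t1) tt !mulNr
      (antiA _ m1).
    by rewrite !mulNr opprK -!(mulrA (v * jm k)) !mulrA -!(mulrA _ (c _) (c _))
      !c2.
  by rewrite vm -!scalerAl (antiA _ t0) scalerN.
have vy : v * phi_num k k.+1 =
    r *: (kappa k *: (v * t k * c k) - u *: (v * t k * c k.+1)).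
  rewrite phi_numE transpositionSn -scalerAr mulrBr -!scalerAr mulrBr.
  by rewrite -!scalerAr !mulrA.
have e : v * phi_num k k.+1 * (u%:A - X) = (pole k * r) *: (v * t k * c k.+1).
  rewrite mulrBr mulr_algr vy -scalerAl mulrBl -!scalerAl e0 e1.
  rewrite !scalerBr !scalerN !scalerA /pole.
rewrite [u * r](mulrC u).
  rewrite (_ : (_ ^+ 2 - _) * r = r * kappa k * kappa k - r * u * u).
    by rewrite scalerBl; zmodule.
  by ring.
rewrite (mulrBr v) -scalerAr mulr1 mulrBl -scalerAl e {1}/X opprB.
rewrite addrA addrAC (mulrDr v) scalerDr -scalerAr mulrA scalerA.
by rewrite addrK.
Qed.

(* The products phi_(j-1,k) ... phi_(0,k) and phi_(0,k) ... phi_(j-1,k) with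
   denominators cleared, the first one of the inverses up to scalars. *)
Fixpoint phi_inv_prod k j : B :=
  if j is j'.+1 then (pole j' *: 1 - phi_num j' k) * phi_inv_prod k j' else 1.

Fixpoint phi_prod k j : B :=
  if j is j'.+1 then phi_prod k j' * (pole j' *: 1 + phi_num j' k) else 1.

Lemma swap_phi_inv_prod k j : (j <= k < N)%N ->
  swap k * phi_inv_prod k j = phi_inv_prod k.+1 j * swap k.
Proof.
move=> /andP[jk kN]; elim: j jk => [|j IH] jk /=; first by rewrite mulr1 mul1r.
rewrite mulrA.
have -> : swap k * ((pole j)%:A - phi_num j k) =
    ((pole j)%:A - phi_num j k.+1) * swap k.
  by rewrite mulrBr mulrBl -scalerAr -scalerAl mulr1 mul1r swap_phi_num ?jk.
by rewrite -mulrA IH ?mulrA // ltnW.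
Qed.

(** The induction hypothesis is applied to v P S, with P the new factor and S the swap. This is
    still an eigenvector of the x_i with i < k, and moving S to the right raises the column index
    from k to k + 1. At the end S is cancelled, as S^2 = 2 is invertible. *)
Lemma jmx_phi_inv v k : (k <= N)%N ->
  (forall i, (i < k)%N -> v * jmx i = kappa i *: v) ->
  (\prod_(i < k) pole i) *: (v * (u%:A - jmx k)) = u *: (v * phi_inv_prod k k).
Proof.
elim: k v => [|k IH] v kN vk.
  by rewrite big_ord0 scale1r jmxE jm0 mul0r scaler0 subr0 mulr1 mulr_algr.
set S := swap k; set P := (pole k)%:A - phi_num k k.+1.
have SS : S * S = 2%:R by exact: swap2.
have vPS i : (i < k)%N -> v * P * S * jmx i = kappa i *: (v * P * S).
  move=> ik; have ikN : (i < k < N)%N by rewrite ik.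
  have Pi : GRing.comm (jmx i) P.
    apply: commrB; last exact: jmx_phi_num.
    by apply/commr_sym/comm_scale/commr_sym/commr1.
  have Si : jmx i * S = S * jmx i by exact: jmx_swap.
  rewrite -(mulrA (v * P)) -Si mulrA -(mulrA v P) -[P * _]Pi mulrA vk ?leqW //.
  by rewrite -!scalerAl.
have := IH (v * P * S) (ltnW kN) vPS.
rewrite -(mulrA _ S (phi_inv_prod k k)) swap_phi_inv_prod ?leqnn //.
have -> : v * P * S * (u%:A - jmx k) =
    v * P * (u%:A - (jmx k.+1 - r *: (t k * c k.+1))) * S.
  rewrite -!(mulrA (v * P)); congr (_ * _).
  by rewrite mulrBr mulrBl mulr_algr mulr_algl swap_jmx.
rewrite phi_num_step ?vk // => e.
have half z : r' ^+ 2 *: (z * S * S) = z.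
  rewrite -mulrA SS mulr_natr -scaler_nat scalerA -r2 expr2.
  by rewrite mulrACA [r' * r]mulrC rr' mulr1 scale1r.
have cancelS z1 z2 : z1 * S = z2 * S -> z1 = z2.
  by move=> z12; rewrite -(half z1) z12 half.
apply: cancelS; rewrite big_ord_recr /= -scalerA -!scalerAl in e *.
by rewrite e !mulrA.
Qed.

Lemma phi_inv_prodK k j : (j <= k <= N)%N ->
  phi_inv_prod k j * phi_prod k j =
  (\prod_(i < j) (pole i ^+ 2 - 2%:R * (kappa i ^+ 2 + u ^+ 2)))%:A.
Proof.
move=> /andP[jk kN]; elim: j jk => [|j IH] jk /=.
  by rewrite big_ord0 mulr1 scale1r.
rewrite mulrA -(mulrA _ (phi_inv_prod k j)) IH ?(ltnW jk) //.
rewrite mulr_algr -scalerAl big_ord_recr /= -scalerA; congr (_ *: _).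
rewrite mulrDr !mulrBl -!scalerAl !mul1r -scalerAr mulr1 phi_num2 ?jk //.
by rewrite scalerA -expr2 [RHS]scalerBl; zmodule.
Qed.

Lemma jmx_phi_prod v k : (k <= N)%N ->
  (forall i, (i < k)%N -> v * jmx i = kappa i *: v) ->
  (\prod_(i < k) pole i) *: (v * (u%:A - jmx k) * phi_prod k k) =
  (u * \prod_(i < k) (pole i ^+ 2 - 2%:R * (kappa i ^+ 2 + u ^+ 2))) *: v.
Proof.
move=> kN vk; rewrite scalerAl jmx_phi_inv // -scalerAl -mulrA.
by rewrite phi_inv_prodK ?leqnn // mulr_algr scalerA.
Qed.

(* For p = prod_(b <- bs) (X - b), this is (p(u) - p(x)) / (u - x). *)
Fixpoint div_diff (bs : seq K) (x : B) : B :=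
  if bs is b :: bs' then
    (u - b) *: div_diff bs' x + \prod_(b <- bs') (x - b%:A)
  else 0.

Lemma comm_prod_sub (bs : seq K) (x z : B) : GRing.comm z x ->
  GRing.comm z (\prod_(b <- bs) (x - b%:A)).
Proof.
move=> zx; apply: commr_prod => b _; apply: commrB => //.
by apply/commr_sym/comm_scale/commr_sym/commr1.
Qed.

Lemma comm_div_diff (bs : seq K) (x z : B) : GRing.comm z x ->
  GRing.comm z (div_diff bs x).
Proof.
move=> zx; elim: bs => [|b bs IH] /=; first exact: commr0.
apply: commrD; last exact: comm_prod_sub.
exact/commr_sym/comm_scale/commr_sym.
Qed.

Lemma div_diffP (bs : seq K) (x : B) :
  div_diff bs x * (u%:A - x) =
  (\prod_(b <- bs) (u - b))%:A - \prod_(b <- bs) (x - b%:A).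
Proof.
elim: bs => [|b bs IH] /=; first by rewrite !big_nil mul0r scale1r subrr.
rewrite mulrDl -scalerAl IH !big_cons.
have xP := comm_prod_sub bs (commr_refl x).
move: xP; set P := \prod_(_ <- _) (x - _); set p := \prod_(_ <- _) _ => xP.
rewrite (mulrBr P) (mulrBl P) xP mulr_algr mulr_algl scalerBr scalerA.
by rewrite [(u - b) *: P]scalerBl; zmodule.
Qed.

(** Since v p(x_k) = 0 for p = prod (X - b), [div_diffP] says that v times the difference quotient
    behaves like p(u) v (u - x_k)^-1. It is still an eigenvector of the earlier x_i, because the x_i
    commute, so [jmx_phi_prod] applies to it. *)
Lemma jmx_fusion v k (bs : seq K) : (k <= N)%N ->
  (forall i, (i < k)%N -> v * jmx i = kappa i *: v) ->
  v * \prod_(b <- bs) (jmx k - b%:A) = 0 ->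
  (\prod_(i < k) pole i * \prod_(b <- bs) (u - b)) *: (v * phi_prod k k) =
  (u * \prod_(i < k) (pole i ^+ 2 - 2%:R * (kappa i ^+ 2 + u ^+ 2))) *:
    (v * div_diff bs (jmx k)).
Proof.
move=> kN vk v0; rewrite -jmx_phi_prod //; last first.
  move=> i ik; rewrite -mulrA -(comm_div_diff bs (jmx_comm _)) ?ik //.
  by rewrite mulrA vk // scalerAl.
rewrite -(mulrA v) div_diffP mulrBr v0 subr0 mulr_algr -scalerAl.
by rewrite scalerA.
Qed.

End Fusion.

(** * Schur's formula for the number of standard shifted tableaux *)

Section PartialFractions.
Variables (F : fieldType) (I : eqType) (A B : I -> F).

(* Compares the coefficients of X^(size s - 1) in
   prod (X - A j) - prod (X - B j) and in its Lagrange interpolation at the B j. *)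
Lemma sum_residues (s : seq I) : uniq s -> {in s &, injective B} ->
  \sum_(k <- s) (A k - B k) *
    \prod_(j <- s | j != k) ((B k - A j) / (B k - B j))
  = \sum_(k <- s) (A k - B k).
Proof.
move=> us injB.
pose PA : {poly F} := \prod_(j <- s) ('X - (A j)%:P);
  pose PB : {poly F} := \prod_(j <- s) ('X - (B j)%:P).
pose Q k : {poly F} := \prod_(j <- s | j != k) ('X - (B j)%:P).
pose r k := (B k - A k) * \prod_(j <- s | j != k) ((B k - A j) / (B k - B j)).
pose L : {poly F} := \sum_(k <- s) r k *: Q k.
have szP (f : I -> F) (t : seq I) :
    size (\prod_(j <- t) ('X - (f j)%:P)) = (size t).+1.
  by rewrite size_prod_XsubC.
have QE k : Q k = \prod_(j <- [seq j <- s | j != k]) ('X - (B j)%:P).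
  by rewrite big_filter.
have szs k : k \in s -> (size [seq j <- s | j != k]).+1 = size s.
  move=> ks; rewrite -(rem_filter k us) size_rem // prednK //.
  by case: (s) ks.
have [->|s0] := eqVneq s [::]; first by rewrite !big_nil.
have sz0 : (0 < size s)%N by rewrite lt0n size_eq0.
have monP (f : I -> F) : \prod_(j <- s) ('X - (f j)%:P) \is @monic F.
  by rewrite monic_prod_XsubC.
have top (f : I -> F) : (\prod_(j <- s) ('X - (f j)%:P))`_(size s) = 1.
  by have /monicP := monP f; rewrite /lead_coef szP.
have next (f : I -> F) : (\prod_(j <- s) ('X - (f j)%:P))`_(size s).-1 =
  - \sum_(j <- s) f j.
  have := @coefPn_prod_XsubC F (map f s); rewrite size_map -lt0n => /(_ sz0).
  by rewrite !big_map.
have L0 j : (size s <= j)%N -> L`_j = 0.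
  move=> sj; rewrite coef_sum big_seq big1 // => k ks; rewrite coefZ.
  by rewrite (@nth_default _ _ (Q k)) ?mulr0 // QE szP szs.
have szD : (size (PA - PB - L)%R <= size s)%N.
  apply/leq_sizeP => j sj; rewrite !coefB L0 // subr0.
  move: sj; rewrite leq_eqVlt => /predU1P[<-|lt]; first by rewrite !top subrr.
  by rewrite (@nth_default _ _ PA) ?(@nth_default _ _ PB) ?subrr ?szP.
have PB0 k : k \in s -> PB.[B k] = 0.
  move=> ks; rewrite horner_prod (big_rem k ks) /= !hornerE subrr mul0r //.
have Qj k j : j \in s -> j != k -> (Q k).[B j] = 0.
  move=> js jk; rewrite horner_prod (big_rem j js) jk /= !hornerE subrr mul0r
    //.
(* A polynomial of degree below the number of nodes that vanishes at all the distinct B k. *)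
have D0 : PA - PB - L = 0.
  apply: (@roots_geq_poly_eq0 _ _ (map B s)); last by rewrite size_map.
    apply/allP => _ /mapP[k ks ->]; rewrite rootE !hornerE PB0 // subr0.
    have -> : L.[B k] = (r k *: Q k).[B k].
      rewrite /L horner_sum (bigD1_seq k) //= big_seq_cond big1 ?addr0 // => j.
      by move=> /andP[js jk]; rewrite hornerZ Qj ?mulr0 // eq_sym.
    rewrite hornerZ /r /PA !horner_prod (bigD1_seq k) //= !hornerE.
    rewrite -mulrA -big_split /= subr_eq0; apply/eqP; congr (_ * _).
    rewrite big_seq_cond [RHS]big_seq_cond; apply: eq_bigr => j /andP[js jk].
    rewrite !hornerE divfK // subr_eq0; apply: contra jk => /eqP /injB.
    by move=> ->.
  by rewrite map_inj_in_uniq.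
have /(congr1 (fun p : {poly F} => p`_(size s).-1)) := D0.
rewrite !coefB coef0 !next coef_sum => /eqP.
rewrite opprK [- _ + _]addrC -sumrB subr_eq0 => /eqP e.
apply: oppr_inj; rewrite -!sumrN.
under [RHS]eq_bigr do rewrite opprB.
rewrite [RHS]e !big_seq; apply: eq_bigr => k ks.
rewrite coefZ (_ : (Q k)`_ _ = 1) ?mulr1 ?mulrN -?mulNr ?opprB //.
by have /monicP := monic_prod_XsubC [seq j <- s | j != k] predT B;
  rewrite -QE /lead_coef QE szP -(szs k ks).
Qed.

End PartialFractions.

Section HookProduct.
Variable F : numFieldType.
Implicit Types (la mu : seq nat) (i j k : nat).

(* This is n! / g_la, by Schur's formula. *)
Fixpoint hook_prod la : F :=
  if la is k :: l then
    k`!%:R * \prod_(j <- l) ((k%:R + j%:R) / (k%:R - j%:R)) * hook_prod l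
  else 1.

(** The quotient of (a + 1 + j) / (a + 1 - j) by (a + j) / (a - j). Reversing both differences does
    not change it, so larger and smaller parts j are treated alike. *)
Definition hook_step a j : F :=
  ((a%:R - j%:R) * (a.+1%:R + j%:R)) / ((a.+1%:R - j%:R) * (a%:R + j%:R)).

Lemma strict_uniq mu : strict mu -> uniq mu.
Proof.
case/andP=> s0 _; apply: sorted_uniq s0 => [|x]; last exact: ltnn.
by move=> x y z /= yx zx; apply: ltn_trans yx.
Qed.

Lemma strict_cons k mu : strict (k :: mu) ->
  [/\ strict mu, k \notin mu & (0 < k)%N].
Proof.
move=> st; have := strict_uniq st; move: st => /= /andP[/= srt].
rewrite inE negb_or eq_sym -lt0n => /andP[k0 n0] /andP[kmu _]; split=> //.
by rewrite /strict (path_sorted srt).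
Qed.

(** The condition [f 0 = 1] covers a box that opens a new row, whose old length is the default 0. *)
Lemma prod_incr_nth (f : nat -> F) mu i : f 0%N = 1 -> (i <= size mu)%N ->
  (\prod_(j <- incr_nth mu i) f j) * f (nth 0%N mu i) =
  (\prod_(j <- mu) f j) * f (nth 0%N mu i).+1.
Proof.
move=> f0; elim: mu i => [|m mu IH] [|i] //= ile.
- by rewrite big_seq1 big_nil f0 mulr1 mul1r.
- by rewrite !big_cons mulrAC [RHS]mulrAC mulrC [RHS]mulrC; congr (_ * _);
  rewrite mulrC.
- by rewrite !big_cons -!mulrA IH.
Qed.

Lemma hook_prod_neq0 mu : strict mu -> hook_prod mu != 0.
Proof.
elim: mu => [|k mu IH] st /=; first exact: oner_neq0.
have [st' kmu k0] := strict_cons st; rewrite !mulf_neq0 ?IH //.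
  by rewrite pnatr_eq0 -lt0n fact_gt0.
rewrite prodf_seq_neq0; apply/allP => j jmu /=; rewrite mulf_neq0 ?invr_neq0 //.
  by rewrite -natrD pnatr_eq0 -lt0n ltn_addr.
by rewrite subr_eq0 eqr_nat; apply: contraNneq kmu => ->.
Qed.

Lemma hook_prod_incr mu i (a := nth 0%N mu i) : strict mu ->
  strict (incr_nth mu i) ->
  hook_prod (incr_nth mu i) =
  hook_prod mu * (a.+1%:R * \prod_(j <- mu | j != a) hook_step a j).
Proof.
move=> st st'; have := strict_incr_size st'; rewrite {}/a.
elim: mu i st st' => [|k mu IH] [|i] //= st st' ile.
- by rewrite !big_nil !mulr1.
- have [st1 kmu k0] := strict_cons st; have [_ k1mu _] := strict_cons st'.
  rewrite factS natrM big_cons eqxx /=.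
  have -> : \prod_(j <- mu | j != k) hook_step k j =
    \prod_(j <- mu) hook_step k j.
    rewrite big_mkcond big_seq [RHS]big_seq; apply: eq_bigr => j jmu.
    by case: eqVneq => // jk; rewrite -jk jmu in kmu.
  have -> : \prod_(j <- mu) ((k.+1%:R + j%:R) / (k.+1%:R - j%:R)) =
      \prod_(j <- mu) ((k%:R + j%:R) / (k%:R - j%:R)) *
        \prod_(j <- mu) hook_step k j :> F.
    rewrite -big_split big_seq [RHS]big_seq; apply: eq_bigr => j jmu /=.
    have h1 : k%:R + j%:R != 0 :> F by rewrite -natrD pnatr_eq0 -lt0n ltn_addr.
    have h2 : k%:R - j%:R != 0 :> F.
      by rewrite subr_eq0 eqr_nat; apply: contraNneq kmu => ->.
    have h3 : k.+1%:R - j%:R != 0 :> F.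
      by rewrite subr_eq0 eqr_nat; apply: contraNneq k1mu => ->.
    rewrite /hook_step; move: h1 h2 h3;
      move: (k%:R : F) (j%:R : F) (k.+1%:R : F).
    by move=> x y z h1 h2 h3; field; rewrite h1 h2 h3.
  by ring.
have [st1 kmu k0] := strict_cons st; have [st1' kmu' _] := strict_cons st'.
set a := nth 0%N mu i; have aS : a.+1 \in incr_nth mu i.
  by apply/mem_strict => //; exists i; rewrite nth_incr_nth eqxx.
have ka1 : k != a.+1 by apply: contraNneq kmu' => ->.
have ka : k != a.
  apply: contraNneq kmu => ka; apply/mem_strict => //; by exists i.
rewrite (IH i) // -/a big_cons ka.
pose f j : F := (k%:R + j%:R) / (k%:R - j%:R).
have k0F : k%:R != 0 :> F by rewrite pnatr_eq0 -lt0n.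
have f0 : f 0%N = 1 by rewrite /f addr0 subr0 divff.
have := prod_incr_nth f0 ile; rewrite -/a.
rewrite -/(\prod_(j <- incr_nth mu i) f j) -/(\prod_(j <- mu) f j) => e.
have h1 b : k%:R + b%:R != 0 :> F by rewrite -natrD pnatr_eq0 -lt0n ltn_addr.
have h2 b : k != b -> k%:R - b%:R != 0 :> F by rewrite subr_eq0 eqr_nat.
have fa0 : f a != 0 by rewrite mulf_neq0 ?invr_neq0 ?h2.
have -> : \prod_(j <- incr_nth mu i) f j = \prod_(j <- mu) f j * hook_step a k.
  apply: (mulIf fa0); rewrite e -mulrA; congr (_ * _).
  have := h2 _ ka1; have := h2 _ ka; have := h1 a => n1 n2 n3.
  have n4 : a.+1%:R - k%:R != 0 :> F by rewrite -oppr_eq0 opprB.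
  have n5 : a%:R + k%:R != 0 :> F by rewrite addrC.
  rewrite /f /hook_step; move: n1 n2 n3 n4 n5.
  move: (k%:R : F) (a%:R : F) (a.+1%:R : F) => x y z n1 n2 n3 n4 n5.
  by field; rewrite n2 n3 n4 n5.
by ring.
Qed.

(** The recursion that n! / g_la must satisfy by the branching rule. After extension by zero terms
    to all rows, it is an instance of [sum_residues]. *)
Lemma sum_hook_prod la : strict la ->
  \sum_(i < size la | removable_row la i)
    hook_prod la / hook_prod (decr_row la i) = (sumn la)%:R.
Proof.
move=> st; have ula := strict_uniq st; have /strictP[n0 dec] := st.
pose R k : F := k%:R * \prod_(j <- la | j != k) hook_step k.-1 j.
have RE i : removable_row la i ->
    hook_prod la / hook_prod (decr_row la i) = R (nth 0%N la i).
  move=> rem; have [st' e] := decr_rowP st rem;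
    move: (decr_row la i) st' e => mu st' e.
  have ste : strict (incr_nth mu i) by rewrite e.
  rewrite -{1}e hook_prod_incr // mulrAC divff ?mul1r ?hook_prod_neq0 //.
  have -> : nth 0%N la i = (nth 0%N mu i).+1 by rewrite -e nth_incr_nth eqxx.
  rewrite /R /=; congr (_ * _); rewrite -big_filter -[RHS]big_filter.
  apply: perm_big; apply: uniq_perm; rewrite ?filter_uniq ?strict_uniq // => j.
  rewrite !mem_filter -e; have [->|j0] := posnP j.
    have /strictP[/negPf -> _] := st'; have /strictP[/negPf -> _] := ste.
    by rewrite !andbF.
  rewrite mem_incr_nth // andbC;
    case: (eqVneq j (nth 0%N mu i).+1) => [->|_] /=.
    by rewrite (negPf (strict_incr_notin st' ste)).
  by [].
(* If row i is not removable, the next part is one less than part i, and [hook_step] at that part is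
   zero. *)
have R0 i : (i < size la)%N -> ~~ removable_row la i -> R (nth 0%N la i) = 0.
  rewrite -strict_gt0 // => i0;
    rewrite /removable_row negb_or -leqNgt => /andP[i1 le].
  have [a1 a2] : (0 < nth 0%N la i.+1)%N /\
    (nth 0%N la i.+1 = (nth 0%N la i).-1)%N.
    by have := dec i; lia.
  have mem : nth 0%N la i.+1 \in la by apply/mem_strict => //; exists i.+1.
  rewrite /R (big_rem _ mem) a2 /=;
    have -> : ((nth 0%N la i).-1 != nth 0%N la i)%N by lia.
  by rewrite /hook_step subrr !mul0r mulr0.
transitivity (\sum_(i < size la) R (nth 0%N la i)).
  rewrite big_mkcond; apply: eq_bigr => i _; case: ifPn => [/RE //|/R0 -> //].
rewrite -(big_mkord xpredT (fun i => R (nth 0%N la i))) -(big_nth 0%N xpredT R).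
(* The squared signed contents of the box to be added to a row of length k and of its last box;
   their difference is 2 k. *)
pose A k : F := k%:R * (k%:R + 1); pose B k : F := k%:R * (k%:R - 1).
have AB k : A k - B k = k%:R * 2%:R by rewrite /A /B; ring.
have two : 2%:R != 0 :> F by rewrite pnatr_eq0.
apply: (mulIf two); rewrite sumnE natr_sum !mulr_suml.
have injB : {in la &, injective B}.
  move=> k j kla jla; rewrite /B => e; apply/eqP;
    rewrite -(eqr_nat F) -subr_eq0.
  have k0 : (0 < k)%N by rewrite lt0n; apply: contraNneq n0 => <-.
  have j0 : (0 < j)%N by rewrite lt0n; apply: contraNneq n0 => <-.
  have : (k%:R - j%:R) * (k + j).-1%:R == 0 :> F.
    by rewrite -subn1 natrB ?addn_gt0 ?k0 // natrD; apply/eqP; move/eqP: e;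
      rewrite -subr_eq0 => /eqP <-; ring.
  rewrite mulf_eq0 pnatr_eq0 => /orP[//|].
  case: (eqVneq k j) => [->|]; rewrite ?subrr //; lia.
transitivity (\sum_(k <- la) (A k - B k)); last first.
  by apply: eq_bigr => k _; rewrite AB.
rewrite -(sum_residues A ula injB) !big_seq; apply: eq_bigr => k kla.
rewrite AB /R mulrAC; congr (_ * _);
  rewrite [LHS]big_seq_cond [RHS]big_seq_cond.
have k0 : (0 < k)%N by rewrite lt0n; apply: contraNneq n0 => <-.
apply: eq_bigr => j /andP[jla jk]; rewrite /hook_step prednK //.
have -> : k.-1%:R = k%:R - 1 :> F by rewrite -subn1 natrB.
by rewrite /A /B; congr (_ / _); ring.
Qed.

Lemma sumn_incr_nth mu i : sumn (incr_nth mu i) = (sumn mu).+1.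
Proof.
elim: mu i => [|m mu IH] [|i] //=; last by rewrite IH addnS.
by elim: i => //= i IH.
Qed.

Lemma size_words_hook n la : strict la -> sumn la = n ->
  (size (words n la))%:R * hook_prod la = n`!%:R.
Proof.
elim: n la => [|n IH] la st sum.
  case: la st sum => [|k la] st /=; first by rewrite mulr1.
  by have [_ _ k0] := strict_cons st; lia.
rewrite size_wordsS natr_sum mulr_suml factS natrM -{1}sum -(sum_hook_prod st).
rewrite mulr_suml; apply: eq_bigr => i rem.
have [st' e] := decr_rowP st rem.
have sum' : sumn (decr_row la i) = n.
  by apply: succn_inj; rewrite -sum -(sumn_incr_nth _ i) e.
by rewrite -(IH _ st' sum'); field; rewrite hook_prod_neq0.
Qed.

Lemma num_standard_hook n la : strict_partition n la ->
  (num_standard n la)%:R * hook_prod la = n`!%:R.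
Proof. by case/andP => st /eqP sum;
  rewrite num_standard_words // size_words_hook. Qed.

End HookProduct.

(** * Eigenvectors attached to barred tableaux *)

Section SergeevGenerators.
Variables (C : numClosedFieldType) (n : nat).
Local Notation S := (sergeev C n).
Local Notation t := (t_ C n).
Local Notation c := (c_ C n).

Lemma t_ord (k : nat) (kn : (k < n.-1)%N) : t k = sergeev_t (Ordinal kn).
Proof. by rewrite /t_ insubT. Qed.

Lemma c_ord (a : nat) (an : (a < n)%N) : c a = sergeev_c (Ordinal an).
Proof. by rewrite /c_ insubT. Qed.

Lemma sergeev_gensP : (0 < n)%N -> sergeev_gens n.-1 t c.
Proof.
move=> n0.
have rel (r : S) : sergeev_rel sergeev_t sergeev_c r -> r = 0.
  exact: sergeev_rel_eq0.
have le_lt a : (a <= n.-1)%N -> (a < n)%N by rewrite -ltnS prednK.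
split; first split.
- move=> k kn; rewrite !(t_ord kn); apply/eqP; rewrite -subr_eq0; apply/eqP.
  by apply: rel; constructor.
- move=> k kn; have kn' := ltnW kn; rewrite !(t_ord kn) !(t_ord kn').
  by apply/eqP; rewrite -subr_eq0; apply/eqP/rel; constructor.
- move=> j k /andP[jk kn]; have jn : (j < n.-1)%N.
    by apply: ltn_trans kn; exact: ltnW.
  rewrite /anti (t_ord kn) (t_ord jn).
  by apply/eqP; rewrite -addr_eq0; apply/eqP/rel; constructor; rewrite /= jk.
- move=> a /le_lt an; rewrite !(c_ord an); apply/eqP; rewrite -addr_eq0.
  by apply/eqP/rel; constructor.
- move=> a b /le_lt an /le_lt bn ab; rewrite /anti (c_ord an) (c_ord bn).
  by apply/eqP; rewrite -addr_eq0; apply/eqP/rel; constructor.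
- move=> k a kn /le_lt an; rewrite /anti (t_ord kn) (c_ord an).
  by apply/eqP; rewrite -addr_eq0; apply/eqP/rel; constructor.
Qed.

Lemma transpE i k : (i < k)%N -> transp C n i k = transposition t i k.
Proof.
move=> ik; rewrite /transp ik; elim: k ik => // k IH.
rewrite ltnS leq_eqVlt => /predU1P[->|ik].
  rewrite transpositionSn /transp_lt subSnn expr0 scale1r /index_iota subnn.
  by rewrite !big_nil mul1r mulr1.
rewrite transpositionS ?ltn_eqF // -IH // /transp_lt.
have -> : index_iota i.+1 k.+1 = rcons (index_iota i.+1 k) k.
  by rewrite /index_iota subSS -(subnSK ik) -cats1 -[(k - i.+1).+1]addn1 iotaD
    subnKC.
rewrite rev_rcons big_cons big_rcons /=.
have -> : ((k.+1 - i).-1 = (k - i).-1.+1)%N by lia.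
by rewrite exprS mulN1r scaleNr !mulrA -scalerAr -scalerAl !mulrA.
Qed.

Lemma jm_mE k : jm_m C n k = jm t k.
Proof.
rewrite /jm_m jm_sum big_mkord; apply: eq_bigr => i _; exact: transpE.
Qed.

Lemma jm_xE k : jm_x C n k = jmx t c (sqrtC 2%:R) k.
Proof. by rewrite /jm_x jmxE jm_mE. Qed.

End SergeevGenerators.

Section SignedSpectrum.
Variables (C : numClosedFieldType) (B : algType C) (N : nat) (t c : nat -> B).
Variable (r : C).
Hypotheses (gensP : sergeev_gens N t c) (r2 : r * r = 2%:R).
Local Notation jmx := (jmx t c r).
Local Notation jm := (jm t).
Local Notation ev x := (horner_alg x).

Let c2 a : (a <= N)%N -> c a * c a = -1.
Proof. by case: gensP => _ + _ _; apply. Qed.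

Lemma jmx2 k : (k <= N)%N -> jmx k * jmx k = 2%:R *: (jm k * jm k).
Proof.
move=> kN; have mc : anti (c k) (jm k) by apply/anti_sym/(jm_c gensP).
rewrite jmxE -scalerAl -scalerAr scalerA r2 mulrA (antiA _ mc) mulNr.
by rewrite -(mulrA _ (c k)) c2 // mulrN opprK mulr1.
Qed.

(** Eigenvectors of x_k yield weights of m_k because x_k^2 = 2 m_k^2. At content 0 the kernel
    condition follows by cancelling c_k in m_k c_k. *)
Lemma jmx_eig v k (h : C) a : (k <= N)%N -> h ^+ 2 = (a * a.+1)%:R ->
  v * jmx k = h *: v -> eig v (jm k) a.
Proof.
move=> kN h2 vk; have two : 2%:R != 0 :> C by rewrite pnatr_eq0.
apply: eigP => a0.
  have h0 : h = 0 by apply/eqP; rewrite -sqrf_eq0 h2 a0.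
  have /eqP := vk; rewrite h0 scale0r jmxE -scalerAr scaler_eq0.
  have /negPf -> : r != 0.
    by apply: contra_neq two => r0; rewrite -r2 r0 mul0r.
  rewrite /= => /eqP /(congr1 (fun z => z * c k)).
  rewrite mul0r mulrA -(mulrA _ (c k)) c2 // mulrN1 => /eqP.
  by rewrite oppr_eq0 => /eqP.
apply: (scalerI two); rewrite -mulrA scalerAr -jmx2 // mulrA vk -scalerAl vk.
rewrite !scalerA -expr2 h2; congr (_ *: _).
by rewrite -natrM -tri_double mul2n.
Qed.

(** The counterpart of [fpol] for x_k, the roots being rescaled by x_k^2 = 2 m_k^2. *)
Definition gpol a : {poly C} :=
  if a is 0%N then 'X else 'X^2 - ((a * a.+1)%:R)%:P.

Lemma jmx_annihilated v k (L : seq nat) : (k <= N)%N -> uniq L ->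
  v * ev (jm k) (\prod_(a <- L) fpol C a) = 0 ->
  v * ev (jmx k) (\prod_(a <- L) gpol a) = 0.
Proof.
move=> kN uL; have two : 2%:R != 0 :> C by rewrite pnatr_eq0.
have pos (s : seq nat) : 0%N \notin s ->
    ev (jmx k) (\prod_(a <- s) gpol a) =
    (2%:R ^+ size s) *: ev (jm k) (\prod_(a <- s) fpol C a).
  elim: s => [|a s IH]; first by rewrite !big_nil !rmorph1 scale1r.
  rewrite inE negb_or eq_sym !big_cons => /andP[a0 s0].
  have fa : ev (jmx k) (gpol a) = 2%:R *: ev (jm k) (fpol C a).
    case: a a0 => // a _; rewrite /= !ev_quad jmx2 // scalerBr; congr (_ - _).
    by rewrite scalerA -natrM -tri_double mul2n.
  by rewrite !rmorphM /= fa IH // -scalerAl -scalerAr scalerA exprS.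
have [L0|L0] := boolP (0%N \in L); last first.
  by move=> vL; rewrite pos // -scalerAr vL scaler0.
rewrite !(big_rem _ L0) /=; set s := rem _ _.
have s0 : 0%N \notin s by rewrite mem_rem_uniq // inE eqxx.
(* The simple factor is moved to the right end, where x_k = r m_k c_k begins with m_k. *)
rewrite !(mulrC 'X) !rmorphM /= !horner_algX pos // mulrA => e.
rewrite -scalerAl -scalerAr jmxE !mulrA -!scalerAr !mulrA e mul0r.
by rewrite !scaler0.
Qed.

End SignedSpectrum.

Section BarredTableau.
Variables (C : numClosedFieldType) (n : nat) (la : seq nat).
Variable U : barred_filling n la.
Hypotheses (la_strict : strict la) (U_std : standard_barred U).
Local Notation T := (entries U).
Local Notation mu := (subshape U).
Local Notation kap := (kappa C U).

Let T_std : standard T. Proof. by case/andP: U_std. Qed.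

(** The row length before entry k is added; since shifted rows start on the diagonal, it is j - i
    for the box (i, j) of that entry. *)
Definition content k : nat := nth 0%N (mu k) (entry_row T k).

Definition content_path k : seq nat := [seq content j | j <- rev (iota 0 k)].

Lemma content_pathS k : content_path k.+1 = content k :: content_path k.
Proof. by rewrite /content_path -addn1 iotaD rev_cat. Qed.

Lemma size_content_path k : size (content_path k) = k.
Proof. by rewrite size_map size_rev size_iota. Qed.

Lemma subshape_strict k : strict (mu k).
Proof. exact: prefix_shape_strict. Qed.

Lemma subshape0 : mu 0 = [::].
Proof. exact: prefix_shape0. Qed.

Lemma subshapen : mu n = la.
Proof. exact: prefix_shapen. Qed.

Lemma subshapeS k : (k < n)%N -> mu k.+1 = incr_nth (mu k) (entry_row T k).
Proof.
move=> kn; have [b Tb] := standard_entry T_std kn.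
by rewrite -Tb entry_rowE //; exact: prefix_shapeS.
Qed.

Lemma content_path_ok k : (k <= n)%N ->
  path_ok (content_path k) /\ parts (content_path k) =1 mem (mu k).
Proof.
elim: k => [|k IH] kn; first by rewrite subshape0.
have [ok pE] := IH (ltnW kn); have st := subshape_strict k.
have st' : strict (incr_nth (mu k) (entry_row T k)).
  by rewrite -subshapeS //; exact: subshape_strict.
rewrite content_pathS /= ok; split.
  rewrite /addable !pE /= -/(content k) (strict_incr_notin st st') andbT.
  case: posnP => //= c0; apply/mem_strict => //; by exists (entry_row T k).
move=> a; rewrite /= pE /= subshapeS //; have [->|a0] := posnP a.
  have /strictP[/negPf -> _] := st'; have /strictP[/negPf /= -> _] := st.
  by [].
by rewrite mem_incr_nth.
Qed.

Lemma entry_placeE b : entry_place U (T b) = (val b, b \in bars U).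
Proof.
rewrite /entry_place; case: pickP => [b' /eqP/val_inj|/(_ b)].
  by move/(standard_inj T_std) ->.
by rewrite eqxx.
Qed.

Lemma entry_place_box k : (k < n)%N ->
  (entry_place U k).1 = (entry_row T k, (entry_row T k + content k)%N).
Proof.
move=> kn; have [b Tb] := standard_entry T_std kn.
rewrite /content -Tb entry_placeE entry_rowE //=.
exact: (box_shape la_strict T_std b).
Qed.

Lemma signed_contentE (p : place) i a : p.1 = (i, (i + a)%N) ->
  signed_content C p ^+ 2 = (a * a.+1)%:R.
Proof.
move=> pE; rewrite /signed_content exprMn sqrr_sign mul1r sqrtCK pE /=.
by rewrite addKn.
Qed.

Lemma kappa_sqr k : (k < n)%N -> kap k ^+ 2 = (content k * (content k).+1)%:R.
Proof. by move=> kn; apply: signed_contentE; exact: entry_place_box. Qed.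

Lemma bars_diagonal k : (k < n)%N -> diagonal (entry_place U k).1 ->
  (entry_place U k).2 = false.
Proof.
move=> kn; have [b Tb] := standard_entry T_std kn; rewrite -Tb entry_placeE /=.
move=> d; apply: contraTF d => bb.
by case/andP: U_std => _ /forallP/(_ b)/implyP; apply.
Qed.

Lemma mem_addable_places nu (p : place) :
  (p \in addable_places nu) =
  [&& p.1.1 < (size nu).+1, strict (incr_nth nu p.1.1),
      p.1.2 == (p.1.1 + nth 0 nu p.1.1) & ~~ (diagonal p.1 && p.2)]%N.
Proof.
case: p => [[i j] e] /=;
  apply/allpairsPdep/and4P => [[b [e' []]]|[isz st jE d]].
  case/mapP=> i'; rewrite mem_filter mem_iota => /and3P[st _ isz] ->.
  move=> e'in [-> -> ->]; split=> //.
  by move: e'in; case: (diagonal _) => //=; rewrite inE => /eqP ->.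
exists (i, j), e; split=> //.
  apply/mapP; exists i; last by rewrite (eqP jE).
  by rewrite mem_filter st mem_iota.
by move: d; case: (diagonal _) => //=; case: e.
Qed.

Lemma addable_places_uniq nu : uniq (addable_places nu).
Proof.
apply: allpairs_uniq_dep => [|b _|[b e] [b' e'] _ _ [-> ->] //].
  rewrite map_inj_uniq ?filter_uniq ?iota_uniq // => i j.
  by case.
by case: ifP.
Qed.

Lemma entry_place_addable k : (k < n)%N ->
  entry_place U k \in addable_places (mu k).
Proof.
move=> kn; have b := entry_place_box kn.
have st : strict (incr_nth (mu k) (entry_row T k)).
  by rewrite -subshapeS //; exact: subshape_strict.
rewrite mem_addable_places b /= st ltnS (strict_incr_size st) eqxx /= -b.
by apply/negP => /andP[/(bars_diagonal kn) ->].
Qed.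

Definition addable_contents nu := [seq nth 0%N nu b.1 | b <- addable_boxes nu].

Lemma addable_contents_uniq nu : strict nu -> uniq (addable_contents nu).
Proof.
move=> st; rewrite /addable_contents -map_comp.
rewrite map_inj_in_uniq ?filter_uniq ?iota_uniq // => i j.
rewrite !mem_filter !mem_iota !add0n /= !ltnS => /andP[_ isz] /andP[_ jsz] e.
have [i0|i0] := posnP (nth 0%N nu i); last exact: (strict_nth_inj st i0).
have sz k : (k <= size nu)%N -> nth 0%N nu k = 0%N -> k = size nu.
  move=> ksz k0; apply/eqP; rewrite eqn_leq ksz leqNgt -strict_gt0 //.
  by rewrite k0.
by rewrite (sz i) // (sz j) // -e.
Qed.

Lemma addable_contentsP nu a : strict nu -> addable (mem nu) a ->
  a \in addable_contents nu.
Proof.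
move=> st /andP[/= a_nu aS].
have [i isz ia] : exists2 i, (i <= size nu)%N & nth 0%N nu i = a.
  case/predU1P: a_nu => [->|/(nthP 0%N)[i isz <-]].
    by exists (size nu); rewrite ?nth_default.
  by exists i => //; exact: ltnW.
apply/mapP; exists (i, (i + a)%N); last by rewrite ia.
apply/mapP; exists i; last by rewrite ia.
by rewrite mem_filter mem_iota strict_incr ?ia.
Qed.

(** The unbarred and barred entries of a non-diagonal box give the two factors of X^2 - a (a + 1). A
    diagonal box carries a single place, which matches the simple factor X at content 0. *)
Lemma addable_places_gpol nu : strict nu ->
  \prod_(p <- addable_places nu) ('X - (signed_content C p)%:P) =
  \prod_(a <- addable_contents nu) gpol C a.
Proof.
move=> st; rewrite /addable_places big_allpairs_dep big_map.
rewrite !big_map; apply: eq_bigr => i _ /=.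
rewrite /diagonal /= -[X in X == _]addn0 eqn_add2l eq_sym.
case ea : (nth 0%N nu i) => [|a] /=.
  by rewrite big_seq1 /signed_content /= addKn mul0n sqrtC0 mulr0 subr0.
rewrite big_cons big_seq1 /signed_content /= addKn expr0 expr1 mul1r mulN1r.
by rewrite polyCN opprK -subr_sqr -polyC_exp sqrtCK.
Qed.

Section JucysMurphyAction.
Hypothesis n0 : (0 < n)%N.
Local Notation S := (sergeev C n).
Local Notation e := (e_upto C U).
Local Notation x := (jm_x C n).
Local Notation ev z := (horner_alg z).

Lemma weight_content_path (v : S) k : (k <= n)%N ->
  (forall i, (i < k)%N -> v * x i = kap i *: v) ->
  weight (C := C) (t_ C n) v (content_path k).
Proof.
move=> kn vx; elim: k kn vx => // k IH kn vx; rewrite content_pathS /=; split.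
  by apply: IH => [|i ik]; [exact: ltnW|apply: vx; exact: ltnW].
rewrite size_content_path;
  apply: (jmx_eig (sergeev_gensP C n0) (r := sqrtC 2%:R)).
- by rewrite -expr2 sqrtCK.
- by rewrite -ltnS prednK.
- exact: kappa_sqr.
- rewrite -jm_xE; exact: vx.
Qed.

Lemma jm_x_annihilated (v : S) k : (k < n)%N ->
  (forall i, (i < k)%N -> v * x i = kap i *: v) ->
  v * ev (x k) (\prod_(p <- addable_places (mu k))
    ('X - (signed_content C p)%:P))
  = 0.
Proof.
move=> kn vx; have st := subshape_strict k.
have gP := sergeev_gensP C n0; have [tP _ _ _] := gP.
have kN : (k <= n.-1)%N by rewrite -ltnS prednK.
rewrite addable_places_gpol // jm_xE.
apply: (jmx_annihilated gP) => //; first by rewrite -expr2 sqrtCK.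
  exact: addable_contents_uniq.
have [ok pE] := content_path_ok (ltnW kn).
have := @weight_annihilated _ _ _ _ tP (content_path k).
rewrite /annihilated size_content_path => /(_ kN ok v) ann; apply: ann.
- by apply: weight_content_path => //; exact: ltnW.
- exact: addable_contents_uniq.
- move=> a; rewrite /addable !pE; exact: addable_contentsP.
Qed.

Lemma ev_prod_places z (s : seq place) :
  ev z (\prod_(p <- s) ('X - (signed_content C p)%:P)) =
  \prod_(p <- s) (z - (signed_content C p)%:A) :> S.
Proof.
rewrite rmorph_prod; apply: eq_bigr => p _.
by rewrite rmorphB /= horner_algX horner_algC.
Qed.

(** The case k = 0, separate in [e_upto], fits the recursion: the empty diagram has one addable
    place, the actual entry, so the factor is an empty product. *)
Lemma e_uptoS k : (k < n)%N -> e k.+1 = e k * e_factor C U k.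
Proof.
case: k => //= _; rewrite mul1r /e_factor.
have -> : other_places U 0 = [::]; last by rewrite !big_nil invr1 scale1r.
rewrite /other_places subshape0.
have := entry_place_addable n0; rewrite mem_addable_places subshape0 /=.
have := bars_diagonal n0; have := entry_place_box n0.
rewrite /content subshape0 nth_nil addn0;
  case: (entry_place U 0) => [[i j] d] /= [-> ->].
rewrite /diagonal /= eqxx => /(_ isT) ->;
  rewrite ltnS leqn0 => /andP[/eqP -> _].
by rewrite eqxx.
Qed.

Lemma jm_x_comm i k : (i < k < n)%N -> GRing.comm (x i) (x k).
Proof.
move=> /andP[ik kn]; rewrite !jm_xE.
by apply: (jmx_comm _ (sergeev_gensP C n0)); rewrite ik -ltnS prednK.
Qed.

Lemma prod_places k : (k < n)%N ->
  \prod_(p <- addable_places (mu k)) ('X - (signed_content C p)%:P) =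
  (\prod_(p <- other_places U k) ('X - (signed_content C p)%:P)) *
    ('X - (kap k)%:P).
Proof.
move=> kn; rewrite (bigD1_seq _ (entry_place_addable kn)) ?addable_places_uniq
  //.
by rewrite /= mulrC big_filter.
Qed.

(** Up to a scalar, the new factor is the annihilating product without x_k - kappa_k, so this
    missing factor kills the result. The earlier x_i commute with the new factor. *)
Lemma e_upto_eigen k : (k <= n)%N ->
  forall i, (i < k)%N -> e k * x i = kap i *: e k.
Proof.
elim: k => // k IH kn i; have {}IH := IH (ltnW kn).
rewrite ltnS leq_eqVlt => /predU1P[->|ik]; rewrite e_uptoS // /e_factor.
  have := jm_x_annihilated kn IH; rewrite prod_places // rmorphM /=.
  rewrite rmorphB /= horner_algX horner_algC ev_prod_places => e0.
  move: e0; set P := \prod_(_ <- _) _; set h := _^-1.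
  move: P h (x k) (e k) => P h y f /eqP;
    rewrite mulrA mulrBr mulr_algr subr_eq0.
  by move/eqP=> fP; rewrite -scalerAr -scalerAl fP !scalerA mulrC.
have xi : GRing.comm (x i) (e_factor C U k).
  apply/commr_sym/comm_scale/commr_sym/commr_prod => p _; apply: commrB.
    by apply: jm_x_comm; rewrite ik.
  exact/commr_sym/comm_scale/commr_sym/commr1.
rewrite -/(e_factor C U k) -mulrA -xi mulrA IH // scalerAl //.
Qed.

End JucysMurphyAction.
End BarredTableau.

(** The change of the quotient of two products over the parts when a box is added, cross-multiplied.
    The hypothesis [f 0 = g 0] covers a new row. *)
Lemma prod_incr_nth2 (R : comNzRingType) (f g : nat -> R) mu i :
  f 0%N = g 0%N -> (i <= size mu)%N -> let a := nth 0%N mu i in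
  (\prod_(j <- incr_nth mu i) f j) * (\prod_(j <- mu) g j) * (f a * g a.+1) =
  (\prod_(j <- mu) f j) * (\prod_(j <- incr_nth mu i) g j) * (g a * f a.+1).
Proof.
move=> fg; elim: mu i => [|m mu IH] [|i] //= ile.
- by rewrite !big_seq1 !big_nil fg; ring.
- by rewrite !big_cons; ring.
- have := IH i ile; rewrite !big_cons; move: (\prod_(j <- incr_nth _ _) f j).
  move: (\prod_(j <- incr_nth _ _) g j) => P Q e.
  rewrite (_ : f m * Q * _ * _ = f m * g m * (Q * (\prod_(j <- mu) g j) *
    (f (nth 0%N mu i) * g (nth 0%N mu i).+1))); last by ring.
  by rewrite e; ring.
Qed.

(* The eigenvalues of x_a ^ 2 at the last box of a row of length k, and at the
   box to be added to it, are part_last k and part_next k. *)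
Definition part_next (R : nzRingType) k : R := (k * k.+1)%:R.
Definition part_last (R : nzRingType) k : R := (k * k.-1)%:R.

Section TableauScalars.
Variables (n : nat) (la : seq nat) (U : barred_filling n la).
Hypotheses (la_strict : strict la) (U_std : standard_barred U).
Local Notation mu := (subshape U).
Local Notation ct := (content U).

(** For kappa_i^2 = a (a + 1), the i-th factor on the left is (u^2 - [part_last] a) (u^2 -
    [part_next] (a + 1)), while the square of the pole is (u^2 - [part_next] a) (u^2 - [part_last]
    (a + 1)). Their quotient is the change of a product over rows when part a becomes a + 1. *)
Lemma prod_pole (R : idomainType) (kap : nat -> R) (u : R) m : (m <= n)%N ->
  (forall i, (i < m)%N -> kap i ^+ 2 = part_next R (ct i)) ->
  (forall k, u ^+ 2 - part_last R k != 0) ->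
  (\prod_(i < m) (pole kap u i ^+ 2 - 2%:R * (kap i ^+ 2 + u ^+ 2))) *
    \prod_(k <- mu m) (u ^+ 2 - part_last R k) =
  (\prod_(i < m) pole kap u i ^+ 2) *
    \prod_(k <- mu m) (u ^+ 2 - part_next R k).
Proof.
move=> mn kap2 u0; elim: m mn kap2 => [|m IH] mn kap2.
  by rewrite !big_ord0 (subshape0 la_strict U_std) !big_nil.
pose f k := u ^+ 2 - part_next R k; pose g k := u ^+ 2 - part_last R k.
have st := subshape_strict la_strict U_std m.
have st' := subshape_strict la_strict U_std m.+1.
have muS := subshapeS la_strict U_std mn; rewrite muS in st'.
have den0 : \prod_(k <- mu m) g k != 0.
  by rewrite prodf_seq_neq0; apply/allP => k _ /=; exact: u0.
have := IH (ltnW mn) (fun i im => kap2 i (ltnW im)); rewrite -/f -/g.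
rewrite !big_ord_recr /= muS; set D := \prod_(i < m) _;
  set P := \prod_(i < m) _.
move=> DP.
have fg : f 0%N = g 0%N by rewrite /f /g /part_next /part_last !mul0n.
have := prod_incr_nth2 fg (strict_incr_size st'); rewrite /= -/(content U m).
have pE : pole kap u m ^+ 2 = f (ct m) * g (ct m).+1.
  rewrite /pole kap2 // /f /g /part_last /= [((ct m).+1 * _)%N]mulnC.
  by rewrite -/(part_next R (ct m)); ring.
have dE : pole kap u m ^+ 2 - 2%:R * (kap m ^+ 2 + u ^+ 2) =
    g (ct m) * f (ct m).+1.
  rewrite /pole kap2 // /f /g /part_next /part_last.
  case: (ct m) => [|a] /=; rewrite !natrM -!natr1; by ring.
rewrite dE pE => e; apply: (mulfI den0).
transitivity ((D * \prod_(k <- mu m) g k) *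
  \prod_(k <- incr_nth (mu m) (entry_row (entries U) m)) g k *
    (g (ct m) * f (ct m).+1)).
  by rewrite /g; ring.
move: DP e; rewrite -/(\prod_(j <- mu m) g j).
move: (\prod_(k <- mu m) f k) (\prod_(k <- mu m) g k) => F G DP e.
rewrite DP; move: e; move: (\prod_(j <- _) _) (\prod_(j <- _) _) => F' G' e.
transitivity (P * (F * G' * (g (ct m) * f (ct m).+1))); first by ring.
by rewrite -e; ring.
Qed.

Section Numerator.
Variables (R : comNzRingType) (k : nat).

(* u * prod_(j <- mu) (u ^ 2 - part_next j) divided by u - h, where h is the
   signed content of the entry k. *)
Definition numer (u h : R) : R :=
  (if ct k == 0%N then 1 else u * (u + h)) *
  \prod_(j <- mu k | j != ct k) (u ^+ 2 - part_next R j).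

Lemma content_mem : ct k != 0%N -> ct k \in mu k.
Proof. by rewrite -lt0n => c0; apply/mem_strict => //;
  exists (entry_row (entries U) k). Qed.

Lemma subshape_notin0 : 0%N \notin mu k.
Proof. by have /strictP[] := subshape_strict la_strict U_std k. Qed.

Lemma numerP (u h : R) : h ^+ 2 = part_next R (ct k) -> (ct k = 0%N -> h = 0) ->
  (u - h) * numer u h = u * \prod_(j <- mu k) (u ^+ 2 - part_next R j).
Proof.
move=> h2 h0; have uq := strict_uniq (subshape_strict la_strict U_std k).
rewrite /numer; case: eqP => [c0|/eqP c0].
  rewrite h0 // subr0 mul1r; congr (_ * _); rewrite big_mkcond big_seq.
  rewrite [RHS]big_seq; apply: eq_bigr => j jm; case: eqP => // jc.
  by have := subshape_notin0; rewrite -c0 -jc jm.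
by rewrite (bigD1_seq (ct k) (content_mem c0) uq) /= -h2; ring.
Qed.

End Numerator.

Lemma part_last_neq (F : numFieldType) k j : (k < n)%N -> j \in mu k ->
  part_next F (ct k) - part_last F j != 0.
Proof.
move=> kn jmu; have st := subshape_strict la_strict U_std k.
have st' : strict (incr_nth (mu k) (entry_row (entries U) k)).
  by rewrite -subshapeS //; exact: subshape_strict.
have := strict_incr_notin st st'; rewrite -/(ct k) => cS.
have j0 : (0 < j)%N by rewrite lt0n;
  apply: contraNneq (subshape_notin0 k) => <-.
rewrite subr_eq0 /part_next /part_last eqr_nat; apply: contra cS => /eqP e.
suff -> : (ct k).+1 = j by [].
by move: e; rewrite -{1 2}(prednK j0) /=; nia.
Qed.

(** The scalar of one evaluation, at u = h, is the quotient of two consecutive values of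
    [hook_prod]; hence the scalars telescope to the constant of Schur's formula. *)
Lemma hook_prod_numer (F : numFieldType) k (h : F) : (k < n)%N ->
  h ^+ 2 = part_next F (ct k) ->
  hook_prod F (mu k) * numer k h h =
  hook_prod F (mu k.+1) * \prod_(j <- mu k) (h ^+ 2 - part_last F j).
Proof.
move=> kn h2; have st := subshape_strict la_strict U_std k.
have uq := strict_uniq st.
have st' : strict (incr_nth (mu k) (entry_row (entries U) k)).
  by rewrite -subshapeS //; exact: subshape_strict.
rewrite subshapeS // hook_prod_incr // -/(ct k) -[RHS]mulrA; congr (_ * _).
have stepE : \prod_(j <- mu k | j != ct k) (h ^+ 2 - part_next F j) =
    \prod_(j <- mu k | j != ct k) hook_step F (ct k) j *
    \prod_(j <- mu k | j != ct k) (h ^+ 2 - part_last F j).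
  rewrite -big_split /= big_seq_cond [RHS]big_seq_cond; apply: eq_bigr => j.
  move=> /andP[jmu jc]; have := part_last_neq F kn jmu; rewrite -h2 h2.
  have j0 : (0 < j)%N by rewrite lt0n;
    apply: contraNneq (subshape_notin0 k) => <-.
  have -> : part_last F j = j%:R * (j%:R - 1).
    by rewrite /part_last natrM -subn1 natrB.
  have -> : part_next F j = j%:R *
    (j%:R + 1) by rewrite /part_next natrM -natr1.
  have -> : part_next F (ct k) = (ct k)%:R * ((ct k)%:R + 1).
    by rewrite /part_next natrM -natr1.
  rewrite /hook_step -natr1; move: ((ct k)%:R : F) (j%:R : F) => x y.
  rewrite (_ : x * (x + 1) - y * (y - 1) = (x + 1 - y) * (x + y)); last by ring.
  rewrite mulf_eq0 negb_or => /andP[n1 n2]; field.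
  by rewrite n1 n2.
rewrite /numer stepE; case: eqP => [c0|/eqP c0].
  have -> : \prod_(j <- mu k) (h ^+ 2 - part_last F j) =
     \prod_(j <- mu k | j != ct k) (h ^+ 2 - part_last F j).
    rewrite [RHS]big_mkcond big_seq [RHS]big_seq; apply: eq_bigr => j jm.
    by case: eqP => // jc; have := subshape_notin0 k; rewrite -c0 -jc jm.
  by rewrite c0; ring.
rewrite [in RHS](bigD1_seq (ct k) (content_mem c0) uq) /=.
(* Both sides are 2 a (a + 1) for a = [ct k]: the factor that remains from u^2 - h^2 after division
   by u - h supplies the a + 1 of [hook_prod_incr]. *)
have -> : h * (h + h) = (ct k).+1%:R * (h ^+ 2 - part_last F (ct k)).
  rewrite mulrDr -expr2 h2 /part_next /part_last.
  by case: (ct k) c0 => // a _ /=; rewrite !natrM -!natr1; ring.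
by ring.
Qed.

End TableauScalars.

(** * Consecutive evaluations *)

(* An alias of {mpoly A[n]} carrying its algebra structure over {mpoly C[n]}. *)
Definition mpoly_alg (C : numClosedFieldType) (A : algType C) (n : nat) :
  Type :=
  {mpoly A[n]}.

Section MpolyAlgebra.
Variables (C : numClosedFieldType) (A : algType C) (n : nat).
Local Notation K := {mpoly C[n]}.
Local Notation B := (mpoly_alg A n).

HB.instance Definition _ := GRing.NzRing.on B.

Definition mpoly_scale (D : K) (p : B) : B := scalar_mpoly A D * p.

Lemma scalar_mpolyM : {morph @scalar_mpoly C A n : D E / D * E}.
Proof. by move=> D E; rewrite /scalar_mpoly rmorphM. Qed.
Lemma scalar_mpolyD : {morph @scalar_mpoly C A n : D E / D + E}.
Proof. by move=> D E; rewrite /scalar_mpoly rmorphD. Qed.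
Lemma scalar_mpoly1 : scalar_mpoly A (1 : K) = 1.
Proof. by rewrite /scalar_mpoly rmorph1. Qed.

Lemma mpoly_scaleA D E (p : B) :
  mpoly_scale D (mpoly_scale E p) = mpoly_scale (D * E) p.
Proof. by rewrite /mpoly_scale scalar_mpolyM -mulrA. Qed.
Lemma mpoly_scale1 : left_id 1 mpoly_scale.
Proof. by move=> p; rewrite /mpoly_scale scalar_mpoly1 mul1r. Qed.
Lemma mpoly_scaleDr : right_distributive mpoly_scale +%R.
Proof. by move=> D p q; rewrite /mpoly_scale mulrDr. Qed.
Lemma mpoly_scaleDl (p : B) : {morph mpoly_scale^~ p : D E / D + E}.
Proof. by move=> D E; rewrite /mpoly_scale scalar_mpolyD mulrDl. Qed.

HB.instance Definition _ := GRing.Zmodule_isLmodule.Build K B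
  mpoly_scaleA mpoly_scale1 mpoly_scaleDr mpoly_scaleDl.

Lemma mpoly_scaleAl (D : K) (p q : B) : D *: (p * q) = (D *: p) * q.
Proof. exact: mulrA. Qed.

HB.instance Definition _ := GRing.Lmodule_isLalgebra.Build K B mpoly_scaleAl.

Lemma mpoly_scaleAr (D : K) (p q : B) : D *: (p * q) = p * (D *: q).
Proof.
rewrite -[LHS]/(scalar_mpoly A D * (p * q)) -[RHS]/(p * (scalar_mpoly A D * q)).
by rewrite !mulrA scalar_mpoly_comm.
Qed.

HB.instance Definition _ := GRing.Lalgebra_isAlgebra.Build K B mpoly_scaleAr.

Lemma mpoly_algE (D : K) (p : B) : D *: p = scalar_mpoly A D * p.
Proof. by []. Qed.

Definition mpoly_const (a : A) : B := a%:MP.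

Variables (i : 'I_n) (z : C).

Definition subst_scalars (D : K) : K := subst i z D.
Definition subst_alg (p : B) : B := subst i z%:A p.

Lemma subst_scalarsB : {morph subst_scalars : p q / p - q}.
Proof. exact: mmapB. Qed.
Lemma subst_scalarsM : GRing.monoid_morphism subst_scalars.
Proof.
split; first by rewrite -mpolyC1; exact: mmapC.
by apply: substM => y; rewrite mulrC.
Qed.

HB.instance Definition _ := GRing.isZmodMorphism.Build K K subst_scalars
  subst_scalarsB.
HB.instance Definition _ := GRing.isMonoidMorphism.Build K K subst_scalars
  subst_scalarsM.

Lemma subst_algB : {morph subst_alg : p q / p - q}.
Proof. exact: mmapB. Qed.
Lemma subst_algM : GRing.monoid_morphism subst_alg.
Proof.
split; first by rewrite -[1]/(1 : {mpoly A[n]}) -mpolyC1; exact: mmapC.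
by apply: substM => y; rewrite mulr_algl mulr_algr.
Qed.

HB.instance Definition _ := GRing.isZmodMorphism.Build B B subst_alg subst_algB.
HB.instance Definition _ := GRing.isMonoidMorphism.Build B B subst_alg
  subst_algM.

Lemma subst_algZ D p : subst_alg (D *: p) = subst_scalars D *: subst_alg p.
Proof.
have [_ sM] := subst_algM.
have e : subst_alg (scalar_mpoly A D : B) = scalar_mpoly A (subst_scalars D).
  exact: subst_scalar.
by rewrite [RHS]mpoly_algE -e -sM.
Qed.

Lemma subst_scalarsC (h : C) : subst_scalars h%:MP = h%:MP.
Proof. exact: mmapC. Qed.
Lemma subst_algC (a : A) : subst_alg (mpoly_const a) = mpoly_const a.
Proof. exact: mmapC. Qed.

Lemma subst_scalarsX (j : 'I_n) :
  subst_scalars 'X_j = if j == i then z%:MP else 'X_j.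
Proof. by rewrite /subst_scalars /subst mmapX mmap1U. Qed.

End MpolyAlgebra.

Section Morphisms.
Variables (B B' : nzRingType) (f : {rmorphism B -> B'}).
Variables (N : nat) (t c : nat -> B).

Lemma transposition_morph i k :
  f (transposition t i k) = transposition (f \o t) i k.
Proof.
elim: k => [|k IH]; first by rewrite !transposition_ge ?rmorph0.
have [->|ik] := eqVneq i k; first by rewrite !transpositionSn.
by rewrite !transpositionS // rmorphN !rmorphM IH.
Qed.

Lemma jm_morph k : f (jm t k) = jm (f \o t) k.
Proof.
rewrite !jm_sum rmorph_sum; apply: eq_bigr => i _; exact: transposition_morph.
Qed.

Lemma anti_morph x y : anti x y -> anti (f x) (f y).
Proof. by rewrite /anti -!rmorphM => ->; rewrite rmorphN. Qed.

Lemma sergeev_gens_morph : sergeev_gens N t c ->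
  sergeev_gens N (f \o t) (f \o c).
Proof.
case=> [[t2 tb ta] c2 ca tca]; split; first split=> /=.
- by move=> k kN; rewrite -rmorphM t2 // rmorph1.
- by move=> k kN; rewrite -!rmorphM tb.
- by move=> j k jk; apply/anti_morph/ta.
- by move=> a aN; rewrite /= -rmorphM c2 // rmorphN rmorph1.
- by move=> a b aN bN ab; apply/anti_morph/ca.
- by move=> k a kN aN; apply/anti_morph/tca.
Qed.

End Morphisms.

Section SemilinearMorphisms.
Variables (K K' : comNzRingType) (B : algType K) (B' : algType K').
Variables (g : {rmorphism K -> K'}) (f : {rmorphism B -> B'}).
Hypothesis fZ : forall h b, f (h *: b) = g h *: f b.
Variables (t c : nat -> B) (r : K) (kap : nat -> K) (u : K).

Lemma jmx_morph k : f (jmx t c r k) = jmx (f \o t) (f \o c) (g r) k.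
Proof. by rewrite !jmxE fZ rmorphM jm_morph. Qed.

Lemma pole_morph i : g (pole kap u i) = pole (g \o kap) (g u) i.
Proof. by rewrite /pole rmorphB !rmorphXn. Qed.

Lemma phi_num_morph i k : f (phi_num t c r kap u i k) =
  phi_num (f \o t) (f \o c) (g r) (g \o kap) (g u) i k.
Proof. by rewrite !phi_numE fZ rmorphM rmorphB !fZ transposition_morph. Qed.

(** Semilinearity is the right generality for the substitution u_m = kappa_m, which acts on the
    scalars as well. *)
Lemma phi_prod_morph k j : f (phi_prod t c r kap u k j) =
  phi_prod (f \o t) (f \o c) (g r) (g \o kap) (g u) k j.
Proof.
elim: j => [|j IH] /=; first by rewrite rmorph1.
by rewrite rmorphM rmorphD fZ rmorph1 IH phi_num_morph pole_morph.
Qed.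

End SemilinearMorphisms.

(** * Reordering the lexicographic product by columns *)

Section ColumnOrder.
Variable B : nzRingType.

Lemma prod_split_comm (R p : nat -> B) k :
  (forall i a, (i < a < k)%N -> GRing.comm (p i) (R a)) ->
  \prod_(0 <= a < k) (R a * p a) =
  (\prod_(0 <= a < k) R a) * \prod_(0 <= a < k) p a.
Proof.
elim: k => [|k IH] pR; first by rewrite !big_geq // mulr1.
rewrite !big_nat_recr //= IH => [|i a /andP[ia ak]]; last first.
  by apply: pR; rewrite ia ltnW.
rewrite -!mulrA; congr (_ * _); rewrite !mulrA; congr (_ * _).
apply/commr_sym; rewrite big_nat; apply: commr_prod => i /andP[_ ik].
by apply/commr_sym/pR; rewrite ik ltnSn.
Qed.

(* The lexicographic order can be replaced by the order of the second indices,
   as G i k is only moved across G a b with i < a < b < k. *)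
Lemma prod_lex_columns (G : nat -> nat -> B) n :
  (forall i a b k, (i < a < b)%N -> (b < k < n)%N ->
    GRing.comm (G i k) (G a b)) ->
  \prod_(0 <= a < n) \prod_(a.+1 <= b < n) G a b =
  \prod_(0 <= b < n) \prod_(0 <= a < b) G a b.
Proof.
elim: n => [|n IH] comG; first by rewrite !big_geq.
rewrite big_nat_recr //= [X in _ * X]big_geq // mulr1.
rewrite [RHS]big_nat_recr //= -IH; last first.
  by move=> i a b k iab /andP[bk kn]; apply: comG => //; rewrite bk (leqW kn).
rewrite -prod_split_comm; last first.
  move=> i a /andP[ia an]; rewrite big_nat; apply: commr_prod => b /andP[ab bn].
  by apply: comG; rewrite ?ia ?ab ?bn ?ltnSn.
rewrite big_nat [RHS]big_nat; apply: eq_bigr => a /andP[_ an].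
by rewrite big_nat_recr.
Qed.

End ColumnOrder.

(** This makes the denominators of e_U non-zero. The square gives the content and hence the row, and
    the sign gives the bar; on the diagonal the sign is lost, but there no bar is allowed. *)
Lemma signed_content_inj (C : numClosedFieldType) nu (p p' : place) :
  strict nu ->
  p \in addable_places nu -> p' \in addable_places nu ->
  signed_content C p = signed_content C p' -> p = p'.
Proof.
case: p p' => [[i j] e] [[i' j'] e'] st; rewrite !mem_addable_places /=.
move=> /and4P[isz _ /eqP jE d] /and4P[i'sz _ /eqP j'E d'] pE.
pose a := nth 0%N nu i; pose a' := nth 0%N nu i'.
have aa' : a = a'.
  have := congr1 (fun z => z ^+ 2) pE.
  rewrite (@signed_contentE C _ i a) ?jE // (@signed_contentE C _ i' a') ?j'E
    //.
  by move/eqP; rewrite eqr_nat => /eqP; nia.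
have ii' : i = i'.
  have [a0|a0] := posnP a; last exact: (strict_nth_inj st a0).
  have sz k : (k < (size nu).+1)%N -> nth 0%N nu k = 0%N -> k = size nu.
    move=> ksz k0; apply/eqP; rewrite eqn_leq -ltnS ksz leqNgt -strict_gt0 //.
    by rewrite k0.
  by rewrite (sz i) // (sz i') // -/a' -aa'.
rewrite -ii' jE j'E -ii'; congr (_, _).
move: pE d d'; rewrite /signed_content /diagonal /= jE j'E -ii' addKn.
have dg y : (i == (i + y)%N) =
  (y == 0%N) by rewrite -[X in X == _]addn0 eqn_add2l eq_sym.
rewrite !dg.
case: posnP => [-> /= _ | a0 /eqP]; first by case: e e' => [] [].
have sq0 : sqrtC (a * a.+1)%:R != 0 :> C.
  by rewrite sqrtC_eq0 pnatr_eq0 muln_eq0 orbF -lt0n.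
rewrite -/a (inj_eq (mulIf sq0)) => /eqP.
case: e e' => [] [] //=; rewrite expr0 expr1 => /eqP; rewrite ?[1 == _]eq_sym.
  by rewrite -subr_eq0 -opprD oppr_eq0 -mulr2n pnatr_eq0.
by rewrite -subr_eq0 -opprD oppr_eq0 -mulr2n pnatr_eq0.
Qed.

Lemma scaler_cross (K : comNzRingType) (V : lmodType K) (p a b d g : K)
    (x y : V) : p *: y = g *: x -> p * a * b = d * g ->
  p *: (a *: (b *: x)) = p *: (d *: y).
Proof.
move=> yx e; transitivity (d *: (g *: x)); first by rewrite !scalerA e.
by rewrite -yx !scalerA mulrC.
Qed.

Section PhiComm.
Variables (K : comNzRingType) (B : algType K) (N : nat) (t c : nat -> B)
  (r : K).
Hypothesis gensP : sergeev_gens N t c.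

Lemma anti_scaleB (h h' : K) (x y z : B) : anti x y -> anti x z ->
  anti x (h *: y - h' *: z).
Proof.
by move=> xy xz; rewrite /anti mulrBr mulrBl -!scalerAr -!scalerAl xy xz
  !scalerN opprB opprK addrC.
Qed.

Lemma phi_num_comm kap u kap' u' i a b k : (i < a < b)%N -> (b < k <= N)%N ->
  GRing.comm (phi_num t c r kap u i k) (phi_num t c r kap' u' a b).
Proof.
move=> /andP[ia ab] /andP[bk kN].
have bN : (b <= N)%N by rewrite ltnW // (leq_trans bk).
have aN : (a <= N)%N by rewrite ltnW // (leq_trans ab).
have iN : (i <= N)%N by rewrite ltnW // (leq_trans ia).
have [_ _ cc _] := gensP.
rewrite !phi_numE; apply/comm_scale/commr_sym/comm_scale; apply: commrM.
  apply: comm_even; first by apply: (transposition_nested gensP) => //;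
    rewrite bk.
  by apply: anti_scaleB; apply: (transposition_c gensP).
apply: comm_even.
  by apply/anti_sym/anti_scaleB; apply: (transposition_c gensP).
apply/anti_sym/anti_scaleB; apply/anti_sym/anti_scaleB;
  by apply: cc => //; lia.
Qed.

End PhiComm.

HB.instance Definition _ (C : numClosedFieldType) (A : algType C) n :=
  GRing.isZmodMorphism.Build A (mpoly_alg A n) (@mpoly_const C A n)
    (@raddfB _ _ (@mpolyC n A)).
HB.instance Definition _ (C : numClosedFieldType) (A : algType C) n :=
  GRing.isMonoidMorphism.Build A (mpoly_alg A n) (@mpoly_const C A n)
    (conj (erefl _) (@mpolyCM n A)).

(** * The rational functions between consecutive evaluations *)

Section EvaluationStates.
Variables (C : numClosedFieldType) (n : nat) (la : seq nat).
Variable U : barred_filling n la.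
Hypotheses (n0 : (0 < n)%N) (la_strict : strict la) (U_std : standard_barred U).
Local Notation S := (sergeev C n).
Local Notation K := {mpoly C[n]}.
Local Notation B := (mpoly_alg S n).
Local Notation kap := (kappa C U).
Local Notation mu := (subshape U).

Definition tB : nat -> B := fun k => mpoly_const n (t_ C n k).
Definition cB : nat -> B := fun k => mpoly_const n (c_ C n k).
Definition rK : K := (sqrtC 2%:R)%:MP.

(* The first m variables have been replaced by their values. *)
Definition var (m k : nat) : K :=
  if (k < m)%N then (kap k)%:MP
  else if insub k is Some i then 'X_(i : 'I_n) else 0.

Definition col_num m b : B := phi_prod tB cB rK (var m) (var m b) b b.
Definition col_den m b : K := \prod_(a < b) pole (var m) (var m b) a.

Definition state_coef m : S := hook_prod C (mu m) *: e_upto C U m.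

(** The function after m evaluations: the columns below m have merged into a constant, the others
    still contain their variables. These states are the witnesses of the final theorem. *)
Definition state m : ratfun S n :=
  (mpoly_const n (state_coef m) * \prod_(m <= b < n) col_num m b : B,
   \prod_(m <= b < n) col_den m b).

Lemma mpoly_constZ (A : algType C) (h : C) (a : A) :
  mpoly_const n (h *: a) = h%:MP_[n] *: mpoly_const n a.
Proof.
rewrite mpoly_algE /scalar_mpoly map_mpolyC /= -[RHS]mpolyCM.
by rewrite mulr_algl.
Qed.

Lemma sergeev_gens_const : sergeev_gens n.-1 tB cB.
Proof. exact: sergeev_gens_morph (mpoly_const n) _ _ _ (sergeev_gensP C n0).
  Qed.

Lemma jmx_const k : jmx tB cB rK k = mpoly_const n (jm_x C n k).
Proof.
rewrite jm_xE; apply/esym.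
exact: (@jmx_morph _ _ _ _ (@mpolyC n C) (@mpoly_const C S n)
  (@mpoly_constZ S)).
Qed.

Lemma rK2 : rK * rK = 2%:R.
Proof. by rewrite -mpolyCM -expr2 sqrtCK mpolyC_nat. Qed.

Lemma rKV : rK * ((sqrtC 2%:R)^-1)%:MP = 1.
Proof. by rewrite -mpolyCM divff ?mpolyC1 // sqrtC_eq0 pnatr_eq0. Qed.

Section Step.
Variable m : nat.
Hypothesis mn : (m < n)%N.
Local Notation i0 := (Ordinal mn).

Lemma var_lt i : (i < m)%N -> var m i = (kap i)%:MP.
Proof. by rewrite /var => ->. Qed.

Lemma var_self : var m m = 'X_i0.
Proof. by rewrite /var ltnn insubT. Qed.

Lemma subst_var k : subst_scalars i0 (kap m) (var m k) = var m.+1 k.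
Proof.
rewrite /var [(k < m.+1)%N]ltnS [(k <= m)%N]leq_eqVlt;
  case: (ltngtP k m) => [km|km|->] /=.
- by rewrite subst_scalarsC.
- case: insubP => [j _ jk|_]; last by rewrite rmorph0.
  by rewrite subst_scalarsX -val_eqE /= jk gtn_eqF.
- by rewrite insubT subst_scalarsX eqxx.
Qed.

Lemma subst_col_num b : subst_alg i0 (kap m) (col_num m b) = col_num m.+1 b.
Proof.
rewrite /col_num (@phi_prod_morph _ _ _ _ (subst_scalars i0 (kap m))
  (subst_alg i0 (kap m)) (@subst_algZ _ _ _ i0 (kap m))).
have -> : subst_alg i0 (kap m) \o tB = tB by apply/funext => k;
  exact: subst_algC.
have -> : subst_alg i0 (kap m) \o cB = cB by apply/funext => k;
  exact: subst_algC.
have -> : subst_scalars i0 (kap m) \o var m = var m.+1.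
  by apply/funext => k; exact: subst_var.
exact: (f_equal2 (fun h v => phi_prod tB cB h (var m.+1) v b b)
  (subst_scalarsC i0 (kap m) (sqrtC 2%:R)) (subst_var b)).
Qed.

Lemma subst_col_den b :
  subst_scalars i0 (kap m) (col_den m b) = col_den m.+1 b.
Proof.
rewrite (rmorph_prod (subst_scalars _ _)); apply: eq_bigr => a _.
by rewrite /pole rmorphB !rmorphXn /= !subst_var.
Qed.

End Step.

Lemma sqrX_sub_neq0 (i : 'I_n) (p : K) : (forall v : 'I_n -> C, exists h : C,
    p.@[fun j => if j == i then h else v j] != h ^+ 2) -> p - 'X_i ^+ 2 != 0.
Proof.
move=> H; have [h] := H (fun=> 0); apply: contraNneq => /eqP.
rewrite subr_eq0 => /eqP ->.
by rewrite rmorphXn /= mevalXU eqxx.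
Qed.

Lemma exists_sqr_neq (h : C) : exists z : C, h != z ^+ 2.
Proof.
have [->|h0] := eqVneq h 0; last by exists 0; rewrite expr0n.
by exists 1; rewrite expr1n eq_sym oner_eq0.
Qed.

Lemma pole_neq0 m a b : (a < b < n)%N -> (m <= b)%N ->
  pole (var m) (var m b) a != 0.
Proof.
move=> /andP[ab bn] mb; have -> : var m b = 'X_(Ordinal bn).
  by rewrite /var ltnNge mb insubT.
have an : (a < n)%N by exact: ltn_trans bn.
rewrite /pole; apply: sqrX_sub_neq0 => v; rewrite /var; case: ifP => _.
  have [z zP] := exists_sqr_neq (kap a ^+ 2).
  by exists z; rewrite rmorphXn /= mevalC.
have [z zP] := exists_sqr_neq (v (Ordinal an) ^+ 2); exists z.
rewrite insubT rmorphXn /= mevalXU -val_eqE /= ltn_eqF //.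
Qed.

Lemma state_den_neq0 m : \prod_(m <= b < n) col_den m b != 0.
Proof.
rewrite prodf_seq_neq0; apply/allP => b;
  rewrite mem_index_iota => /andP[mb bn] /=.
by apply/prodf_neq0 => a _; apply: pole_neq0; rewrite ?ltn_ord.
Qed.

Lemma state_coef_eigen m i : (m <= n)%N -> (i < m)%N ->
  state_coef m * jm_x C n i = kap i *: state_coef m.
Proof.
move=> mn im; rewrite /state_coef -scalerAl (e_upto_eigen C la_strict U_std n0)
  //.
by rewrite !scalerA mulrC.
Qed.

Lemma col_den_neq0 m : (m < n)%N -> col_den m m != 0.
Proof.
by move=> mn; apply/prodf_neq0 => a _; apply: pole_neq0; rewrite ?ltn_ord.
Qed.

Section EvaluationStep.
Variable m : nat.
Hypothesis mn : (m < n)%N.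
Local Notation i0 := (Ordinal mn).
Local Notation w := (mpoly_const n (state_coef m)).
Local Notation u := (var m m).

Definition other_contents : seq C :=
  [seq signed_content C p | p <- other_places U m].

(** With the actual content first, [div_diff] unfolds at u = kappa_m to the product over the other
    contents alone. *)
Definition poles : seq K := [seq h%:MP | h <- kap m :: other_contents].

Lemma prod_sub_const (s : seq C) :
  \prod_(b <- [seq h%:MP | h <- s]) (jmx tB cB rK m - b%:A) =
  mpoly_const n (\prod_(h <- s) (jm_x C n m - h%:A)).
Proof.
rewrite rmorph_prod big_map; apply: eq_bigr => h _.
by rewrite rmorphB /= jmx_const; congr (_ - _); rewrite mpoly_constZ.
Qed.

Lemma poles_annihilate : w * \prod_(b <- poles) (jmx tB cB rK m - b%:A) = 0.
Proof.
rewrite prod_sub_const -rmorphM big_cons big_map.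
have := jm_x_annihilated la_strict U_std n0 mn
  (fun i im => state_coef_eigen (ltnW mn) im).
rewrite (prod_places C la_strict U_std mn) mulrC (rmorphM (horner_alg _)) /=
  ev_prod_places.
by rewrite rmorphB /= horner_algX horner_algC => ->; rewrite rmorph0.
Qed.

Lemma step_fusion :
  (\prod_(i < m) pole (var m) u i * \prod_(b <- poles) (u - b)) *:
    (w * col_num m m) =
  (u * \prod_(i < m) (pole (var m) u i ^+ 2 -
     2%:R * (var m i ^+ 2 + u ^+ 2))) *:
    (w * div_diff u poles (jmx tB cB rK m)).
Proof.
apply: (jmx_fusion sergeev_gens_const rK2 rKV) => [|i im|];
  last exact: poles_annihilate.
  by rewrite -ltnS prednK.
rewrite jmx_const -rmorphM state_coef_eigen ?(ltnW mn) // var_lt //.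
exact: mpoly_constZ.
Qed.

Lemma subst_div_diff :
  subst_alg i0 (kap m) (div_diff u poles (jmx tB cB rK m)) =
  mpoly_const n (\prod_(p <- other_places U m)
    (jm_x C n m - (signed_content C p)%:A)).
Proof.
rewrite /= rmorphD /= subst_algZ prod_sub_const /= subst_algC big_map.
rewrite (_ : subst_scalars _ _ _ = 0) ?scale0r ?add0r //.
by rewrite rmorphB /= subst_scalarsC subst_var /var ltnSn subrr.
Qed.

Lemma u_sqr_neq0 k : u ^+ 2 - part_last K k != 0.
Proof.
rewrite -oppr_eq0 opprB (var_self mn); apply: sqrX_sub_neq0 => v.
have [z zP] := exists_sqr_neq (part_last C k).
by exists z; rewrite /part_last rmorph_nat.
Qed.

Lemma scalar_step : \prod_(i < m) (pole (var m) u i ^+ 2 -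
     2%:R * (var m i ^+ 2 + u ^+ 2)) *
    \prod_(j <- mu m) (u ^+ 2 - part_last K j) =
  col_den m m ^+ 2 * \prod_(j <- mu m) (u ^+ 2 - part_next K j).
Proof.
rewrite /col_den -prodrXl; apply: (prod_pole la_strict U_std).
- exact: ltnW.
- move=> i im; rewrite var_lt // -rmorphXn /= (kappa_sqr C la_strict U_std) //.
    by rewrite /part_next rmorph_nat.
  exact: ltn_trans im mn.
- exact: u_sqr_neq0.
Qed.

Definition den_factor : K :=
  \prod_(j <- mu m) (u ^+ 2 - part_last K j) *
  \prod_(h <- other_contents) (u - h%:MP).

Definition num_factor : K := numer U m u (kap m)%:MP.

Lemma u_sub_neq0 h : u - h%:MP != 0.
Proof.
rewrite (var_self mn); apply/eqP => /(congr1 (meval (fun=> h + 1))).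
rewrite rmorphB /= mevalXU mevalC rmorph0 addrAC subrr add0r.
by move/eqP; rewrite oner_eq0.
Qed.

(** Column m gets a representation whose denominator lacks the factor u - kappa_m. This factor of
    the annihilating polynomial cancels against the one in u prod (u^2 - [part_next] j), by
    [numerP]. *)
Lemma step_value :
  col_den m m *: (num_factor *: (w * div_diff u poles (jmx tB cB rK m))) =
  den_factor *: (w * col_num m m).
Proof.
have kap2 : (kap m)%:MP ^+ 2 = part_next K (content U m).
  rewrite -rmorphXn /= (kappa_sqr C la_strict U_std mn).
  by rewrite /part_next rmorph_nat.
have kap0 : content U m = 0%N -> (kap m)%:MP = 0 :> K.
  by move=> c0; apply/eqP; rewrite -sqrf_eq0 kap2 c0 /part_next mul0n.
have numE := numerP la_strict U_std u kap2 kap0.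
have fus := step_fusion; have sc := scalar_step.
have pE : \prod_(b <- poles) (u - b) =
    (u - (kap m)%:MP) * \prod_(h <- other_contents) (u - h%:MP).
  by rewrite /poles /= big_cons big_map.
(* The product p contains u - kappa_m but is a non-zero polynomial, so it can be cancelled before
   any value is substituted. *)
pose p := col_den m m * \prod_(b <- poles) (u - b).
have p0 : p != 0.
  rewrite mulf_neq0 ?col_den_neq0 // pE mulf_neq0 ?u_sub_neq0 //.
  by rewrite prodf_seq_neq0; apply/allP => h _; exact: u_sub_neq0.
apply: (scalar_mpoly_inj p0); move: fus; rewrite -/(col_den m m) -/p => fus.
suff e : p * col_den m m * num_factor =
    den_factor * (u * \prod_(i < m) (pole (var m) u i ^+ 2 -
      2%:R * (var m i ^+ 2 + u ^+ 2))).
  exact: (scaler_cross fus e).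
rewrite /den_factor /p pE /num_factor.
move: numE sc; move: (numer U m _ _) (\prod_(i < m) _)
  (\prod_(h <- other_contents) _).
move: (\prod_(j <- mu m) _) (\prod_(j <- mu m) _) (col_den m m) => d1 d2 cd nu
  De Ot nE sE.
transitivity (cd ^+ 2 * Ot * ((u - (kap m)%:MP) * nu)); first by ring.
by rewrite nE; transitivity (Ot * u * (cd ^+ 2 * d2)); [ring|rewrite -sE; ring].
Qed.

End EvaluationStep.

End EvaluationStates.

Lemma numer_morph n la (U : barred_filling n la) (R R' : comNzRingType)
    (f : {rmorphism R -> R'}) k u h : f (numer U k u h) = numer U k (f u) (f h).
Proof.
rewrite /numer rmorphM rmorph_prod; congr (_ * _).
  by case: ifP; rewrite ?rmorph1 // rmorphM rmorphD.
by apply: eq_bigr => j _; rewrite rmorphB rmorphXn /part_next rmorph_nat.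
Qed.

Lemma scaler_mulr (K : comNzRingType) (B : algType K) (a d e : K) (x y z : B) :
  a *: x = d *: y -> (a * e) *: (x * z) = (d * e) *: (y * z).
Proof. by move=> xy; rewrite ![_ * e]mulrC -!scalerA !(scalerAl _ _ z) xy. Qed.

Lemma scalerAr_comm (K : comNzRingType) (V : lmodType K) (h k : K) (x : V) :
  h *: (k *: x) = (k * h) *: x.
Proof. by rewrite scalerA mulrC. Qed.

(** * One evaluation step *)

Section StateEvaluation.
Variables (C : numClosedFieldType) (n : nat) (la : seq nat).
Variable U : barred_filling n la.
Hypotheses (n0 : (0 < n)%N) (la_strict : strict la) (U_std : standard_barred U).
Local Notation S := (sergeev C n).
Local Notation K := {mpoly C[n]}.
Local Notation B := (mpoly_alg S n).
Local Notation kap := (kappa C U).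
Local Notation mu := (subshape U).

Variable m : nat.
Hypothesis mn : (m < n)%N.
Local Notation i0 := (Ordinal mn).
Local Notation w := (mpoly_const n (state_coef C U m)).
Local Notation u := (var C U m m).
Local Notation Q :=
  (div_diff u (poles C U m) (jmx (tB C n) (cB C n) (rK C n) m)).
Local Notation others z :=
  (\prod_(p <- other_places U m) (z - (signed_content C p)%:A)).

Definition den_value : C :=
  (\prod_(j <- mu m) (kap m ^+ 2 - part_last C j)) *
  \prod_(p <- other_places U m) (kap m - signed_content C p).

(** The regularity of the step: the content of the added box is not that of the last box of any row,
    and the other places have other signed contents. *)
Lemma den_value_neq0 : den_value != 0.
Proof.
apply: mulf_neq0; rewrite prodf_seq_neq0; apply/allP.
  move=> j jm /=; rewrite (kappa_sqr C la_strict U_std mn).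
  exact: (part_last_neq la_strict U_std).
move=> p; rewrite mem_filter => /andP[pe pa] /=.
rewrite subr_eq0; apply: contra pe => /eqP e.
apply/eqP/esym; apply: (signed_content_inj _ _ pa e).
  exact: (subshape_strict la_strict U_std).
exact: (entry_place_addable la_strict U_std mn).
Qed.

Lemma subst_u : subst_scalars i0 (kap m) u = (kap m)%:MP.
Proof. by rewrite subst_var /var ltnSn. Qed.

Lemma subst_den_factor :
  subst_scalars i0 (kap m) (den_factor C U m) = den_value%:MP.
Proof.
rewrite /den_factor /den_value rmorphM mpolyCM !rmorph_prod big_map /=.
congr (_ * _); apply: eq_bigr.
  move=> j _; rewrite !rmorphB !rmorphXn /= subst_u /part_last.
  by rewrite !rmorph_nat.
by move=> p _; rewrite !rmorphB /= subst_u subst_scalarsC.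
Qed.

Lemma subst_num_factor :
  subst_scalars i0 (kap m) (num_factor C U m) = (numer U m (kap m) (kap m))%:MP.
Proof.
rewrite /num_factor (numer_morph U (subst_scalars i0 (kap m))) /=.
by rewrite subst_u subst_scalarsC -(numer_morph U (@mpolyC n C)).
Qed.

Lemma state_coef_step :
  numer U m (kap m) (kap m) *: (state_coef C U m * others (jm_x C n m)) =
  den_value *: state_coef C U m.+1.
Proof.
rewrite /state_coef (e_uptoS C la_strict U_std n0 mn) /e_factor /den_value.
have := hook_prod_numer la_strict U_std mn (kappa_sqr C la_strict U_std mn).
have := den_value_neq0; rewrite /den_value mulf_eq0 negb_or => /andP[_].
move: (\prod_(p <- _) (kap m - _)) (\prod_(j <- mu m) _) => d d' d0 e.
rewrite -scalerAl -scalerAr !scalerA mulrC e; congr (_ *: _).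
by rewrite mulrC -mulrA mulrA; field.
Qed.

Lemma state_evaluates :
  evaluates i0 (kap m) (state C U m) (state C U m.+1).
Proof.
pose R k : B := \prod_(m.+1 <= b < n) col_num C U k b.
pose D k : K := \prod_(m.+1 <= b < n) col_den C U k b.
have sR : subst_alg i0 (kap m) (R m) = R m.+1.
  rewrite /R rmorph_prod; apply: eq_bigr => b _; exact: subst_col_num.
have sD : subst_scalars i0 (kap m) (D m) = D m.+1.
  rewrite /D rmorph_prod; apply: eq_bigr => b _; exact: subst_col_den.
have D0 : D m.+1 != 0 by exact: state_den_neq0.
have st1 : (state C U m).1 = (w * col_num C U m m) * R m :> B.
  by rewrite /state /= big_ltn // mulrA.
have st2 : (state C U m).2 = col_den C U m m * D m.
  by rewrite /state /= big_ltn.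
(* The representative required by [evaluates]: column m in the form of [step_value], the later
   columns unchanged. *)
pose Nn : B := (num_factor C U m *: (w * Q)) * R m.
pose Dd : K := den_factor C U m * D m.
have sDd : subst_scalars i0 (kap m) Dd = den_value%:MP * D m.+1.
  by rewrite /Dd rmorphM /= subst_den_factor sD.
have sNn : subst_alg i0 (kap m) Nn =
    den_value%:MP *: (mpoly_const n (state_coef C U m.+1) * R m.+1).
  rewrite /Nn rmorphM /= sR subst_algZ subst_num_factor
    (rmorphM (subst_alg i0 (kap m))) /=.
  rewrite subst_div_diff subst_algC -rmorphM -mpoly_constZ state_coef_step.
  by rewrite mpoly_constZ -scalerAl.
split; [exact: state_den_neq0|exact: state_den_neq0|exists Nn, Dd; split].
- have e : (state C U m).2 *: Nn = Dd *: ((state C U m).1 : B).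
    rewrite st1 st2; apply: scaler_mulr.
    exact: (step_value C n0 la_strict U_std mn).
  exact: e.
- have e : subst_scalars i0 (kap m) Dd != 0.
    by rewrite sDd mulf_neq0 // mpolyC_eq0 den_value_neq0.
  exact: e.
- have e : D m.+1 *: subst_alg i0 (kap m) Nn = subst_scalars i0 (kap m) Dd *:
      (mpoly_const n (state_coef C U m.+1) * R m.+1).
    rewrite sNn sDd; exact: scalerAr_comm.
  exact: e.
Qed.

End StateEvaluation.

(** * The product [Phi] as the initial state, and the conclusion *)

Lemma big_rf_mul (C : numClosedFieldType) (A : algType C) n (I : Type)
    (s : seq I) (F : I -> ratfun A n) :
  \big[@rf_mul C A n/rf_const n 1]_(i <- s) F i =
  (\prod_(i <- s) (F i).1, \prod_(i <- s) (F i).2).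
Proof.
elim: s => [|i s IH]; first by rewrite !big_nil /rf_const mpolyC1.
by rewrite !big_cons IH.
Qed.

Lemma prod_lex_pairs (R : nzRingType) n (G : nat -> nat -> R) :
  \prod_(p <- lex_pairs n) G p.1 p.2 =
  \prod_(0 <= a < n) \prod_(a.+1 <= b < n) G a b.
Proof.
have enumE (F : nat -> R) : \prod_(i <- enum 'I_n) F i = \prod_(0 <= i < n) F i.
  by rewrite -(big_map val xpredT) val_enum_ord /index_iota subn0.
rewrite /lex_pairs big_filter big_mkcond big_allpairs_dep /=.
rewrite (enumE (fun a => \prod_(b <- enum 'I_n) if (a < b)%N then G a b else
  1)).
apply: eq_bigr => a _;
  rewrite (enumE (fun b => if (a < b)%N then G a b else 1)).
by rewrite -big_mkcond [RHS](big_nat_widenl _ 0).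
Qed.

Lemma phi_prodE (K : comNzRingType) (B : algType K) (t c : nat -> B) r kap u k j
  :
  phi_prod t c r kap u k j =
  \prod_(0 <= i < j) (pole kap u i *: 1 + phi_num t c r kap u i k).
Proof.
elim: j => [|j IH]; first by rewrite big_geq.
by rewrite big_nat_recr //= IH.
Qed.

Section InitialState.
Variables (C : numClosedFieldType) (n : nat) (la : seq nat).
Variable U : barred_filling n la.
Hypotheses (n0 : (0 < n)%N) (la_strict : strict la) (U_std : standard_barred U).
Local Notation S := (sergeev C n).
Local Notation K := {mpoly C[n]}.
Local Notation B := (mpoly_alg S n).
Local Notation xvar := (var C U 0).

Let factor a b : B := pole xvar (xvar b) a *: 1 +
  phi_num (tB C n) (cB C n) (rK C n) xvar (xvar b) a b.

Lemma var0 (a : 'I_n) : xvar a = 'X_a.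
Proof. by rewrite /var /= valK. Qed.

Lemma scale_X (a : 'I_n) (p : B) : ('X_a : K) *: p = ('X_a : B) * p.
Proof. by rewrite mpoly_algE /scalar_mpoly map_mpolyX. Qed.

Lemma scalar_mpolyC (h : C) : scalar_mpoly S h%:MP = (h%:A)%:MP_[n].
Proof. by rewrite /scalar_mpoly map_mpolyC. Qed.

Lemma phi_factor (a b : 'I_n) : (a < b)%N ->
  phi C a b = (factor a b, pole xvar (xvar b) a).
Proof.
move=> ab; rewrite /phi /rf_add /rf_const /pole /= !var0 mul1r; congr (_, _).
rewrite scalar_mpoly1 mul1r mpolyC1 mulr1 -scalar_mpolyC.
have e (x y : B) (h : K) : x * (scalar_mpoly S h * y) = h *: (x * y).
  by rewrite -mpoly_algE scalerAr.
rewrite {}e /factor phi_numE /pole !var0 !scale_X.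
have -> : transposition (tB C n) a b = mpoly_const n (transp C n a b).
  by rewrite transpE // (transposition_morph (mpoly_const n)).
by apply: f_equal2 => //; rewrite mpoly_algE mulr1.
Qed.

Let gP := sergeev_gens_const C n0.

Lemma factor_comm i a b k : (i < a < b)%N -> (b < k < n)%N ->
  GRing.comm (factor i k) (factor a b).
Proof.
move=> iab /andP[bk kn]; rewrite /factor.
have sc (x : B) (h : K) : GRing.comm x (h *: 1).
  by rewrite /GRing.comm mulr_algr mulr_algl.
apply: commrD; first exact: sc.
apply/commr_sym/commrD; first exact: sc.
apply/commr_sym/(phi_num_comm _ gP) => //.
by rewrite bk -ltnS prednK.
Qed.

Lemma mem_lex_pairs p : p \in lex_pairs n -> (p.1 < p.2)%N.
Proof. by rewrite mem_filter => /andP[]. Qed.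

Lemma PhiE : Phi C n = state C U 0.
Proof.
rewrite /Phi big_rf_mul /state; apply: f_equal2.
- have -> : state_coef C U 0 = 1.
    by rewrite /state_coef (subshape0 la_strict U_std) /= scale1r.
  rewrite rmorph1 mul1r.
  transitivity (\prod_(p <- lex_pairs n) factor p.1 p.2).
    rewrite big_seq [RHS]big_seq; apply: eq_bigr => p /mem_lex_pairs p12.
    by rewrite phi_factor.
  rewrite (prod_lex_pairs n factor) prod_lex_columns; last exact: factor_comm.
  by apply: eq_bigr => b _; rewrite /col_num phi_prodE.
- pose q a b : K := pole xvar (xvar b) a.
  transitivity (\prod_(p <- lex_pairs n) q p.1 p.2).
    rewrite big_seq [RHS]big_seq; apply: eq_bigr => p /mem_lex_pairs p12.
    by rewrite phi_factor.
  rewrite (prod_lex_pairs n q) prod_lex_columns; last by move=> *; exact: mulrC.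
  by apply: eq_bigr => b _; rewrite /col_den big_mkord.
Qed.

Lemma stateE : state C U n = rf_const n (hook_prod C la *: e_tab C U).
Proof.
rewrite /state !big_geq // mulr1 /state_coef (subshapen la_strict U_std).
by [].
Qed.

End InitialState.

Theorem theorem4p1 (R : realType) (n : nat) (la : seq nat)
    (U : barred_filling n la) :
  (0 < n)%N -> strict_partition n la -> standard_barred U ->
  exists F : nat -> ratfun (sergeev R[i] n) n,
    [/\ F 0%N = Phi R[i] n,
        forall a : 'I_n, evaluates a (kappa R[i] U a) (F a) (F a.+1) &
        rf_eq (F n)
          (rf_const n (((n`!)%:R / (num_standard n la)%:R : R[i]) *:
                       e_tab R[i] U))].
Proof.
move=> n0 la_n U_std; have /andP[la_strict _] := la_n.
exists (state R[i] U); split.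
- exact/esym/PhiE.
- move=> [a an]; exact: state_evaluates.
- have := num_standard_hook R[i] la_n;
  rewrite (stateE R[i] la_strict U_std) => e.
  rewrite -e mulrAC mulfV ?mul1r; first exact: rf_eq_refl.
  (* The number g_la is non-zero because its product with [hook_prod] is n!. *)
  apply/eqP => z; move/eqP: e; rewrite z mul0r eq_sym pnatr_eq0.
  by rewrite -leqn0 leqNgt fact_gt0.
Qed.
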